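(* For the spectrum of any normal extension $L_{W_1W_2}=L_{W_1}\oplus L_{W_2}$ of the minimal operator $L_0(1,1,1)$ in $L_2(1,1,1)$ one has $$\sigma_p(L_{W_1W_2})=\sigma_p(L_{W_2}),\qquad \sigma_c(L_{W_1W_2})=\big\{[\sigma_p(L_{W_2})]^c\cap[i\mathbb R]\big\}\cup\sigma_c(L_{W_2}).$$
   Context: $H$ is a separable Hilbert space and $-\infty<a_1<a_2<b_2<a_3<+\infty$. $A_k:D(A_k)\subset H\to H$ ($k=1,2,3$) are linear selfadjoint operators with $A_1=A_1^*\le 0$, $A_2=A_2^*\ge 0$, $A_3=A_3^*\ge 0$, and $0\in\sigma_p((-A_1)^{1/2})\cap\sigma_p(A_3^{1/2})$. Put $I_1=(-\infty,a_1)$, $I_2=(a_2,b_2)$, $I_3=(a_3,\infty)$, $L_2(1,1,1)=L_2(H,I_1)\oplus L_2(H,I_2)\oplus L_2(H,I_3)$, $L_2(1,0,1)=L_2(H,I_1)\oplus 0\oplus L_2(H,I_3)$, $L_2(0,1,0)=0\oplus L_2(H,I_2)\oplus 0$. $H_{k,+}$ is $D(A_k)$ with the inner product $(f,g)_{k,+}=(A_kf,A_kg)_H+(f,g)_H$; $H_{k,-}$ is the corresponding space with negative norm (the dual of $H_{k,+}$ with respect to $H$); $\tilde A_k:H\to H_{k,-}$ is the adjoint of the continuous operator $A_k:H_{k,+}\to H$ and is an extension of $A_k$. $\tilde l_k(u_k)=u_k'+\tilde A_ku_k$ on $I_k$. The minimal operator $L_{k0}$ generated by $\tilde l_k$ is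 the closure in $L_2(H,I_k)$ of $u\mapsto u'+A_ku$ defined on finite sums $\sum_j\varphi_j(t)f_j$ with $\varphi_j\in C_0^\infty(I_k)$, $f_j\in D(A_k)$; the maximal operator $L_k$ is the adjoint of the minimal operator defined in the same way from $-u'+A_ku$. Put $L_0(1,1,1)=L_{10}\oplus L_{20}\oplus L_{30}$, $L_0(1,0,1)=L_{10}\oplus0\oplus L_{30}$, $L_0(0,1,0)=0\oplus L_{20}\oplus0$. A densely defined closed operator $N$ is normal if $D(N)=D(N^* )$ and $\|Nf\|=\|N^*f\|$ for all $f\in D(N)$. Every normal extension of $L_0(1,1,1)$ is written $L_{W_1W_2}=L_{W_1}\oplus L_{W_2}$, where $W_1,W_2$ are unitary operators in $H$; $L_{W_1}$ is a normal extension of $L_0(1,0,1)$ in $L_2(1,0,1)$, namely the restriction of $L_1\oplus0\oplus L_3$ to the elements satisfying $u_3(a_3)=W_1u_1(a_1)$, $u_1(a_1)\in\ker(-A_1)^{1/2}$, $u_3(a_3)\in\ker A_3^{1/2}$; and $L_{W_2}$ is a normal extension of $L_0(0,1,0)$ in $L_2(0,1,0)$, namely the restriction of $0\oplus L_2\oplus 0$ to the elements satisfying $u_2(b_2)=W_2u_2(a_2)$ (here $L_2$ denotes the maximal operator on $I_2$). $\sigma_p$ and $\sigma_c$ denote point and continuous spectrum, and the superscript $c$ denotes complement in $\mathbb C$. *)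

(* Defs.v *)
From HB Require Import structures.
From mathcomp Require Import all_boot all_order all_algebra.
From mathcomp Require Import all_classical all_reals all_analysis.
From mathcomp Require Import measurable_realfun complex.
From mathcomp Require Import ring lra.
Set Implicit Arguments. Unset Strict Implicit. Unset Printing Implicit Defensive.
Import Order.TTheory GRing.Theory Num.Theory numFieldNormedType.Exports.
Local Open Scope classical_set_scope.
Local Open Scope ring_scope.
Local Open Scope complex_scope.

(** Complex vector spaces with an inner product [dotp], linear in the first and
    conjugate-linear in the second argument. *)
HB.mixin Record hasDot (R : realType) V of GRing.Lmodule R[i] V := {
  dotp : {dot V for (@Num.conj R[i])}
}.
#[short(type="preHilbertType")]
HB.structure Definition PreHilbert (R : realType) :=
  {V of hasDot R V & GRing.Lmodule R[i] V}.

Local Notation Re := complex.Re.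
Local Notation Im := complex.Im.

Section PreHilbertTheory.
Variables (R : realType) (V : preHilbertType R).
Implicit Types (u v w : V) (a : R[i]).

Definition hnorm u : R := Num.sqrt (Re (dotp u u)).

Definition rdot u v : R := Re (dotp u v).

Lemma dotpC u v : dotp v u = conjc (dotp u v).
Proof. by rewrite (hermitian_subproof (s := dotp) v u) expr0 mul1r. Qed.

Lemma dotpZl a u v : dotp (a *: u) v = a * dotp u v.
Proof. by rewrite linearZl_LR. Qed.

Lemma dotpDl u v w : dotp (u + v) w = dotp u w + dotp v w.
Proof. by rewrite linearDl. Qed.

Lemma rdotC u v : rdot u v = rdot v u.
Proof. by rewrite /rdot (dotpC u v); case: (dotp u v). Qed.

Lemma rdotDl u v w : rdot (u + v) w = rdot u w + rdot v w.
Proof. by rewrite /rdot dotpDl; case: (dotp u w); case: (dotp v w). Qed.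

Lemma rdotDr u v w : rdot w (u + v) = rdot w u + rdot w v.
Proof. by rewrite rdotC rdotDl !(rdotC w). Qed.

Lemma rdotZl (r : R) u v : rdot (r%:C *: u) v = r * rdot u v.
Proof. by rewrite /rdot dotpZl; case: (dotp u v) => x y /=; rewrite mul0r subr0. Qed.

Lemma rdotZr (r : R) u v : rdot u (r%:C *: v) = r * rdot u v.
Proof. by rewrite rdotC rdotZl rdotC. Qed.

Lemma rdotNl u v : rdot (- u) v = - rdot u v.
Proof. by rewrite /rdot linearNl raddfN. Qed.

Lemma rdotNr u v : rdot u (- v) = - rdot u v.
Proof. by rewrite rdotC rdotNl rdotC. Qed.

Lemma Im_dotp u v : complex.Im (dotp u v) = rdot u ('i *: v).
Proof.
rewrite /rdot (dotpC ('i *: v) u) dotpZl (dotpC u v); case: (dotp u v) => x y /=.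
by rewrite mul0r mul1r sub0r !opprK.
Qed.

Lemma rdot_ge0 u : 0 <= rdot u u.
Proof.
have [->|u0] := eqVneq u 0; first by rewrite /rdot linear0l.
have := neq0_dnorm_gt0 (s := dotp) u u0.
by rewrite ltcE => /andP[_ /ltW].
Qed.

Lemma rdot_eq0 u : rdot u u = 0 -> u = 0.
Proof.
move=> h; apply/eqP; case: eqVneq => // u0.
have := neq0_dnorm_gt0 (s := dotp) u u0.
by rewrite ltcE => /andP[_]; rewrite -/(rdot u u) h ltxx.
Qed.

Lemma dotpp u : dotp u u = (rdot u u)%:C.
Proof.
have := dotpC u u; rewrite /rdot; case: (dotp u u) => x y /= [] h.
by congr (_ +i* _); lra.
Qed.

Lemma hnorm_ge0 u : 0 <= hnorm u. Proof. exact: sqrtr_ge0. Qed.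

Lemma hnorm_sq u : hnorm u ^+ 2 = rdot u u.
Proof. by rewrite sqr_sqrtr // rdot_ge0. Qed.

Lemma rdot_CS u v : `|rdot u v| <= hnorm u * hnorm v.
Proof.
have [v0|v0] := eqVneq (rdot v v) 0.
  by rewrite (rdot_eq0 v0) /rdot linear0r normr0 mulr_ge0 ?hnorm_ge0.
have vp : 0 < rdot v v by rewrite lt_neqAle eq_sym v0 rdot_ge0.
rewrite -(@ler_pXn2r _ 2) ?nnegrE ?mulr_ge0 ?hnorm_ge0// exprMn !hnorm_sq.
rewrite real_normK ?num_real//.
pose t := - (rdot u v / rdot v v).
have := rdot_ge0 (u + t%:C *: v).
rewrite rdotDl !rdotDr !rdotZl !rdotZr (rdotC v u).
rewrite -(pmulr_lge0 _ vp).
suff -> : (rdot u u + t * rdot u v + (t * rdot u v + t * (t * rdot v v))) * rdot v v =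
  rdot u u * rdot v v - rdot u v ^+ 2 by rewrite subr_ge0.
by rewrite /t; field.
Qed.

Lemma hnormD u v : hnorm (u + v) <= hnorm u + hnorm v.
Proof.
rewrite -(@ler_pXn2r _ 2) ?nnegrE ?addr_ge0 ?hnorm_ge0// sqrrD !hnorm_sq.
rewrite rdotDl !rdotDr (rdotC v u).
have := le_trans (ler_norm _) (rdot_CS u v); lra.
Qed.

Lemma hnorm0 : hnorm 0 = 0.
Proof. by rewrite /hnorm linear0l sqrtr0. Qed.

Lemma hnorm_eq0 u : hnorm u = 0 -> u = 0.
Proof. by move=> h; apply: rdot_eq0; rewrite -hnorm_sq h expr0n. Qed.

Lemma hnormN u : hnorm (- u) = hnorm u.
Proof. by rewrite /hnorm linearNl linearNr opprK. Qed.

Lemma hnormZ a u : hnorm (a *: u) = Num.sqrt (Re (a * conjc a)) * hnorm u.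
Proof.
rewrite -sqrtrM; last first.
  by case: a => x y /=; rewrite mulrN opprK -!expr2 addr_ge0// sqr_ge0.
congr Num.sqrt; rewrite dotpZl dotpC dotpZl dotpp.
by case: a => x y /=; ring.
Qed.

Lemma hnorm_dist u v : `|hnorm u - hnorm v| <= hnorm (u - v).
Proof.
have h1 := hnormD (u - v) v; have h2 := hnormD (v - u) u.
rewrite -(hnormN (v - u)) opprB in h2; rewrite !subrK in h1 h2.
by rewrite ler_norml; apply/andP; split; lra.
Qed.

Lemma hnorm_sqD u v : hnorm (u + v) ^+ 2 <= (hnorm u ^+ 2 + hnorm v ^+ 2) *+ 2.
Proof.
rewrite !hnorm_sq.
have := rdot_ge0 (u - v).
rewrite !(rdotDl, rdotDr, rdotNl, rdotNr) (rdotC v u) -mulr_natl; lra.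
Qed.

Lemma rdot_polar u v : rdot u v = (hnorm (u + v) ^+ 2 - hnorm (u - v) ^+ 2) / 4.
Proof.
by rewrite !hnorm_sq !(rdotDl, rdotDr, rdotNl, rdotNr) (rdotC v u); field.
Qed.

Lemma rdot_bound u v : `|rdot u v| <= hnorm u ^+ 2 + hnorm v ^+ 2.
Proof.
apply: le_trans (rdot_CS u v) _.
have := sqr_ge0 (hnorm u - hnorm v); have := sqr_ge0 (hnorm u).
have := sqr_ge0 (hnorm v); rewrite !expr2; lra.
Qed.

End PreHilbertTheory.

Section SimpleFunctions.
Variables (R : realType) (I : interval R).

Definition simple_on T (s : R -> T) :=
  finite_set (s @` [set` I]) /\
  forall x, measurable ([set` I] `&` s @^-1` [set x]).

Lemma simple_on_preimage T (s : R -> T) (Y : set T) :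
  simple_on s -> measurable ([set` I] `&` s @^-1` Y).
Proof.
move=> [fs ms].
rewrite (_ : _ `&` _ =
  \bigcup_(x in s @` [set` I] `&` Y) ([set` I] `&` s @^-1` [set x])).
  by apply: fin_bigcup_measurable => // ; exact: finite_setIl.
apply/seteqP; split=> [t [It Yt]|t [x [_ Yx] [It /= sx]]].
  by exists (s t) => //; split=> //; exists t.
by split=> //=; rewrite sx.
Qed.

Lemma simple_on_comp T U (g : T -> U) (s : R -> T) :
  simple_on s -> simple_on (g \o s).
Proof.
move=> ss; split=> [|x]; last exact: (simple_on_preimage (g @^-1` [set x]) ss).
by rewrite -image_comp; apply: finite_image; exact: ss.1.
Qed.

Lemma simple_on_pair T U (s : R -> T) (s' : R -> U) :
  simple_on s -> simple_on s' -> simple_on (fun t => (s t, s' t)).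
Proof.
move=> [fs ms] [fs' ms']; split=> [|[x y]].
  apply: (sub_finite_set _ (finite_setX fs fs')).
  by move=> _ [t It <-]; split; exists t.
rewrite (_ : _ `&` _ = ([set` I] `&` s @^-1` [set x]) `&`
   ([set` I] `&` s' @^-1` [set y])); first exact: measurableI.
apply/seteqP; split=> [t [It [<- <-]]|t [[It /= <-] [_ /= <-]]] //.
Qed.

Lemma simple_on_cst T (x : T) : simple_on (cst x : R -> T).
Proof.
split=> [|y]; first by apply: (sub_finite_set _ (finite_set1 x)) => _ [t _ <-].
by rewrite preimage_cst; case: ifP => _; rewrite ?setIT ?setI0.
Qed.

Lemma simple_on_measurable (s : R -> R) :
  simple_on s -> measurable_fun [set` I] s.
Proof. by move=> ss _ Y _; exact: simple_on_preimage. Qed.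

End SimpleFunctions.

Section SquareIntegrable.
Variables (R : realType) (H : preHilbertType R) (I : interval R).
Local Notation mu := (@lebesgue_measure R).
Implicit Types u v w : R -> H.

(** Bochner measurability on [I].  Asking for convergence everywhere on [I]
    instead of almost everywhere does not change the classes in [L2], and keeps
    the norm of [u] Borel measurable. *)
Definition strongly_measurable u :=
  exists s : nat -> R -> H, (forall n, simple_on I (s n)) /\
    forall t, [set` I] t -> hnorm (s n t - u t) @[n --> \oo] --> (0 : R).

Lemma strongly_measurable0 : strongly_measurable (fun=> 0).
Proof.
exists (fun=> cst 0); split=> [_|t _]; first exact: simple_on_cst.
by under eq_fun do rewrite subr0 hnorm0; exact: cvg_cst.
Qed.

Lemma strongly_measurableP a u v : strongly_measurable u ->
  strongly_measurable v -> strongly_measurable (fun t => a *: u t + v t).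
Proof.
move=> [s [ss su]] [s' [ss' sv]]; exists (fun n t => a *: s n t + s' n t).
split=> [n|t It].
  exact: (simple_on_comp (fun p => a *: p.1 + p.2)
    (simple_on_pair (ss n) (ss' n))).
apply: (@squeeze_cvgr _ _ _ _ (fun=> 0) (fun n =>
  Num.sqrt (Re (a * conjc a)) * hnorm (s n t - u t) + hnorm (s' n t - v t))).
- apply: nearW => n; rewrite hnorm_ge0 /=.
  rewrite opprD addrACA -scalerBr -hnormZ; exact: hnormD.
- exact: cvg_cst.
- rewrite -[X in _ --> X]addr0 -[X in _ --> X + _](mulr0 (Num.sqrt (Re (a * conjc a)))).
  by apply: cvgD; [apply: cvgMr; exact: su|exact: sv].
Qed.

Lemma strongly_measurable_hnorm u : strongly_measurable u ->
  measurable_fun [set` I] (fun t => hnorm (u t)).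
Proof.
move=> [s [ss su]].
apply: (@measurable_realfun.measurable_fun_cvg _ _ _ _ (fun n t => hnorm (s n t))).
  move=> n; apply: simple_on_measurable.
  exact: (simple_on_comp (@hnorm R H) (ss n)).
move=> t It; apply/cvgrPdist_le => e e0.
have /cvgrPdist_le/(_ e e0) := su t It; apply: filterS => n.
rewrite sub0r normrN ger0_norm ?hnorm_ge0// => h.
by apply: le_trans h; rewrite distrC; exact: hnorm_dist.
Qed.

Lemma strongly_measurable_rdot u v : strongly_measurable u ->
  strongly_measurable v -> measurable_fun [set` I] (fun t => rdot (u t) (v t)).
Proof.
move=> su sv.
have mD : strongly_measurable (fun t => u t + v t).
  by have := strongly_measurableP 1 su sv; under eq_fun do rewrite scale1r.
have mB : strongly_measurable (fun t => u t - v t).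
  have := strongly_measurableP (-1) sv su.
  by under eq_fun do rewrite scaleN1r addrC.
apply: (eq_measurable_fun
  (fun t => (hnorm (u t + v t) ^+ 2 - hnorm (u t - v t) ^+ 2) / 4)).
  by move=> t _; rewrite rdot_polar.
apply: measurable_funM => //; apply: measurable_funB;
  by apply: measurable_funX; exact: strongly_measurable_hnorm.
Qed.

Definition square_integrable u := strongly_measurable u /\
  (\int[mu]_(t in [set` I]) (hnorm (u t) ^+ 2)%:E < +oo)%E.

Lemma measurable_hnorm2 u : strongly_measurable u ->
  measurable_fun [set` I] (fun t => (hnorm (u t) ^+ 2)%:E).
Proof.
move=> su; apply/measurable_EFinP; apply: measurable_funX.
exact: strongly_measurable_hnorm.
Qed.

Lemma hnorm2_integrable u : square_integrable u ->
  mu.-integrable [set` I] (fun t => (hnorm (u t) ^+ 2)%:E).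
Proof.
move=> [su fu]; apply/integrableP; split; first exact: measurable_hnorm2.
by under eq_integral do rewrite gee0_abs ?lee_fin ?sqr_ge0//.
Qed.

Lemma square_integrable0 : square_integrable (fun=> 0).
Proof.
split; first exact: strongly_measurable0.
by under eq_integral do rewrite hnorm0 expr0n; rewrite integral0.
Qed.

Lemma square_integrableP a u v : square_integrable u ->
  square_integrable v -> square_integrable (fun t => a *: u t + v t).
Proof.
move=> iu iv; have mw := strongly_measurableP a iu.1 iv.1; split=> //.
pose c := Re (a * conjc a).
have c0 : 0 <= c.
  by rewrite /c; case: a {mw c} => x y /=; rewrite mulrN opprK -!expr2 addr_ge0// sqr_ge0.
have ib : mu.-integrable [set` I] (fun t => ((c *+ 2)%:E * (hnorm (u t) ^+ 2)%:E +
    2%:E * (hnorm (v t) ^+ 2)%:E)%E).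
  by apply: integrableD => //; apply: integrableZl => //; exact: hnorm2_integrable.
have : mu.-integrable [set` I] (fun t => (hnorm (a *: u t + v t) ^+ 2)%:E).
  apply: le_integrable ib => //; first exact: measurable_hnorm2.
  move=> t It; rewrite -!EFinM -EFinD !abse_EFin lee_fin.
  rewrite !ger0_norm ?sqr_ge0 ?addr_ge0 ?mulr_ge0 ?mulrn_wge0 ?hnorm_ge0//.
  apply: le_trans (hnorm_sqD _ _) _.
  by rewrite hnormZ exprMn sqr_sqrtr// -/c; lra.
move=> /integrableP[_].
by under eq_integral do rewrite gee0_abs ?lee_fin ?exprn_ge0 ?hnorm_ge0//.
Qed.

Lemma rdot_integrable u v : square_integrable u -> square_integrable v ->
  mu.-integrable [set` I] (fun t => (rdot (u t) (v t))%:E).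
Proof.
move=> iu iv.
have ib : mu.-integrable [set` I] (fun t =>
    ((hnorm (u t) ^+ 2)%:E + (hnorm (v t) ^+ 2)%:E)%E).
  by apply: integrableD => //; exact: hnorm2_integrable.
apply: le_integrable ib => //.
  by apply/measurable_EFinP; exact: strongly_measurable_rdot iu.1 iv.1.
move=> t It; rewrite -EFinD !abse_EFin lee_fin.
rewrite [leRHS]ger0_norm ?addr_ge0 ?sqr_ge0//; exact: rdot_bound.
Qed.

End SquareIntegrable.

Section L2Space.
Variables (R : realType) (H : preHilbertType R) (I : interval R).
Local Notation mu := (@lebesgue_measure R).

Definition L2pred : {pred R -> H} := fun u => `[< square_integrable I u >].

Lemma L2pred_submod : submod_closed L2pred.
Proof.
split; first by apply/asboolP; exact: square_integrable0.
move=> a u v /asboolP iu /asboolP iv; apply/asboolP.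
exact: square_integrableP.
Qed.

HB.instance Definition _ :=
  GRing.isSubmodClosed.Build _ _ L2pred L2pred_submod.

Record L2fun := MkL2fun { L2fun_val :> R -> H ; _ : L2fun_val \in L2pred }.
HB.instance Definition _ := [isSub for L2fun_val].
HB.instance Definition _ := [Choice of L2fun by <:].
HB.instance Definition _ := [SubChoice_isSubLmodule of L2fun by <:].

Definition L2null : {pred L2fun} :=
  fun u => `[< (u : R -> H) = cst 0 %[ae mu in [set` I]] >].

Lemma L2null_zmod : zmod_closed L2null.
Proof.
split=> [|u v /asboolP u0 /asboolP v0]; apply/asboolP; first exact: aeW.
apply: (@filterS2 _ _ (ae_filter_ringOfSetsType mu) _ _ _ _ u0 v0).
move=> t {}u0 {}v0 It.
by rewrite /= /GRing.add /= /GRing.opp /= u0 // v0 // subrr.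
Qed.

HB.instance Definition _ := GRing.isZmodClosed.Build _ L2null L2null_zmod.

(** [L_2(H, I)]: classes of almost everywhere equal functions on [I]; values off
    [I] are ignored by the equivalence. *)
Definition L2 : Type := Quotient.quot L2null.
HB.instance Definition _ := GRing.Zmodule.on L2.

Definition L2_class (u : L2fun) : L2 := \pi_(Quotient.quot L2null)%qT u.
Definition L2_repr (x : L2) : L2fun := repr (x : Quotient.quot L2null).

Lemma L2_reprK x : L2_class (L2_repr x) = x. Proof. exact: reprK. Qed.

Lemma L2_classP u v :
  L2_class u = L2_class v <-> (u : R -> H) = v %[ae mu in [set` I]].
Proof.
have F := ae_filter_ringOfSetsType mu.
have -> : L2_class u = L2_class v <-> (u - v) \in L2null.
  by rewrite Quotient.idealrBE; split=> /eqP.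
split=> [/asboolP|] uv; last apply/asboolP;
  apply: (@filterS _ _ F _ _ _ uv) => t {}uv It; have := uv It.
  by rewrite /= /GRing.add /= /GRing.opp /= => /eqP; rewrite subr_eq0 => /eqP.
by move=> e; rewrite /= /GRing.add /= /GRing.opp /= e subrr.
Qed.

Lemma L2_classD u v : L2_class (u + v) = L2_class u + L2_class v.
Proof. exact: raddfD. Qed.

Lemma L2_repr_class u : (L2_repr (L2_class u) : R -> H) = u %[ae mu in [set` I]].
Proof. by apply/L2_classP; rewrite L2_reprK. Qed.

Definition L2_scale (a : R[i]) (x : L2) : L2 := L2_class (a *: L2_repr x).

Lemma L2_scale_class a u : L2_scale a (L2_class u) = L2_class (a *: u).
Proof.
apply/L2_classP; apply: (@filterS _ _ (ae_filter_ringOfSetsType mu)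
  _ _ _ (L2_repr_class u)) => t uv It.
by rewrite /= /GRing.scale /= uv.
Qed.

Lemma L2_scaleA a b x : L2_scale a (L2_scale b x) = L2_scale (a * b) x.
Proof. by rewrite -[x]L2_reprK !L2_scale_class scalerA. Qed.

Lemma L2_scale1 : left_id 1 L2_scale.
Proof. by move=> x; rewrite -[x]L2_reprK !L2_scale_class scale1r. Qed.

Lemma L2_scaleDr : right_distributive L2_scale +%R.
Proof.
move=> a x y; rewrite -[x]L2_reprK -[y]L2_reprK.
by rewrite -L2_classD !L2_scale_class scalerDr L2_classD.
Qed.

Lemma L2_scaleDl x : {morph L2_scale^~ x : a b / a + b}.
Proof.
by move=> a b; rewrite -[x]L2_reprK !L2_scale_class scalerDl L2_classD.
Qed.

HB.instance Definition _ := GRing.Zmodule_isLmodule.Build R[i] L2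
  L2_scaleA L2_scale1 L2_scaleDr L2_scaleDl.

Lemma L2_reprP a x y : (L2_repr (a *: x + y) : R -> H) =
  (fun t => a *: L2_repr x t + L2_repr y t) %[ae mu in [set` I]].
Proof.
have -> : a *: x + y = L2_class (a *: L2_repr x + L2_repr y).
  by rewrite L2_classD L2_reprK.
exact: L2_repr_class.
Qed.

Lemma L2_reprI x : square_integrable I (L2_repr x).
Proof. by apply/asboolP; exact: (valP (L2_repr x)). Qed.

Definition L2_dot (x y : L2) : R[i] :=
  (\int[mu]_(t in [set` I]) Re (dotp (L2_repr x t) (L2_repr y t))) +i*
  (\int[mu]_(t in [set` I]) Im (dotp (L2_repr x t) (L2_repr y t))).

End L2Space.

Section L2Dot.
Variables (R : realType) (H : preHilbertType R) (I : interval R).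
Local Notation mu := (@lebesgue_measure R).
Local Notation integrable_fun f := (mu.-integrable [set` I] (EFin \o f)).
Implicit Types (u v w : R -> H) (x y z : L2 H I).

Lemma Re_integrable u v : square_integrable I u -> square_integrable I v ->
  integrable_fun (fun t => Re (dotp (u t) (v t))).
Proof. exact: rdot_integrable. Qed.

Lemma Im_integrable u v : square_integrable I u -> square_integrable I v ->
  integrable_fun (fun t => Im (dotp (u t) (v t))).
Proof.
move=> iu iv.
have iw : square_integrable I (fun t => 'i *: v t).
  have := square_integrableP 'i iv (square_integrable0 H I).
  by under eq_fun do rewrite addr0.
have -> : (fun t => Im (dotp (u t) (v t))) = (fun t => rdot (u t) ('i *: v t)).
  by apply/funext => t; exact: Im_dotp.
exact: rdot_integrable.
Qed.

Lemma L2_dotC x y : L2_dot y x = conjc (L2_dot x y).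
Proof.
rewrite /L2_dot /=; congr (_ +i* _).
  by apply: eq_Rintegral => t _; rewrite dotpC; case: (dotp _ _).
rewrite -mulN1r -RintegralZl//; last first.
  by apply: Im_integrable; exact: L2_reprI.
by apply: eq_Rintegral => t _; rewrite mulN1r dotpC; case: (dotp _ _).
Qed.

Let integrable_funZ (r : R) f :
  integrable_fun f -> integrable_fun (fun t => r * f t).
Proof.
move=> fi; have : mu.-integrable [set` I] (fun t => (r%:E * (f t)%:E)%E) by exact: integrableZl.
by [].
Qed.

Let integrable_funD f g :
  integrable_fun f -> integrable_fun g -> integrable_fun (fun t => f t + g t).
Proof.
move=> fi gi.
have : mu.-integrable [set` I] (fun t => ((f t)%:E + (g t)%:E)%E) by exact: integrableD.
by [].
Qed.

Let Rintegral_lin (r s : R) f g h :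
  integrable_fun f -> integrable_fun g -> integrable_fun h ->
  \int[mu]_(t in [set` I]) (r * f t + s * g t + h t) =
  r * \int[mu]_(t in [set` I]) f t + s * \int[mu]_(t in [set` I]) g t +
    \int[mu]_(t in [set` I]) h t.
Proof.
move=> fi gi hi; rewrite !RintegralD// ?RintegralZl//.
- exact: integrable_funZ.
- exact: integrable_funZ.
- by apply: integrable_funD; exact: integrable_funZ.
Qed.

Let ae_eq_Rintegral f g : integrable_fun f -> integrable_fun g ->
  f = g %[ae mu in [set` I]] ->
  \int[mu]_(t in [set` I]) f t = \int[mu]_(t in [set` I]) g t.
Proof.
move=> fi gi fg; congr fine; apply: ae_eq_integral => //.
- exact: measurable_int fi.
- exact: measurable_int gi.
- apply: (@filterS _ _ (ae_filter_ringOfSetsType mu) _ _ _ fg) => t {}fg It /=.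
  by rewrite fg.
Qed.

Lemma L2_dotP a x y z : L2_dot (a *: x + y) z = a * L2_dot x z + L2_dot y z.
Proof.
have ix := L2_reprI x; have iy := L2_reprI y; have iz := L2_reprI z.
have iw := L2_reprI (a *: x + y).
pose re u := fun t => Re (dotp (u t) (L2_repr z t)).
pose im u := fun t => Im (dotp (u t) (L2_repr z t)).
have reI u : square_integrable I u -> integrable_fun (re u).
  by move=> iu; exact: Re_integrable.
have imI u : square_integrable I u -> integrable_fun (im u).
  by move=> iu; exact: Im_integrable.
have e1 : \int[mu]_(t in [set` I]) re (L2_repr (a *: x + y)) t =
    \int[mu]_(t in [set` I]) (Re a * re (L2_repr x) t
      + (- Im a) * im (L2_repr x) t + re (L2_repr y) t).
  apply: ae_eq_Rintegral; first exact: reI.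
    by do !(apply: integrable_funD || apply: integrable_funZ);
      [exact: reI|exact: imI|exact: reI].
  apply: (@filterS _ _ (ae_filter_ringOfSetsType mu) _ _ _ (L2_reprP a x y)).
  move=> t e It; rewrite /re /im e// dotpDl dotpZl.
  by case: a {e iw} => p q; case: (dotp _ _) => b c; case: (dotp _ _) => d k /=; ring.
have e2 : \int[mu]_(t in [set` I]) im (L2_repr (a *: x + y)) t =
    \int[mu]_(t in [set` I]) (Re a * im (L2_repr x) t
      + Im a * re (L2_repr x) t + im (L2_repr y) t).
  apply: ae_eq_Rintegral; first exact: imI.
    by do !(apply: integrable_funD || apply: integrable_funZ);
      [exact: imI|exact: reI|exact: imI].
  apply: (@filterS _ _ (ae_filter_ringOfSetsType mu) _ _ _ (L2_reprP a x y)).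
  move=> t e It; rewrite /re /im e// dotpDl dotpZl.
  by case: a {e1 e iw} => p q; case: (dotp _ _) => b c; case: (dotp _ _) => d k /=; ring.
rewrite /L2_dot e1 e2 !Rintegral_lin; try by [exact: reI|exact: imI].
by rewrite /re /im; case: a {e1 e2 iw} => p q /=; congr (_ +i* _); ring.
Qed.

Lemma L2_dot_gt0 x : x != 0 -> 0 < L2_dot x x.
Proof.
move=> x0; have ix := L2_reprI x.
have im0 : Im (L2_dot x x) = 0.
  have := L2_dotC x x; case: (L2_dot x x) => p q /= [] e; lra.
rewrite ltcE im0 eqxx /= lt_neqAle; apply/andP; split; last first.
  by apply: Rintegral_ge0 => t _; exact: rdot_ge0.
apply: contra x0; rewrite eq_sym => /eqP e; apply/eqP.
have fi := rdot_integrable ix ix.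
have : (\int[mu]_(t in [set` I]) `|(rdot (L2_repr x t) (L2_repr x t))%:E|)%E = 0%E.
  under eq_integral do rewrite gee0_abs ?lee_fin ?rdot_ge0//.
  by rewrite -[LHS]fineK ?integrable_fin_num// -/(Rintegral _ _ _) e.
move=> /(proj1 (ae_eq_integral_abs mu (measurable_itv I) (measurable_int mu fi))) x0.
have c0 : L2_class (0 : L2fun H I) = 0 by exact: raddf0.
rewrite -(L2_reprK x) -c0; apply/L2_classP.
apply: (@filterS _ _ (ae_filter_ringOfSetsType mu) _ _ _ x0) => t {}x0 It.
by apply: rdot_eq0; have /= [] := x0 It.
Qed.

Lemma L2_dotDl x y z : L2_dot (x + y) z = L2_dot x z + L2_dot y z.
Proof. by rewrite -{1}[x]scale1r L2_dotP mul1r. Qed.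

Lemma L2_dot0l z : L2_dot 0 z = 0.
Proof. by apply: (addrI (L2_dot 0 z)); rewrite -L2_dotDl !addr0. Qed.

Lemma L2_dotZl a x z : L2_dot (a *: x) z = a * L2_dot x z.
Proof. by rewrite -[a *: x]addr0 L2_dotP L2_dot0l addr0. Qed.
End L2Dot.

Section DotFactory.
Variables (R : realType) (V : lmodType R[i]) (f : V -> V -> R[i]).
Hypothesis fD : forall x y z, f (x + y) z = f x z + f y z.
Hypothesis fZ : forall a x z, f (a *: x) z = a * f x z.
Hypothesis fC : forall x y, f y x = conjc (f x y).

Lemma dot_zmodl z : zmod_morphism (f^~ z).
Proof. by move=> x y /=; rewrite -scaleN1r fD fZ mulN1r. Qed.

Lemma dot_zmodr z : zmod_morphism (f z).
Proof.
move=> x y; rewrite fC (dot_zmodl z x y) (fC x z) (fC y z).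
by case: (f x z); case: (f y z) => a b c d /=; congr (_ +i* _); ring.
Qed.

Lemma dot_scalel z : scalable_for *%R (f^~ z).
Proof. by move=> a x /=; rewrite fZ. Qed.

Lemma dot_scaler z : scalable_for (Num.conj \; *%R) (f z).
Proof.
move=> a x; rewrite fC fZ (fC x z) /=.
by case: a; case: (f x z) => b c d e /=; congr (_ +i* _); ring.
Qed.

Lemma dot_herm x y : f x y = (-1) ^+ false * Num.conj (f y x).
Proof. by rewrite expr0 mul1r; exact: fC. Qed.
End DotFactory.

HB.instance Definition _ (R : realType) (H : preHilbertType R) (I : interval R) :=
  isBilinear.Build R[i] (L2 H I) (L2 H I) R[i] *%R (Num.conj \; *%R)
    (@L2_dot R H I)
    (dot_zmodl (@L2_dotDl R H I) (@L2_dotZl R H I))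
    (dot_zmodr (@L2_dotDl R H I) (@L2_dotZl R H I) (@L2_dotC R H I))
    (dot_scalel (@L2_dotZl R H I))
    (dot_scaler (@L2_dotZl R H I) (@L2_dotC R H I)).
HB.instance Definition _ (R : realType) (H : preHilbertType R) (I : interval R) :=
  isHermitianSesquilinear.Build R[i] (L2 H I) false Num.conj (@L2_dot R H I)
    (dot_herm (@L2_dotC R H I)).
HB.instance Definition _ (R : realType) (H : preHilbertType R) (I : interval R) :=
  isDotProduct.Build R[i] (L2 H I) (@L2_dot R H I) (@L2_dot_gt0 R H I).
HB.instance Definition _ (R : realType) (H : preHilbertType R) (I : interval R) :=
  hasDot.Build R (L2 H I) (@L2_dot R H I).

Section ProductSpace.
Variables (R : realType) (V W : preHilbertType R).
Implicit Types p q : V * W.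

Definition pair_dot p q : R[i] := dotp p.1 q.1 + dotp p.2 q.2.

Lemma pair_dotDl p q r : pair_dot (p + q) r = pair_dot p r + pair_dot q r.
Proof. by rewrite /pair_dot !dotpDl addrACA. Qed.

Lemma pair_dotZl a p q : pair_dot (a *: p) q = a * pair_dot p q.
Proof. by rewrite /pair_dot !dotpZl mulrDr. Qed.

Lemma pair_dotC p q : pair_dot q p = conjc (pair_dot p q).
Proof. by rewrite /pair_dot rmorphD /= -!dotpC. Qed.

Lemma pair_dot_gt0 p : p != 0 -> 0 < pair_dot p p.
Proof.
case: p => v w; rewrite /pair_dot !dotpp -rmorphD /= => p0.
rewrite ltcE /= eqxx /= lt_neqAle addr_ge0 ?rdot_ge0// andbT.
apply: contra p0; rewrite eq_sym paddr_eq0 ?rdot_ge0// => /andP[/eqP v0 /eqP w0].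
by rewrite (rdot_eq0 v0) (rdot_eq0 w0).
Qed.

HB.instance Definition _ :=
  isBilinear.Build R[i] (V * W)%type (V * W)%type R[i] *%R (Num.conj \; *%R) pair_dot
    (dot_zmodl pair_dotDl pair_dotZl)
    (dot_zmodr pair_dotDl pair_dotZl pair_dotC)
    (dot_scalel pair_dotZl)
    (dot_scaler pair_dotZl pair_dotC).
HB.instance Definition _ :=
  isHermitianSesquilinear.Build R[i] (V * W)%type false Num.conj pair_dot
    (dot_herm pair_dotC).
HB.instance Definition _ :=
  isDotProduct.Build R[i] (V * W)%type pair_dot pair_dot_gt0.
HB.instance Definition _ := hasDot.Build R (V * W)%type pair_dot.
End ProductSpace.

(** An unbounded operator in [V] is represented by its graph. *)
Section Operators.
Variables (R : realType) (V : preHilbertType R).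

Definition operator := set (V * V).
Implicit Types (S T : operator) (l : R[i]).

Definition hdense (A : set V) :=
  forall v (e : R), 0 < e -> exists2 u, A u & hnorm (v - u) < e.

Definition separable := exists s : nat -> V, hdense (range s).

Definition complete_space := forall s : nat -> V,
  (forall e : R, 0 < e -> exists N, forall m n, (N <= m)%N -> (N <= n)%N ->
     hnorm (s m - s n) < e) ->
  exists v, hnorm (s n - v) @[n --> \oo] --> (0 : R).

Definition dom T : set V := [set u | exists f, T (u, f)].

Definition ker T : set V := [set u | T (u, 0)].

Definition linear_operator T :=
  [/\ T 0, forall (a : R[i]) p q, T p -> T q -> T (a *: p + q)
    & forall u f g, T (u, f) -> T (u, g) -> f = g].

Definition adjoint T : operator :=
  [set p | forall q, T q -> dotp q.2 p.1 = dotp q.1 p.2].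

Definition op_closure T : operator :=
  [set p | forall e : R, 0 < e -> exists2 q, T q & hnorm (p - q) < e].

Definition closed_operator T := op_closure T `<=` T.

Definition op_opp T : operator := [set p | T (p.1, - p.2)].

Definition op_comp S T : operator :=
  [set p | exists2 v, T (p.1, v) & S (v, p.2)].

Definition selfadjoint T :=
  [/\ linear_operator T, hdense (dom T) & adjoint T = T].

(** In the order of [R[i]], [0 <= z] says that [z] is real and nonnegative. *)
Definition nonneg_operator T := forall p, T p -> 0 <= dotp p.2 p.1.

Definition is_sqrt S T :=
  [/\ selfadjoint S, nonneg_operator S & op_comp S S = T].

Definition normal T :=
  [/\ linear_operator T, hdense (dom T), closed_operator T,
      dom T = dom (adjoint T)
    & forall u f g, T (u, f) -> adjoint T (u, g) -> hnorm f = hnorm g].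

Definition range_shift T l : set V :=
  [set g | exists2 p, T p & g = p.2 - l *: p.1].

Definition point_spectrum T : set R[i] :=
  [set l | exists2 u, u != 0 & T (u, l *: u)].

Definition resolvent_set T : set R[i] :=
  [set l | [/\ ~ point_spectrum T l, range_shift T l = setT
    & exists M : R, forall p, T p -> hnorm p.1 <= M * hnorm (p.2 - l *: p.1)]].

Definition continuous_spectrum T : set R[i] :=
  [set l | [/\ ~ resolvent_set T l, ~ point_spectrum T l
    & hdense (range_shift T l)]].

Definition unitary (W : {linear V -> V}) :=
  (forall x y, dotp (W x) (W y) = dotp x y) /\ (forall y, exists x, W x = y).

End Operators.

Definition imaginary_axis (R : realType) : set R[i] := [set l | Re l = 0].
Arguments imaginary_axis : clear implicits.

Section DifferentialOperators.
Variables (R : realType) (H : preHilbertType R).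
Local Notation mu := (@lebesgue_measure R).

Definition test_function (I : interval R) (phi : R -> R) :=
  [/\ forall n t, derivable (phi^`(n)%classic) t 1,
      compact (closure [set t | phi t != 0])
    & closure [set t | phi t != 0] `<=` [set` I]].

(** [u |-> c u' + A u] on finite sums [\sum_j phi_j(t) f_j] with [phi_j] a test
    function and [f_j \in D(A)], where [g j = A (f j)].  Real test functions
    suffice: [i phi f = phi (i f)]. *)
Definition preminimal (c : R) (A : operator H) (I : interval R) :
    operator (L2 H I) :=
  [set p | exists n (phi : 'I_n -> R -> R) (f g : 'I_n -> H),
    [/\ forall j, test_function I (phi j),
        forall j, A (f j, g j),
        (L2_repr p.1 : R -> H) =
          (fun t => \sum_(j < n) (phi j t)%:C *: f j) %[ae mu in [set` I]]
      & (L2_repr p.2 : R -> H) =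
          (fun t => \sum_(j < n) ((c * (phi j)^`()%classic t)%:C *: f j
                                  + (phi j t)%:C *: g j))
          %[ae mu in [set` I]]]].
Arguments preminimal : clear implicits.

Definition minimal_operator (A : operator H) (I : interval R) :
  operator (L2 H I) := op_closure (preminimal 1 A I).
Arguments minimal_operator : clear implicits.

Definition maximal_operator (A : operator H) (I : interval R) :
  operator (L2 H I) := adjoint (op_closure (preminimal (-1) A I)).
Arguments maximal_operator : clear implicits.

(** Norm of [h : H] in the negative space [H_-] of [A], the dual with respect
    to [H] of [D(A)] with the graph norm. *)
Definition negative_norm (A : operator H) (h : H) : R :=
  sup [set Re `|dotp h p.1| | p in
        [set p | A p /\ hnorm p.2 ^+ 2 + hnorm p.1 ^+ 2 <= 1]].

(** [u(a) = x], for [a] an endpoint of [I].  An element of the domain of the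
    maximal operator has an [H_-]-valued representative that is continuous up
    to the finite endpoints of [I]; its value at [a] is the essential limit of
    [u] at [a] in the norm of [H_-], which is what is asked for here. *)
Definition boundary_value (A : operator H) (I : interval R) (u : L2 H I)
    (a : R) (x : H) :=
  forall e : R, 0 < e -> exists2 d : R, 0 < d &
    {ae mu, forall t, [set` I] t -> `|t - a| < d ->
      negative_norm A (L2_repr u t - x) < e}.

End DifferentialOperators.
Arguments preminimal {R H} c A I _.
Arguments minimal_operator {R H} A I _.
Arguments maximal_operator {R H} A I _.
Arguments boundary_value {R H} A {I} u a x.

(** [L_2(1,0,1)] and [L_2(0,1,0)] are written without their zero summands. *)
Section ThreeIntervals.
Variables (R : realType) (H : preHilbertType R) (a1 a2 b2 a3 : R).
Local Notation L2_1 := (L2 H `]-oo, a1[).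
Local Notation L2_2 := (L2 H `]a2, b2[).
Local Notation L2_3 := (L2 H `]a3, +oo[).

Definition L2_111 : preHilbertType R := (L2_1 * L2_2 * L2_3)%type.
Definition L2_101 : preHilbertType R := (L2_1 * L2_3)%type.
Definition L2_010 : preHilbertType R := L2_2.

Definition L0_111 (A1 A2 A3 : operator H) : operator L2_111 :=
  [set p | let: (u1, u2, u3, (f1, f2, f3)) := p in
    [/\ minimal_operator A1 `]-oo, a1[ (u1, f1),
        minimal_operator A2 `]a2, b2[ (u2, f2)
      & minimal_operator A3 `]a3, +oo[ (u3, f3)]].

(** [B1] and [B3] stand for the square roots of [- A1] and [A3]. *)
Definition L_W1 (A1 A3 B1 B3 : operator H) (W1 : {linear H -> H}) :
    operator L2_101 :=
  [set p | let: (u1, u3, (f1, f3)) := p in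
    [/\ maximal_operator A1 `]-oo, a1[ (u1, f1),
        maximal_operator A3 `]a3, +oo[ (u3, f3)
      & exists x1 x3, [/\ boundary_value A1 u1 a1 x1, boundary_value A3 u3 a3 x3,
          x3 = W1 x1, ker B1 x1 & ker B3 x3]]].
Arguments L_W1 : clear implicits.

Definition L_W2 (A2 : operator H) (W2 : {linear H -> H}) : operator L2_010 :=
  [set p | let: (u2, f2) := p in
    maximal_operator A2 `]a2, b2[ (u2, f2) /\
    exists xa xb, [/\ boundary_value A2 u2 a2 xa, boundary_value A2 u2 b2 xb
      & xb = W2 xa]].
Arguments L_W2 : clear implicits.

Definition L_W1W2 (A1 A2 A3 B1 B3 : operator H) (W1 W2 : {linear H -> H}) :
    operator L2_111 :=
  [set p | let: (u1, u2, u3, (f1, f2, f3)) := p in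
    L_W1 A1 A3 B1 B3 W1 (u1, u3, (f1, f3)) /\ L_W2 A2 W2 (u2, f2)].

End ThreeIntervals.

Arguments L0_111 {R H} a1 a2 b2 a3 A1 A2 A3 _.
Arguments L_W1 {R H} a1 a3 A1 A3 B1 B3 W1 _.
Arguments L_W2 {R H} a2 b2 A2 W2 _.
Arguments L_W1W2 {R H} a1 a2 b2 a3 A1 A2 A3 B1 B3 W1 W2 _.

(* Main.v *)
From Pilot Require Import Defs.
From mathcomp Require Import all_boot all_order all_algebra.
From mathcomp Require Import all_classical all_reals all_analysis.
From mathcomp Require Import measurable_realfun complex.
From mathcomp Require Import ring lra.
Import Pilot.Defs.
Set Implicit Arguments. Unset Strict Implicit. Unset Printing Implicit Defensive.
Import Order.TTheory GRing.Theory Num.Theory numFieldNormedType.Exports.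
Local Open Scope classical_set_scope.
Local Open Scope ring_scope.
Local Open Scope complex_scope.

(** Write [L] for the normal operator with summands [L_W1], on the two half-lines,
    and [L_W2], on the bounded interval.  Everything rests on the fact that
    normality leaves no freedom on the half-lines.

    The boundary condition [u_3(a_3) \in ker B_3] holds on [D(L)], hence on the
    domain of the adjoint of [L], which is the same.  Let [f \in D(A_3)] be
    orthogonal to [ker B_3] and let [phi] be a cutoff function equal to [1] near
    [a_3].  Integration by parts against [phi f] has no boundary term, because
    boundary values of elements of [D(L)] lie in [ker B_3] ([boundary_pairing]).  So
    [phi f] is in the domain of the adjoint and must itself satisfy the boundary
    condition: [f \in ker B_3], whence [f = 0].  Decomposing [D(A_3)] along
    [ker B_3] gives [A_3 = 0], and [A_1 = 0] in the same way
    ([half_line_normal_eq0]).  On the half-lines [L] is therefore a restriction of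
    [d/dt] and its adjoint a restriction of [- d/dt], so the outer part of [L] is
    skew-symmetric ([L_skew]).

    Point spectrum.  Let [L u = l u].  If [Re l <> 0], skew-symmetry forces the
    outer components of [u] to vanish.  If [l = i omega], an outer component [x]
    solves [x' = i omega x] weakly, so [exp(-i omega t) x(t)] is constant and
    square integrable on a half-line, which makes it [0] ([L2_eq0_oscillating]).
    Hence [u] is an eigenvector of [L_W2] ([point_spectrum_L]).

    Continuous spectrum.  For a normal operator the range of [L - l] is dense as soon
    as [l] is not an eigenvalue ([normal_dense_range]).
    - If [Re l <> 0], skew-symmetry bounds the outer part of [L - l] below by
      [|Re l|].  When [l] is in the resolvent set of [L_W2] and [L - l] has dense
      range, [L - l] is bounded below, and its range, closed and dense, is everything
      ([resolvent_L]).
    - If [l = i omega] is not an eigenvalue of [L_W2], wave packets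
      [phi(t) exp(i omega t) f] with longer and longer plateaus [phi] inside
      [(a_3, oo)] are approximate eigenvectors, and [l] is in the continuous spectrum
      ([imaginary_not_resolvent]).
    - A point of the resolvent set of [L] is in the resolvent set of [L_W2], so the
      continuous spectrum of [L_W2] is contained in that of [L].

    The density arguments need [L2 H I] to be complete ([L2_complete]), and the weak
    formulations need enough test functions, which are built from [exp(-1/t)]. *)

(** * Orthogonal projection in a complete space *)

Section Hilbert.
Variables (R : realType) (V : preHilbertType R).
Implicit Types (u v w x y : V) (S : set V).

Definition subspace S := S 0 /\ forall (a : R[i]) u v, S u -> S v -> S (a *: u + v).

Lemma rdotBl u v w : rdot (u - v) w = rdot u w - rdot v w.
Proof. by rewrite rdotDl rdotNl. Qed.

Lemma rdotBr u v w : rdot w (u - v) = rdot w u - rdot w v.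
Proof. by rewrite rdotDr rdotNr. Qed.

Lemma hnormB u v : hnorm (u - v) = hnorm (v - u).
Proof. by rewrite -(hnormN (u - v)) opprB. Qed.

Lemma hnormZr (r : R) u : hnorm (r%:C *: u) = `|r| * hnorm u.
Proof.
rewrite hnormZ (_ : complex.Re _ = r ^+ 2) ?sqrtr_sqr// -conjc_real /=.
by rewrite /=; ring.
Qed.

Lemma hnorm_triangle u v w : hnorm (u - w) <= hnorm (u - v) + hnorm (v - w).
Proof. by rewrite -[u - w](subrKA v); exact: hnormD. Qed.

Lemma parallelogram u v :
  hnorm (u + v) ^+ 2 + hnorm (u - v) ^+ 2 = 2 * (hnorm u ^+ 2 + hnorm v ^+ 2).
Proof. by rewrite !hnorm_sq !(rdotDl, rdotDr, rdotNl, rdotNr) (rdotC v u); ring. Qed.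

Lemma dotp_eq0 u v : rdot u v = 0 -> rdot u ('i *: v) = 0 -> dotp u v = 0.
Proof. by rewrite -Im_dotp /rdot; case: (dotp u v) => x y /= -> ->. Qed.

Lemma subspaceZ S a u : subspace S -> S u -> S (a *: u).
Proof. by move=> [S0 SP] Su; rewrite -[_ *: _]addr0; exact: SP. Qed.

Lemma subspaceD S u v : subspace S -> S u -> S v -> S (u + v).
Proof. by move=> [S0 SP] Su Sv; rewrite -[u]scale1r; exact: SP. Qed.

(** A minimizing sequence in [S] is Cauchy by the parallelogram identity; its
    limit [p] is nearest to [x], so that [x - p] is orthogonal to [S]. *)
Lemma orthogonal_decomposition S x : complete_space V -> subspace S ->
  exists2 p, (forall e : R, 0 < e -> exists2 u, S u & hnorm (p - u) < e) &
    forall u, S u -> dotp (x - p) u = 0.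
Proof.
move=> Vc SS; pose D := [set hnorm (x - u) | u in S].
have D0 : D !=set0 by exists (hnorm (x - 0)), 0 => //; exact: SS.1.
have Dlb : has_lbound D by exists 0 => _ [u _ <-]; exact: hnorm_ge0.
pose d := inf D.
have d0 : 0 <= d by apply: lb_le_inf => // _ [u _ <-]; exact: hnorm_ge0.
have dP u : S u -> d <= hnorm (x - u) by move=> Su; apply: ge_inf => //; exists u.
have /choice[s sP] : forall n : nat, exists u, S u /\ hnorm (x - u) < d + n.+1%:R^-1.
  move=> n; have [|_ [u Su <-] h] := @inf_adherent _ D n.+1%:R^-1 _ (conj D0 Dlb).
    by rewrite invr_gt0.
  by exists u.
have midS u v : S u -> S v -> S ((2^-1 : R)%:C *: (u + v)).
  by move=> Su Sv; apply: subspaceZ => //; exact: subspaceD.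
have key u v (r : R) : S u -> S v -> 0 <= r -> hnorm (x - u) <= d + r ->
    hnorm (x - v) <= d + r -> hnorm (u - v) ^+ 2 <= 4 * (2 * d * r + r ^+ 2).
  move=> Su Sv r0 hu hv.
  have := parallelogram (x - u) (x - v).
  have -> : x - u - (x - v) = v - u by rewrite opprB addrC addrA subrK.
  have -> : x - u + (x - v) = (2 : R)%:C *: (x - (2^-1 : R)%:C *: (u + v)).
    rewrite scalerBr scalerA -rmorphM /= divff// scale1r.
    by rewrite rmorphD /= scalerDl !scale1r addrACA opprD.
  rewrite hnormZr ger0_norm//.
  rewrite [hnorm (u - v)]hnormB exprMn => e.
  have h1 := dP _ (midS _ _ Su Sv).
  have h2 : d ^+ 2 <= hnorm (x - (2^-1 : R)%:C *: (u + v)) ^+ 2.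
    by rewrite ler_sqr ?nnegrE ?hnorm_ge0.
  have h3 : hnorm (x - u) ^+ 2 <= (d + r) ^+ 2.
    by rewrite ler_sqr ?nnegrE ?hnorm_ge0// addr_ge0.
  have h4 : hnorm (x - v) ^+ 2 <= (d + r) ^+ 2.
    by rewrite ler_sqr ?nnegrE ?hnorm_ge0// addr_ge0.
  move: e h2 h3 h4; rewrite [(d + r) ^+ 2]sqrrD mulr2n; lra.
have inv0 : (fun n : nat => n.+1%:R^-1 : R) @ \oo --> (0 : R).
  exact: cvg_harmonic.
have [p sp] : exists p, hnorm (s n - p) @[n --> \oo] --> (0 : R).
  apply: Vc => e e0.
  pose r := Num.min 1 (e ^+ 2 / (4 * (2 * d + 1) + 1)).
  have q0 : 0 < 4 * (2 * d + 1) + 1 by lra.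
  have r0 : 0 < r by rewrite lt_min ltr01 divr_gt0// exprn_gt0.
  have /cvgrPdist_lt/(_ r r0)[N _ NP] := inv0.
  exists N => m n Nm Nn.
  have close k : (N <= k)%N -> hnorm (x - s k) <= d + r.
    move=> Nk; have /ltW/le_trans := (sP k).2; apply; rewrite lerD2l.
    have := NP k Nk; rewrite sub0r normrN ger0_norm ?invr_ge0//.
    exact: ltW.
  have h := key _ _ r (sP m).1 (sP n).1 (ltW r0) (close _ Nm) (close _ Nn).
  rewrite -(@ltr_pXn2r _ 2) ?nnegrE ?hnorm_ge0 ?(ltW e0)//.
  apply: le_lt_trans h _.
  have r1 : r <= 1 by rewrite ge_min lexx.
  have r2 : r * (4 * (2 * d + 1) + 1) <= e ^+ 2.
    by rewrite -ler_pdivlMr// ge_min lexx orbT.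
  have : r ^+ 2 <= r by rewrite expr2 ler_piMr// ltW.
  nra.
exists p => [e e0|u Su].
  have /cvgrPdist_lt/(_ e e0)[N _ NP] := sp.
  exists (s N); first exact: (sP N).1.
  have := NP N (leqnn _); rewrite sub0r normrN ger0_norm ?hnorm_ge0// hnormB.
  by [].
have near v : S v -> hnorm (x - p) <= hnorm (x - p - v).
  move=> Sv; suff h (e : R) : 0 < e -> hnorm (x - p) <= hnorm (x - p - v) + e.
    exact/ler_addgt0Pr.
  move=> e0.
  have e3 : 0 < e / 3 by rewrite divr_gt0.
  have [N1 _ N1P] := (@cvgrPdist_lt _ _ _ _ _ _ _).1 sp _ e3.
  have [N2 _ N2P] := (@cvgrPdist_lt _ _ _ _ _ _ _).1 inv0 _ e3.
  pose N := maxn N1 N2.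
  have a1 : hnorm (s N - p) < e / 3.
    by have := N1P N (leq_maxl _ _); rewrite /= sub0r normrN ger0_norm ?hnorm_ge0.
  have a2 : N.+1%:R^-1 < e / 3.
    by have := N2P N (leq_maxr _ _); rewrite /= sub0r normrN ger0_norm ?invr_ge0.
  have b1 := dP _ (subspaceD SS (sP N).1 Sv).
  have b2 := hnorm_triangle x (s N) p.
  have b3 : hnorm (x - s N) < d + e / 3.
    by apply: lt_trans (sP N).2 _; rewrite ltrD2l.
  have b4 : hnorm (x - (s N + v)) <= hnorm (x - p - v) + hnorm (p - s N).
    have -> : x - (s N + v) = (x - p - v) + (p - s N); last exact: hnormD.
    by rewrite [RHS]addrAC addrA subrK opprD addrA.
  rewrite [hnorm (p - _)]hnormB in b4; lra.
have ort v : S v -> rdot (x - p) v = 0.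
  move=> Sv; have [v0|v0] := eqVneq (rdot v v) 0.
    by rewrite (rdot_eq0 v0) /rdot linear0r.
  have vp : 0 < rdot v v by rewrite lt_neqAle eq_sym v0 rdot_ge0.
  have := near _ (subspaceZ (rdot (x - p) v / rdot v v)%:C SS Sv).
  rewrite -(@ler_pXn2r _ 2) ?nnegrE ?hnorm_ge0// !hnorm_sq.
  move: (x - p) => z; rewrite rdotBl !rdotBr !rdotZl !rdotZr (rdotC v z).
  set r := rdot z v.
  have -> : rdot z z - r / rdot v v * r -
     (r / rdot v v * r - r / rdot v v * (r / rdot v v * rdot v v)) =
     rdot z z - r ^+ 2 / rdot v v by field.
  rewrite lerBrDr gerDl => h.
  have : r ^+ 2 <= 0 by rewrite -[_ ^+ 2](divfK v0) pmulr_lle0.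
  by move=> h'; apply/eqP; rewrite -sqrf_eq0 eq_le h' sqr_ge0.
by apply: dotp_eq0; apply: ort => //; exact: subspaceZ.
Qed.

(** Any vector is the sum of a limit of vectors of [S] and of a vector orthogonal
    to [S], and the latter is [0] by assumption. *)
Lemma hdense_orthogonal S : complete_space V -> subspace S ->
  (forall x, (forall u, S u -> dotp x u = 0) -> x = 0) -> hdense S.
Proof.
move=> Vc SS S0 x e e0.
have [p pS xp] := orthogonal_decomposition x Vc SS.
by have /eqP := S0 _ xp; rewrite subr_eq0 => /eqP ->; exact: pS.
Qed.

Lemma hdense_orthogonal0 S x : hdense S -> (forall u, S u -> dotp x u = 0) -> x = 0.
Proof.
move=> Sd xS; apply/eqP/negP => /negP x0.
have xp : 0 < hnorm x.
  by rewrite lt_neqAle hnorm_ge0 andbT eq_sym; apply: contra x0 => /eqP/hnorm_eq0->.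
have [u Su xu] := Sd x _ xp.
have : hnorm (x - u) ^+ 2 = hnorm x ^+ 2 + hnorm u ^+ 2.
  rewrite !hnorm_sq rdotBl !rdotBr (rdotC u x).
  by rewrite [rdot x u]/rdot xS//=; lra.
have : hnorm (x - u) ^+ 2 < hnorm x ^+ 2.
  by rewrite ltr_pXn2r ?nnegrE ?hnorm_ge0.
by have := sqr_ge0 (hnorm u); lra.
Qed.

End Hilbert.

(** * Strong measurability in a separable space *)

Section Measurability.
Variables (R : realType) (H : preHilbertType R) (I : interval R).
Hypothesis H_separable : separable H.
Local Notation mu := (@lebesgue_measure R).
Implicit Types u v w : R -> H.

(** Reduces the measurability of an [H]-valued step function to that of the
    integer that selects its value. *)
Lemma simple_on_nat_choice (N : nat) (k : R -> nat) (s : nat -> H) :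
  (forall t, [set` I] t -> (k t <= N)%N) ->
  (forall n, measurable ([set` I] `&` [set t | k t = n])) ->
  simple_on I (s \o k).
Proof.
move=> kN mk; split.
  apply: (@sub_finite_set _ _ (s @` `I_N.+1)); last exact/finite_image/finite_II.
  by move=> _ [t It <-]; exists (k t) => //=; rewrite ltnS kN.
move=> x; rewrite (_ : _ `&` _ =
  \bigcup_(n in [set n | s n = x]) ([set` I] `&` [set t | k t = n])).
  exact: bigcup_measurable.
apply/seteqP; split=> [t [It /= <-]|t [n /= <-] [It /= <-]] //.
by exists (k t).
Qed.

(** With a dense sequence [s] in [H], the simple function taking at [t] the
    value among [s 0, ..., s n] closest to [u t] approximates [u]. *)
Lemma strongly_measurable_dist u :
  (forall y, measurable_fun [set` I] (fun t => hnorm (u t - y))) ->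
  strongly_measurable I u.
Proof.
move=> mu_; have [s sd] := H_separable.
pose d (n : nat) t := hnorm (u t - s n).
pose k := fix k n t := if n is n'.+1 then
  (if d n'.+1 t < d (k n' t) t then n'.+1 else k n' t) else 0%N.
have kle n t : (k n t <= n)%N.
  by elim: n => //= n IH; case: ifP => // _; exact: leqW.
have kmin n m t : (m <= n)%N -> d (k n t) t <= d m t.
  elim: n => [|n IH] /=; first by rewrite leqn0 => /eqP ->.
  rewrite leq_eqVlt => /predU1P[->|]; first by case: ifP => // /negbT; rewrite -leNgt.
  rewrite ltnS => /IH h; case: ifP => // /ltW h'; exact: le_trans h' h.
have mlt n m : measurable ([set` I] `&` [set t | d n t < d m t]).
  rewrite (_ : [set t | _] = (fun t => d n t < d m t) @^-1` [set true]); last first.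
    by apply/seteqP; split.
  exact: (measurable_fun_ltr (mu_ (s n)) (mu_ (s m)) (measurable_itv I)).
have mk n : forall m, measurable ([set` I] `&` [set t | k n t = m]).
  elim: n => [|n IH] m /=.
    case: m => [|m].
      suff -> : [set` I] `&` [set t | 0%N = 0%N] = [set` I] by exact: measurable_itv.
      by apply/seteqP; split=> t [].
    suff -> : [set` I] `&` [set t | 0%N = m.+1] = set0 by exact: measurable0.
    by apply/seteqP; split=> t // [_ /=].
  pose A := \bigcup_j (([set` I] `&` [set t | k n t = j]) `&`
      ([set` I] `&` [set t | d n.+1 t < d j t])).
  have mA : measurable A by apply: bigcup_measurable => j _; exact: measurableI.
  have AP t : [set` I] t -> A t <-> d n.+1 t < d (k n t) t.
    by move=> It; split=> [[j _ [[_ /= ->] []//]]|h]; exists (k n t).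
  case: (eqVneq m n.+1) => [->|mn].
    suff -> : [set` I] `&` [set t | (if d n.+1 t < d (k n t) t then n.+1 else k n t) = n.+1] = A by [].
    apply/seteqP; split=> t /=.
      move=> [It]; case: ifP => [h _|_ e]; first by apply/AP.
      by have := kle n t; rewrite e ltnn.
    move=> At; have It : [set` I] t by case: At => j _ [[]].
    by split=> //; move/AP : At => ->.
  suff -> : [set` I] `&` [set t | (if d n.+1 t < d (k n t) t then n.+1 else k n t) = m] =
     ([set` I] `&` [set t | k n t = m]) `\` A by exact: measurableD.
  apply/seteqP; split=> t /=.
    move=> [It]; case: ifPn => [_ e|h <-]; first by rewrite e eqxx in mn.
    by split=> //; rewrite AP//; exact/negP.
  by move=> [[It <-]]; rewrite AP// => /negP/negbTE ->.
exists (fun n t => s (k n t)); split=> [n|t It].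
  by apply: (@simple_on_nat_choice n (k n)) => // t _; exact: kle.
apply/cvgrPdist_lt => e e0; have [_ [m _ <-] um] := sd (u t) e e0.
exists m => // n /= mn; rewrite sub0r normrN ger0_norm ?hnorm_ge0// hnormB.
exact: le_lt_trans (kmin n m t mn) um.
Qed.

Lemma strongly_measurable_cst (y : H) : strongly_measurable I (cst y).
Proof.
exists (fun=> cst y); split=> [_|t _]; first exact: simple_on_cst.
by under eq_fun do rewrite subrr hnorm0; exact: cvg_cst.
Qed.

Lemma strongly_measurableB u v : strongly_measurable I u ->
  strongly_measurable I v -> strongly_measurable I (fun t => u t - v t).
Proof.
move=> mu_ mv; have := strongly_measurableP (-1) mv mu_.
by under eq_fun do rewrite scaleN1r addrC.
Qed.

Lemma measurable_dist u y : strongly_measurable I u ->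
  measurable_fun [set` I] (fun t => hnorm (u t - y)).
Proof.
move=> mu_; apply: strongly_measurable_hnorm.
exact: strongly_measurableB mu_ (strongly_measurable_cst y).
Qed.

(** Distances to a fixed vector pass to the limit, unlike approximating simple
    functions, for which a diagonal argument would be needed. *)
Lemma strongly_measurable_lim (v : nat -> R -> H) u :
  (forall n, strongly_measurable I (v n)) ->
  (forall t, [set` I] t -> hnorm (v n t - u t) @[n --> \oo] --> (0 : R)) ->
  strongly_measurable I u.
Proof.
move=> mv vu; apply: strongly_measurable_dist => y.
apply: (@measurable_realfun.measurable_fun_cvg _ _ _ _ (fun n t => hnorm (v n t - y))).
  by move=> n; exact: measurable_dist.
move=> t It; apply/cvgrPdist_le => e e0.
have /cvgrPdist_le/(_ e e0) := vu t It; apply: filterS => n.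
rewrite sub0r normrN ger0_norm ?hnorm_ge0// => h.
apply: le_trans h; rewrite distrC.
by apply: le_trans (hnorm_dist _ _) _; rewrite opprB addrA subrK.
Qed.

(** The square of the distance to [y] is a polynomial in [phi], [|u|] and
    [<u, y>], which are measurable. *)
Lemma strongly_measurable_scale (phi : R -> R) u :
  measurable_fun [set` I] phi -> strongly_measurable I u ->
  strongly_measurable I (fun t => (phi t)%:C *: u t).
Proof.
move=> mphi mu_; apply: strongly_measurable_dist => y.
have mdot := strongly_measurable_rdot mu_ (strongly_measurable_cst y).
have mn := strongly_measurable_hnorm mu_.
apply: (eq_measurable_fun (fun t => Num.sqrt (phi t ^+ 2 * hnorm (u t) ^+ 2
    - 2 * phi t * rdot (u t) y + rdot y y))).
  move=> t _; rewrite /hnorm -/(rdot _ _); congr Num.sqrt.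
  rewrite sqr_sqrtr ?rdot_ge0// -/(rdot _ _) rdotBl !rdotBr !rdotZl !rdotZr (rdotC y (u t)).
  by rewrite /rdot /=; ring.
apply: measurableT_comp; first exact: continuous_measurable_fun (@sqrt_continuous R).
apply: measurable_funD => //; apply: measurable_funB.
  by apply: measurable_funM; apply: measurable_funX.
by apply: measurable_funM => //; exact: measurable_funM.
Qed.

End Measurability.

(** * Completeness of [L2 H I] *)

Section L2Classes.
Variables (R : realType) (H : preHilbertType R) (I : interval R).
Local Notation mu := (@lebesgue_measure R).
Implicit Types (u v w : R -> H) (x y : L2 H I).

Lemma ae_imp (P Q : R -> Prop) : (forall t, P t -> Q t) ->
  {ae mu, forall t, P t} -> {ae mu, forall t, Q t}.
Proof. by move=> PQ; exact: (@filterS _ _ (ae_filter_ringOfSetsType mu)). Qed.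

Lemma ae_imp2 (P Q S : R -> Prop) : (forall t, P t -> Q t -> S t) ->
  {ae mu, forall t, P t} -> {ae mu, forall t, Q t} -> {ae mu, forall t, S t}.
Proof. by move=> PQ; exact: (@filterS2 _ _ (ae_filter_ringOfSetsType mu)). Qed.

(** Total in [w], so that classes can be written before square integrability is
    known. *)
Definition L2_of w : L2 H I :=
  if pselect (square_integrable I w) is left h
  then L2_class (MkL2fun (asboolT h)) else 0.

Lemma L2_ofE w : square_integrable I w ->
  (L2_repr (L2_of w) : R -> H) = w %[ae mu in [set` I]].
Proof.
by move=> h; rewrite /L2_of; case: pselect => // ?; exact: L2_repr_class.
Qed.

Lemma L2_eqP x y : (L2_repr x : R -> H) = L2_repr y %[ae mu in [set` I]] -> x = y.
Proof. by move=> /L2_classP; rewrite !L2_reprK. Qed.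

Lemma L2_repr0 : (L2_repr (0 : L2 H I) : R -> H) = cst 0 %[ae mu in [set` I]].
Proof.
have <- : L2_class (0 : L2fun H I) = 0 by exact: raddf0.
exact: L2_repr_class.
Qed.

Lemma L2_reprB x y : (L2_repr (x - y) : R -> H) =
  (fun t => L2_repr x t - L2_repr y t) %[ae mu in [set` I]].
Proof.
have := L2_reprP (-1) y x; rewrite scaleN1r addrC.
by apply: ae_imp => t h It; rewrite h// scaleN1r addrC.
Qed.

Lemma L2_rdot_ae x y (h : R -> R) : measurable_fun [set` I] h ->
  {ae mu, forall t, [set` I] t -> rdot (L2_repr x t) (L2_repr y t) = h t} ->
  rdot x y = \int[mu]_(t in [set` I]) h t.
Proof.
move=> mh e; congr fine; apply: ae_eq_integral => //.
- exact: measurable_int (rdot_integrable (L2_reprI x) (L2_reprI y)).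
- exact/measurable_EFinP.
- by apply: ae_imp e => t e It /=; rewrite -e.
Qed.

Lemma L2_hnorm2 x w : strongly_measurable I w ->
  (L2_repr x : R -> H) = w %[ae mu in [set` I]] ->
  (\int[mu]_(t in [set` I]) (hnorm (w t) ^+ 2)%:E = (hnorm x ^+ 2)%:E)%E.
Proof.
move=> mw xw.
have -> : (\int[mu]_(t in [set` I]) (hnorm (w t) ^+ 2)%:E =
    \int[mu]_(t in [set` I]) (rdot (L2_repr x t) (L2_repr x t))%:E)%E.
  apply: ae_eq_integral => //.
  - exact: measurable_hnorm2.
  - exact: measurable_int (rdot_integrable (L2_reprI x) (L2_reprI x)).
  - by apply: ae_imp xw => t e It; rewrite -e// hnorm_sq.
rewrite -[LHS]fineK; last first.
  by apply: integrable_fin_num => //; exact: rdot_integrable (L2_reprI x) (L2_reprI x).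
by congr EFin; rewrite hnorm_sq.
Qed.

Lemma L2_hnorm2B x y :
  (\int[mu]_(t in [set` I]) (hnorm (L2_repr x t - L2_repr y t) ^+ 2)%:E =
   (hnorm (x - y) ^+ 2)%:E)%E.
Proof.
apply: L2_hnorm2; last exact: L2_reprB.
by apply: strongly_measurableB; exact: (L2_reprI _).1.
Qed.

End L2Classes.

Section Completeness.
Variable R : realType.

Lemma complete_geometric (V : preHilbertType R) (s : nat -> V) (C : R) :
  complete_space V -> (forall k, hnorm (s k.+1 - s k) <= C * 2^-1 ^+ k) ->
  exists v, hnorm (s n - v) @[n --> \oo] --> (0 : R).
Proof.
move=> Vc sC.
have C0 : 0 <= C by have := le_trans (hnorm_ge0 _) (sC 0); rewrite expr0 mulr1.
have tail n k : hnorm (s (n + k)%N - s n) <= 2 * C * 2^-1 ^+ n * (1 - 2^-1 ^+ k).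
  elim: k => [|k IH]; first by rewrite addn0 subrr hnorm0 expr0 subrr mulr0.
  rewrite addnS; apply: le_trans (hnorm_triangle _ (s (n + k)%N) _) _.
  apply: le_trans (lerD (sC _) IH) _.
  by rewrite exprD exprS le_eqVlt; apply/orP; left; apply/eqP; field.
have tail' n k : hnorm (s (n + k)%N - s n) <= 2 * C * 2^-1 ^+ n.
  apply: le_trans (tail n k) (ler_piMr _ _).
    by rewrite mulr_ge0 ?exprn_ge0 ?invr_ge0 ?mulr_ge0.
  by rewrite gerBl exprn_ge0 ?invr_ge0.
apply: Vc => e e0.
have : (fun n => 2 * C * 2^-1 ^+ n : R) @ \oo --> (0 : R).
  apply: cvg_geometric; rewrite ger0_norm//; lra.
move=> /cvgrPdist_lt/(_ (e / 2)); rewrite divr_gt0// => /(_ isT)[N _ NP].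
have small k : hnorm (s (N + k)%N - s N) < e / 2.
  apply: le_lt_trans (tail' N k) _; have := NP N (leqnn _).
  by rewrite /= sub0r normrN ger0_norm// ?mulr_ge0 ?exprn_ge0.
exists N => m n Nm Nn; rewrite -(subnKC Nm) -(subnKC Nn).
apply: le_lt_trans (hnorm_triangle _ (s N) _) _.
rewrite [hnorm (s N - _)]hnormB.
by have := small (m - N)%N; have := small (n - N)%N; lra.
Qed.

Lemma complete_pair (V W : preHilbertType R) :
  complete_space V -> complete_space W -> complete_space (V * W)%type.
Proof.
have nP (p : V * W) : hnorm p ^+ 2 = hnorm p.1 ^+ 2 + hnorm p.2 ^+ 2.
  by rewrite !hnorm_sq /rdot /dotp /= /pair_dot; case: (dotp p.1 _); case: (dotp p.2 _).
have n1 (p : V * W) : hnorm p.1 <= hnorm p.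
  rewrite -(@ler_pXn2r _ 2) ?nnegrE ?hnorm_ge0// nP lerDl; exact: sqr_ge0.
have n2 (p : V * W) : hnorm p.2 <= hnorm p.
  rewrite -(@ler_pXn2r _ 2) ?nnegrE ?hnorm_ge0// nP lerDr; exact: sqr_ge0.
have n12 (p : V * W) : hnorm p <= hnorm p.1 + hnorm p.2.
  rewrite -(@ler_pXn2r _ 2) ?nnegrE ?addr_ge0 ?hnorm_ge0// nP sqrrD.
  have := mulr_ge0 (hnorm_ge0 p.1) (hnorm_ge0 p.2); lra.
move=> Vc Wc s sC.
have [|v sv] := Vc (fun n => (s n).1).
  move=> e e0; have [N NP] := sC e e0; exists N => m n Nm Nn.
  exact: le_lt_trans (n1 (s m - s n)) (NP _ _ Nm Nn).
have [|w sw] := Wc (fun n => (s n).2).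
  move=> e e0; have [N NP] := sC e e0; exists N => m n Nm Nn.
  exact: le_lt_trans (n2 (s m - s n)) (NP _ _ Nm Nn).
exists (v, w); apply: (@squeeze_cvgr _ _ _ _ (fun=> 0)
  (fun n => hnorm ((s n).1 - v) + hnorm ((s n).2 - w))).
- by apply: nearW => n; rewrite hnorm_ge0 /=; exact: n12.
- exact: cvg_cst.
- by rewrite -[X in _ --> X]addr0; exact: cvgD.
Qed.

End Completeness.

Lemma limn_einf_le (R : realType) (u : (\bar R)^nat) (c : \bar R) N :
  (forall m, (N <= m)%N -> (u m <= c)%E) -> (limn_einf u <= c)%E.
Proof.
move=> uc; rewrite limn_einf_lim; apply: lime_le; first exact: is_cvg_einfs.
apply: nearW => k; apply: (@le_trans _ _ (u (maxn k N))); last by apply: uc; exact: leq_maxr.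
by apply: ereal_inf_lbound; exists (maxn k N) => //=; exact: leq_maxl.
Qed.

Section RieszFischer.
Variables (R : realType) (H : preHilbertType R) (I : interval R).
Hypotheses (H_complete : complete_space H) (H_separable : separable H).
Local Notation mu := (@lebesgue_measure R).

(** [\sum_k 4^k |x_(k+1)(t) - x_k(t)|^2] is integrable, hence finite for almost
    every [t]; there the increments are [O(2^-k)].  The weights replace the use of
    Minkowski's inequality for series. *)
Lemma L2_fast_ae_cvg (x : nat -> L2 H I) :
  (forall k, hnorm (x k.+1 - x k) ^+ 2 <= 8^-1 ^+ k) ->
  {ae mu, forall t, [set` I] t ->
    exists v, hnorm (L2_repr (x n) t - v) @[n --> \oo] --> (0 : R)}.
Proof.
move=> xC.
pose d k t := ((4 ^+ k * hnorm (L2_repr (x k.+1) t - L2_repr (x k) t) ^+ 2)%:E : \bar R).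
have md k : measurable_fun [set` I] (d k).
  apply/measurable_EFinP; apply: measurable_funM => //; apply: measurable_funX.
  apply: strongly_measurable_hnorm; apply: strongly_measurableB;
  exact: (L2_reprI _).1.
have d0 k t : (0 <= d k t)%E by rewrite lee_fin mulr_ge0 ?exprn_ge0 ?hnorm_ge0.
have sum_fin : (\int[mu]_(t in [set` I]) (\sum_(0 <= k <oo) d k t) < +oo)%E.
  rewrite integral_nneseries//.
  apply: (@le_lt_trans _ _ (\sum_(0 <= k <oo) ((2 : R) / (2 ^ k.+1)%:R)%:E)%E); last first.
    by apply: le_lt_trans (epsilon_trick0 xpredT _) _ => //; rewrite ltry.
  apply: lee_nneseries => [k _ _|k _]; first by apply: integral_ge0 => t _; exact: d0.
  rewrite /d; under eq_integral do rewrite EFinM.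
  rewrite ge0_integralZl//; try by [rewrite lee_fin exprn_ge0|move=> t _; rewrite lee_fin sqr_ge0
    |apply: measurable_hnorm2; apply: strongly_measurableB; exact: (L2_reprI _).1].
  rewrite L2_hnorm2B -EFinM lee_fin.
  apply: le_trans (ler_wpM2l _ (xC k)) _; first exact: exprn_ge0.
  rewrite -exprMn natrX exprS invfM mulrA divff// mul1r -exprVn.
  by rewrite (_ : 4 * 8^-1 = 2^-1 :> R)//; field.
have msum : measurable_fun [set` I] (fun t => \sum_(0 <= k <oo) d k t)%E.
  by apply: ge0_emeasurable_sum => // k t _ _; exact: d0.
have sum_ge0 t : (0 <= \sum_(0 <= k <oo) d k t)%E by exact: nneseries_ge0.
have : mu.-integrable [set` I] (fun t => \sum_(0 <= k <oo) d k t)%E.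
  by apply/integrableP; split=> //; under eq_integral do rewrite gee0_abs//.
move=> hi; have := @integrable_ae _ _ _ mu _ (measurable_itv I) _ hi; apply: ae_imp => t ht It.
have {ht}ht := ht It; set C := fine (\sum_(0 <= k <oo) d k t)%E.
have dC k : 4 ^+ k * hnorm (L2_repr (x k.+1) t - L2_repr (x k) t) ^+ 2 <= C.
  rewrite -lee_fin fineK// -/(d k t).
  have := @nneseries_lim_ge R (d^~ t) xpredT 0%N k.+1 (fun n _ _ => d0 n t).
  apply: le_trans; rewrite big_nat_recr//= leeDr//.
  by apply: sume_ge0 => n _; exact: d0.
have C0 : 0 <= C by apply: fine_ge0.
apply: (@complete_geometric _ H (fun n => L2_repr (x n) t) (Num.sqrt C)) => // k.
rewrite -(@ler_pXn2r _ 2) ?nnegrE ?mulr_ge0 ?exprn_ge0 ?hnorm_ge0 ?sqrtr_ge0//.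
rewrite exprMn (sqr_sqrtr C0).
have -> : 2^-1 ^+ k ^+ 2 = (4 ^+ k)^-1 :> R.
  by rewrite -exprM mulnC exprM -exprVn; congr (_ ^+ k); field.
by rewrite ler_pdivlMr ?exprn_gt0// mulrC.
Qed.

(** Riesz-Fischer: a fast subsequence has a pointwise limit, and a Cauchy sequence
    converges as soon as one of its subsequences does. *)
Lemma L2_complete : complete_space (L2 H I).
Proof.
move=> x xC.
have /choice[N NP] : forall k : nat, exists N, forall m n, (N <= m)%N -> (N <= n)%N ->
    hnorm (x m - x n) ^+ 2 < 8^-1 ^+ k.
  move=> k; have [|N NP] := xC (Num.sqrt (8^-1 ^+ k)).
    by rewrite sqrtr_gt0 exprn_gt0.
  exists N => m n Nm Nn; have := NP m n Nm Nn.
  rewrite -(@ltr_pXn2r _ 2) ?nnegrE ?hnorm_ge0 ?sqrtr_ge0// [Num.sqrt (_ ^+ k) ^+ 2]sqr_sqrtr//.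
(* [M] is increasing and [M k >= N k], so that [x \o M] is a fast subsequence. *)
pose M := fix M k := if k is k'.+1 then maxn (M k').+1 (N k) else N 0%N.
have MN k : (N k <= M k)%N by case: k => //= k; exact: leq_maxr.
have Mmono k : (M k <= M k.+1)%N by apply: leq_trans (leqnSn _) (leq_maxl _ _).
have Mk k : (k <= M k)%N.
  by elim: k => // k IH; apply: leq_trans (leq_maxl _ _); rewrite ltnS.
pose y k := x (M k).
have yC k : hnorm (y k.+1 - y k) ^+ 2 <= 8^-1 ^+ k.
  by apply/ltW/NP; [exact: leq_trans (MN k) (Mmono k)|exact: MN].
have [Z [mZ Z0 Zsub]] := L2_fast_ae_cvg yC.
pose v n t := (\1_(~` Z) t : R)%:C *: L2_repr (y n) t.
have /choice[u vu] : forall t, exists w, [set` I] t ->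
    hnorm (v n t - w) @[n --> \oo] --> (0 : R).
  move=> t; case: (pselect (Z t)) => [Zt|nZt].
    exists 0 => _; rewrite /v indicE memNset; last by move=> /(_ Zt).
    by under eq_fun do rewrite scale0r subrr hnorm0; exact: cvg_cst.
  have := contra_notP (@Zsub t) => /(_ nZt) /= h.
  case: (pselect ([set` I] t)) => It; last by exists 0.
  have [w hw] := h It; exists w => _.
  by rewrite /v indicE mem_set//; under eq_fun do rewrite scale1r.
have mv n : strongly_measurable I (v n).
  by apply: strongly_measurable_scale => //; [apply: measurable_indic; exact: measurableC|exact: (L2_reprI _).1].
have mu_ : strongly_measurable I u by exact: strongly_measurable_lim mv vu.
have ae_v n : {ae mu, forall t, [set` I] t -> v n t = L2_repr (y n) t}.
  exists Z; split=> // t /= h; apply: contrapT => nZt; apply: h => It.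
  by rewrite /v indicE mem_set// scale1r.
have vB n m : (\int[mu]_(t in [set` I]) (hnorm (v m t - v n t) ^+ 2)%:E =
    (hnorm (y m - y n) ^+ 2)%:E)%E.
  apply: L2_hnorm2; first exact: strongly_measurableB.
  have h : (fun t => L2_repr (y m) t - L2_repr (y n) t) =
      (fun t => v m t - v n t) %[ae mu in [set` I]].
    by apply: ae_imp2 (ae_v m) (ae_v n) => t a b It; rewrite a// b.
  by apply: ae_imp2 (L2_reprB (y m) (y n)) h => t a b It; rewrite a//; exact: b.
have yclose n m : (n <= m)%N -> hnorm (y m - y n) ^+ 2 <= 8^-1 ^+ n.
  move=> nm; apply/ltW/NP; last exact: MN.
  apply: leq_trans (MN n) _; elim: m nm => [|m IH]; first by rewrite leqn0 => /eqP ->.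
  by rewrite leq_eqVlt => /predU1P[->//|/IH h]; exact: leq_trans h (Mmono m).
(* Fatou's lemma bounds the distance from [y n] to the pointwise limit. *)
have uv n : (\int[mu]_(t in [set` I]) (hnorm (u t - v n t) ^+ 2)%:E <=
    (8^-1 ^+ n)%:E)%E.
  pose f m t := ((hnorm (v m t - v n t) ^+ 2)%:E : \bar R).
  have mf m : measurable_fun [set` I] (f m).
    by apply: measurable_hnorm2; exact: strongly_measurableB.
  have f0 m t : [set` I] t -> (0 <= f m t)%E by rewrite lee_fin sqr_ge0.
  have := fatou mu (measurable_itv I) mf f0.
  have -> : (\int[mu]_(t in [set` I]) limn_einf (f^~ t) =
     \int[mu]_(t in [set` I]) (hnorm (u t - v n t) ^+ 2)%:E)%E.
    apply: eq_integral => t; rewrite inE => It.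
    suff h : (f^~ t) @ \oo --> (hnorm (u t - v n t) ^+ 2)%:E.
      by have [-> _] := cvg_limn_einf_sup h.
    apply: cvg_EFin; first exact: nearW.
    suff h : (fun m => hnorm (v m t - v n t)) @ \oo --> hnorm (u t - v n t).
      rewrite (_ : _ \o _ = (fun m => hnorm (v m t - v n t) * hnorm (v m t - v n t))).
        by rewrite expr2; exact: (cvgM h).
      by apply/funext => m; rewrite /= expr2.
    apply/cvgrPdist_le => e e0; have /cvgrPdist_le/(_ e e0) := vu t It.
    apply: filterS => m; rewrite sub0r normrN ger0_norm ?hnorm_ge0// => h.
    apply: le_trans h; rewrite distrC; apply: le_trans (hnorm_dist _ _) _.
    by rewrite opprB addrA subrK.
  move=> h; apply: le_trans h _; apply: (@limn_einf_le _ _ _ n) => m nm.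
  rewrite /f vB lee_fin.
  exact: yclose.
have uI : square_integrable I u.
  have iB : square_integrable I (fun t => u t - v 0%N t).
    split; first exact: strongly_measurableB.
    by apply: le_lt_trans (uv 0%N) _; rewrite ltry.
  have iv : square_integrable I (v 0%N).
    split; first exact: mv.
    by rewrite (@L2_hnorm2 _ _ _ (y 0%N)) ?ltry//; apply: ae_imp (ae_v 0%N) => t h It; rewrite h.
  have := square_integrableP 1 iB iv.
  by under eq_fun do rewrite scale1r subrK.
exists (L2_of I u); apply/cvgrPdist_lt => e e0.
have yu n : hnorm (y n - L2_of I u) ^+ 2 <= 8^-1 ^+ n.
  rewrite hnormB -lee_fin -(@L2_hnorm2 _ _ _ (L2_of I u - y n) (fun t => u t - v n t)).
  - exact: uv.
  - exact: strongly_measurableB.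
  - have h : (fun t => L2_repr (L2_of I u) t - L2_repr (y n) t) =
      (fun t => u t - v n t) %[ae mu in [set` I]].
      by apply: ae_imp2 (L2_ofE uI) (ae_v n) => t a b It; rewrite a// b.
    by apply: ae_imp2 (L2_reprB (L2_of I u) (y n)) h => t a b It; rewrite a//; exact: b.
have [N1 N1P] := xC _ (divr_gt0 e0 (ltr0n R 2)).
have : (fun n => 1 * 8^-1 ^+ n : R) @ \oo --> (0 : R).
  by apply: cvg_geometric; rewrite ger0_norm//; lra.
move=> /cvgrPdist_lt/(_ ((e / 2) ^+ 2)); rewrite exprn_gt0 ?divr_gt0// => /(_ isT)[N2 _ N2P].
pose K := maxn N1 N2.
have yK : hnorm (y K - L2_of I u) < e / 2.
  rewrite -(@ltr_pXn2r _ 2) ?nnegrE ?hnorm_ge0 ?divr_ge0 ?(ltW e0)//.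
  apply: le_lt_trans (yu K) _; have := N2P K (leq_maxr _ _).
  by rewrite /= mul1r sub0r normrN ger0_norm// exprn_ge0.
have KM : (N1 <= M K)%N by exact: leq_trans (leq_maxl _ _) (Mk K).
exists N1 => // n /= n1; rewrite sub0r normrN ger0_norm ?hnorm_ge0//.
apply: le_lt_trans (hnorm_triangle _ (y K) _) _.
by have := N1P n (M K) n1 KM; rewrite -/(y K); lra.
Qed.

End RieszFischer.

(** * Smooth functions and a mollifier *)

Section Smooth.
Variable R : realType.

Lemma near_is_derive (f g : R -> R) (t d : R) : (\near t, f t = g t) ->
  is_derive t (1 : R) f d -> is_derive t (1 : R) g d.
Proof. exact: near_eq_is_derive. Qed.

Implicit Types f g : R -> R.

Definition deriv_fun f g := forall t : R, is_derive t (1 : R) f (g t).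

(** Naming the derivative existentially makes stability under products and inverses
    a plain induction, without Leibniz's formula. *)
Fixpoint diffn n f := if n is n'.+1 then
  exists2 g, deriv_fun f g & diffn n' g else True.

Definition smooth f := forall n, diffn n f.

Lemma deriv_funE f g : deriv_fun f g -> f^`()%classic = g.
Proof.
by move=> fg; apply/funext => t; rewrite derive1E; exact: (@derive_val _ _ _ _ _ _ _ (fg t)).
Qed.

Lemma smooth_deriv_fun f : smooth f -> deriv_fun f f^`()%classic.
Proof. by move=> /(_ 1%N)[g fg _]; rewrite (deriv_funE fg). Qed.

Lemma smooth_derive1 f : smooth f -> smooth f^`()%classic.
Proof. by move=> fs n; have [g fg ng] := fs n.+1; rewrite (deriv_funE fg). Qed.

Lemma smooth_derivable f : smooth f -> forall n t, derivable (f^`(n)%classic) t 1.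
Proof.
move=> fs n t; suff : smooth (f^`(n)%classic).
  by move=> /smooth_deriv_fun/(_ t) h; exact: (@ex_derive _ _ _ _ _ _ _ h).
by elim: n => [//|n IH]; rewrite derive1nS; exact: smooth_derive1.
Qed.

Lemma smooth_continuous f : smooth f -> continuous f.
Proof.
move=> /smooth_deriv_fun fs t; apply: differentiable_continuous.
by apply/derivable1_diffP; exact: (@ex_derive _ _ _ _ _ _ _ (fs t)).
Qed.

Lemma diffn_le n f : diffn n.+1 f -> diffn n f.
Proof. by elim: n f => //= n IH f [g fg h]; exists g => //; exact: IH. Qed.

Lemma deriv_funD f f' g g' : deriv_fun f f' -> deriv_fun g g' ->
  deriv_fun (fun t => f t + g t) (fun t => f' t + g' t).
Proof. by move=> hf hg t; exact: is_deriveD (hf t) (hg t). Qed.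

Lemma deriv_funM f f' g g' : deriv_fun f f' -> deriv_fun g g' ->
  deriv_fun (fun t => f t * g t) (fun t => f t * g' t + g t * f' t).
Proof. by move=> hf hg t; exact: is_deriveM (hf t) (hg t). Qed.

Lemma deriv_fun_cst (c : R) : deriv_fun (fun=> c) (fun=> 0).
Proof. by move=> t; exact: is_derive_cst. Qed.

Lemma deriv_fun_affine f f' (a b : R) : deriv_fun f f' ->
  deriv_fun (fun t => f (a * t + b)) (fun t => a * f' (a * t + b)).
Proof.
move=> hf t; have h : is_derive t 1 (fun s => a * s + b) a.
  have := deriv_funD (deriv_funM (deriv_fun_cst a) (fun s => is_derive_id s 1))
    (deriv_fun_cst b) t.
  by rewrite mulr1 mulr0 !addr0.
by rewrite mulrC; exact: is_derive1_comp (hf _) h.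
Qed.

Lemma diffn_cst n (c : R) : diffn n (fun=> c).
Proof.
by elim: n c => //= n IH c; exists (fun=> 0) => //; exact: deriv_fun_cst.
Qed.

Lemma diffnD n f g : diffn n f -> diffn n g -> diffn n (fun t => f t + g t).
Proof.
elim: n f g => //= n IH f g [f' ff' nf'] [g' gg' ng'].
by exists (fun t => f' t + g' t); [exact: deriv_funD|exact: IH].
Qed.

Lemma diffnM n f g : diffn n f -> diffn n g -> diffn n (fun t => f t * g t).
Proof.
elim: n f g => // n IH f g nf ng.
have [f' ff' nf'] := nf; have [g' gg' ng'] := ng.
exists (fun t => f t * g' t + g t * f' t); first exact: deriv_funM.
by apply: diffnD; apply: IH => //; exact: diffn_le.
Qed.

Lemma diffnV n f : (forall t, f t != 0) -> diffn n f -> diffn n (fun t => (f t)^-1).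
Proof.
move=> f0; elim: n => // n IH nf; have [f' ff' nf'] := nf.
have iV := IH (diffn_le nf).
exists (fun t => -1 * ((f t)^-1 * (f t)^-1 * f' t)).
  move=> t; have := is_deriveV (f0 t) (ff' t); congr is_derive.
  by rewrite /GRing.scale /=; field.
by apply: diffnM; [exact: diffn_cst|apply: diffnM => //; exact: diffnM].
Qed.

Lemma diffn_affine n f (a b : R) : diffn n f -> diffn n (fun t => f (a * t + b)).
Proof.
elim: n f => //= n IH f [f' ff' nf'].
exists (fun t => a * f' (a * t + b)); first exact: deriv_fun_affine.
by apply: diffnM; [exact: diffn_cst|exact: IH].
Qed.

Lemma smooth_cst (c : R) : smooth (fun=> c).
Proof. by move=> n; exact: diffn_cst. Qed.

Lemma smoothD f g : smooth f -> smooth g -> smooth (fun t => f t + g t).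
Proof. by move=> hf hg n; exact: diffnD. Qed.

Lemma smoothM f g : smooth f -> smooth g -> smooth (fun t => f t * g t).
Proof. by move=> hf hg n; exact: diffnM. Qed.

Lemma smoothB f g : smooth f -> smooth g -> smooth (fun t => f t - g t).
Proof.
move=> hf hg; rewrite (_ : (fun t => _) = (fun t => f t + -1 * g t)).
  by apply: smoothD => //; apply: smoothM => //; exact: smooth_cst.
by apply/funext => t; rewrite mulN1r.
Qed.

Lemma deriv_funB f f' g g' : deriv_fun f f' -> deriv_fun g g' ->
  deriv_fun (fun t => f t - g t) (fun t => f' t - g' t).
Proof. by move=> hf hg t; exact: is_deriveB (hf t) (hg t). Qed.

Lemma smooth_affine f (a b : R) : smooth f -> smooth (fun t => f (a * t + b)).
Proof. by move=> hf n; exact: diffn_affine. Qed.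

Lemma smooth_trigo (c : R) : smooth (fun t => cos (c * t)) /\ smooth (fun t => sin (c * t)).
Proof.
suff h n : diffn n (@cos R) /\ diffn n (@sin R).
  have e (f : R -> R) : (fun t => f (c * t)) = (fun t => f (c * t + 0)).
    by apply/funext => t; rewrite addr0.
  split=> n; rewrite e; [exact: diffn_affine (h n).1|exact: diffn_affine (h n).2].
elim: n => // n [nc ns]; split.
  exists (fun t => -1 * sin t).
    by move=> t; rewrite mulN1r; exact: is_derive_cos.
  by apply: diffnM => //; exact: diffn_cst.
by exists cos => // t; exact: is_derive_sin.
Qed.

Lemma deriv_cos (c : R) : deriv_fun (fun t => cos (c * t)) (fun t => - c * sin (c * t)).
Proof.
have := deriv_fun_affine c 0 (fun t => is_derive_cos t).
rewrite (_ : (fun t => cos _) = (fun t => cos (c * t))) => [h t|].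
  by have := h t; rewrite addr0 mulrN mulNr.
by apply/funext => t; rewrite addr0.
Qed.

Lemma deriv_sin (c : R) : deriv_fun (fun t => sin (c * t)) (fun t => c * cos (c * t)).
Proof.
have := deriv_fun_affine c 0 (fun t => is_derive_sin t).
rewrite (_ : (fun t => sin _) = (fun t => sin (c * t))) => [h t|].
  by have := h t; rewrite addr0.
by apply/funext => t; rewrite addr0.
Qed.

(** The function [exp(-1/t)] extended by [0], for [k = 0]; the other indices are
    there because the span of the family is stable under derivation. *)
Definition flat (k : nat) (t : R) := if 0 < t then t ^- k * expR (- t^-1) else 0.

(** From [x^(k+2) / (k+2)! <= exp(x)] at [x = 1/t]; the square gives a derivative
    [0] at the origin. *)
Lemma flat_bound k (t : R) : `|flat k t| <= k.+2`!%:R * t ^+ 2.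
Proof.
rewrite /flat; case: ifPn => [t0|_]; last by rewrite normr0 mulr_ge0// sqr_ge0.
rewrite ger0_norm ?mulr_ge0 ?expR_ge0 ?invr_ge0 ?exprn_ge0 ?(ltW t0)//.
have h : t^-1 ^+ k.+2 <= k.+2`!%:R * expR t^-1.
  have ti : 0 < t^-1 by rewrite invr_gt0.
  have h := expR_ge1Dxn k.+1 (ltW ti).
  rewrite mulrC -ler_pdivrMr ?ltr0n ?fact_gt0//.
  by apply: le_trans h; rewrite lerDr.
have -> : t ^- k = t^-1 ^+ k.+2 * t ^+ 2.
  rewrite -addn2 exprD -mulrA -exprMn mulVf ?gt_eqF// expr1n mulr1.
  by rewrite exprVn.
by rewrite expRN ler_pdivrMr ?expR_gt0// [leRHS]mulrAC ler_wpM2r ?sqr_ge0.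
Qed.

Lemma flat_deriv k : deriv_fun (flat k) (fun t => flat k.+2 t - k%:R * flat k.+1 t).
Proof.
move=> t; have [t0|t0|t0] := ltgtP t 0.
- have -> : flat k.+2 t - k%:R * flat k.+1 t = 0.
    by rewrite /flat ltNge (ltW t0)/= mulr0 subr0.
  apply: (@near_is_derive (cst 0)).
  near=> s; rewrite /flat ltNge /=; case: leP => // s0.
  suff : s < 0 by lra.
  by near: s; exact: lt_nbhsl.
- suff : is_derive t 1 (fun s : R => (s ^+ k)^-1 * expR (- s^-1))
      (flat k.+2 t - k%:R * flat k.+1 t).
    apply: near_is_derive; near=> s; rewrite /flat ifT//.
    by near: s; exact: lt_nbhsr.
  have tn0 : t != 0 by rewrite gt_eqF.
  have dV : is_derive t 1 (fun s : R => - s^-1) (t ^- 2).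
    have := is_deriveN (is_deriveV tn0 (is_derive_id t 1)).
    by rewrite scaleNr opprK /GRing.scale /= mulr1.
  have dE : is_derive t 1 (fun s : R => expR (- s^-1)) (expR (- t^-1) * t ^- 2).
    exact: is_derive1_comp (is_derive_expR _) dV.
  have dX : is_derive t 1 (fun s : R => s ^+ k) (k%:R * t ^+ k.-1).
    have := is_deriveX k (is_derive_id t 1).
    by rewrite /GRing.scale /= mulr1; congr is_derive; apply/funext => s; rewrite exprfctE.
  have tk0 : t ^+ k != 0 by rewrite expf_neq0.
  have := is_deriveM (@is_deriveV R (fun s => s ^+ k) t _ 1 tk0 dX) dE.
  congr is_derive; rewrite /flat t0 /GRing.scale /=.
  case: k dX tk0 => [|k] _ _ /=.
    by field.
  rewrite !exprS; field.
  by rewrite tn0 expf_neq0.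
- rewrite t0; have -> : flat k.+2 0 - k%:R * flat k.+1 0 = 0.
    by rewrite /flat ltxx mulr0 subr0.
  have f0 : flat k 0 = 0 by rewrite /flat ltxx.
  have h : (fun h : R => h^-1 *: (flat k (h *: 1 + 0) - flat k 0)) @ 0^' --> (0 : R).
    apply/cvgrPdist_le => e e0.
    have C0 : 0 < k.+2`!%:R :> R by rewrite ltr0n fact_gt0.
    near=> s; rewrite sub0r normrN f0 subr0 addr0 /GRing.scale /= mulr1 normrM normfV.
    have s0 : s != 0 by near: s; exact: nbhs_dnbhs_neq.
    rewrite ler_pdivrMl ?normr_gt0//.
    apply: le_trans (flat_bound k s) _.
    rewrite -real_normK ?num_real// expr2 mulrA mulrC ler_wpM2l//.
    rewrite -ler_pdivlMl//.
    near: s; apply: dnbhs0_le; rewrite mulr_gt0// invr_gt0//.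
  by apply: DeriveDef; [apply/cvg_ex; exists 0|exact: cvg_lim].
Unshelve. all: by end_near.
Qed.

Lemma smooth_flat k : smooth (flat k).
Proof.
move=> n; elim: n k => // n IH k.
exists (fun t => flat k.+2 t + - k%:R * flat k.+1 t).
  by move=> t; rewrite mulNr; exact: flat_deriv.
by apply: diffnD => //; apply: diffnM => //; exact: diffn_cst.
Qed.

Lemma flat0_ge0 (t : R) : 0 <= flat 0 t.
Proof. by rewrite /flat; case: ifP => // _; rewrite expr0 invr1 mul1r expR_ge0. Qed.

Lemma flat0_gt0 (t : R) : 0 < t -> 0 < flat 0 t.
Proof. by move=> t0; rewrite /flat t0 expr0 invr1 mul1r expR_gt0. Qed.

Lemma flat0_le0 (t : R) : t <= 0 -> flat 0 t = 0.
Proof. by move=> t0; rewrite /flat ltNge t0. Qed.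

(** The usual smooth transition from [0] to [1] over [0, 1]; the denominator is
    positive because [t] and [1 - t] are not both negative. *)
Definition step (t : R) := flat 0 t * (flat 0 t + flat 0 (-1 * t + 1))^-1.

Lemma step_den (t : R) : 0 < flat 0 t + flat 0 (-1 * t + 1).
Proof.
have [t0|t0] := ltP 0 t; first by rewrite ltr_pwDl ?flat0_ge0 ?flat0_gt0.
by rewrite ltr_wpDl ?flat0_ge0 ?flat0_gt0//; lra.
Qed.

Lemma smooth_step : smooth step.
Proof.
have h : smooth (fun t => flat 0 t + flat 0 (-1 * t + 1)).
  by apply: smoothD (smooth_flat 0) _; exact: smooth_affine (smooth_flat 0).
move=> n; apply: diffnM; first exact: smooth_flat.
by apply: diffnV => // t; rewrite gt_eqF// step_den.
Qed.

Lemma step0 (t : R) : t <= 0 -> step t = 0.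
Proof. by move=> t0; rewrite /step flat0_le0// mul0r. Qed.

Lemma step1 (t : R) : 1 <= t -> step t = 1.
Proof.
move=> t1; have := step_den t; rewrite /step (@flat0_le0 (-1 * t + 1)); last lra.
by rewrite addr0 => h; rewrite divff// gt_eqF.
Qed.

Lemma step_ge0 (t : R) : 0 <= step t.
Proof. by rewrite /step divr_ge0 ?flat0_ge0// ltW// step_den. Qed.

Lemma step_le1 (t : R) : step t <= 1.
Proof. by rewrite /step ler_pdivrMr ?step_den// mul1r lerDl flat0_ge0. Qed.

(** A mollifier: supported in [0, 1] and of integral [step 1 - step 0 = 1]. *)
Definition bump := step^`()%classic.

Lemma deriv_step : deriv_fun step bump.
Proof. exact: smooth_deriv_fun smooth_step. Qed.

Lemma smooth_bump : smooth bump.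
Proof. exact: smooth_derive1 smooth_step. Qed.

Lemma bump_out (t : R) : ~~ (0 <= t <= 1) -> bump t = 0.
Proof.
suff h (c : R) : (\near t, step t = c) -> bump t = 0.
  rewrite negb_and -!ltNge => /orP[t0|t1].
    apply: (h 0); near=> s; rewrite step0//; apply: ltW; near: s; exact: lt_nbhsl.
  apply: (h 1); near=> s; rewrite step1//; apply: ltW; near: s; exact: lt_nbhsr.
move=> sc; have cs : \near t, cst c t = step t by apply: filterS sc => s ->.
have d := near_is_derive cs (is_derive_cst c t 1).
by rewrite /bump derive1E (@derive_val _ _ _ _ _ _ _ d).
Unshelve. all: by end_near.
Qed.

Lemma bump_bounded : exists2 C : R, 0 < C & forall t, `|bump t| <= C.
Proof.
have cb : continuous (fun t => `|bump t|).
  by move=> t; apply: cvg_norm; exact: smooth_continuous smooth_bump t.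
have [c c01 cmax] := @EVT_max R (fun t => `|bump t|) 0 1 ler01
  (continuous_subspaceT cb).
exists (`|bump c| + 1) => [|t]; first by rewrite ltr_wpDl.
case: (boolP (0 <= t <= 1)) => [t01|/bump_out ->].
  by apply: le_trans (cmax t _) _; rewrite ?in_itv//= lerDl.
by rewrite normr0 addr_ge0.
Qed.

End Smooth.

(** * Mollification on the line *)

Section Mollification.
Variable R : realType.
Local Notation mu := (@lebesgue_measure R).
Implicit Types (f g h : R -> R) (c d e : R).

Section RealIntegrable.
Variable D : set R.
Hypothesis mD : measurable D.

Lemma integrableZ_real (C : R) f : mu.-integrable D (EFin \o f) ->
  mu.-integrable D (EFin \o (fun t => C * f t)).
Proof. by move=> fi; have : mu.-integrable D (fun t => (C%:E * (f t)%:E)%E) by exact: integrableZl. Qed.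

Lemma integrableD_real f g : mu.-integrable D (EFin \o f) -> mu.-integrable D (EFin \o g) ->
  mu.-integrable D (EFin \o (fun t => f t + g t)).
Proof.
by move=> fi gi; have : mu.-integrable D (fun t => ((f t)%:E + (g t)%:E)%E) by exact: integrableD.
Qed.

Lemma integrableB_real f g : mu.-integrable D (EFin \o f) -> mu.-integrable D (EFin \o g) ->
  mu.-integrable D (EFin \o (fun t => f t - g t)).
Proof.
by move=> fi gi; have : mu.-integrable D (fun t => ((f t)%:E - (g t)%:E)%E) by exact: integrableB.
Qed.

Lemma integrable_norm_real f : mu.-integrable D (EFin \o f) ->
  mu.-integrable D (EFin \o (fun t => `|f t|)).
Proof. by move=> fi; have := integrable_abse fi. Qed.

Lemma le_integrable_real f g : measurable_fun D f ->
  (forall t, D t -> `|f t| <= g t) -> mu.-integrable D (EFin \o g) ->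
  mu.-integrable D (EFin \o f).
Proof.
move=> mf fg; apply: le_integrable => //; first exact/measurable_EFinP.
by move=> t Dt /=; rewrite lee_fin (le_trans (fg t Dt))// ler_norm.
Qed.

End RealIntegrable.

Lemma integrable_indic_itv (B c d : R) :
  mu.-integrable setT (fun t => (B * \1_(`[c, d]%classic) t)%:E).
Proof.
under eq_fun do rewrite EFinM.
apply: integrableZl => //.
have : mu.-integrable `[c, d]%classic (fun=> 1%:E).
  apply/integrableP; split=> //.
  rewrite integral_cst//= normr1 mul1e.
  by have := compact_finite_measure (@segment_compact R c d).
move=> i1; have := (@integrable_mkcond _ _ _ mu _ _ (measurable_itv _)).1 i1; congr integrable.
by apply/funext => t; rewrite patchE indicE; case: ifP.
Qed.

Lemma integral_indic_itv (B c d : R) : c <= d ->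
  \int[mu]_t (B * \1_(`[c, d]%classic) t) = B * (d - c).
Proof.
move=> cd; rewrite RintegralZl//; last first.
  have := integrable_indic_itv 1 c d.
  by congr integrable; apply/funext => t; rewrite mul1r.
congr (_ * _); rewrite /Rintegral integral_indic//= setIT.
rewrite lebesgue_measure_itv /= lte_fin; case: ltgtP cd => [_|//|->] _ //.
by rewrite subrr.
Qed.

Section BoundedSupport.
Variables (D : set R) (h : R -> R) (B c d : R).
Hypotheses (mD : measurable D) (mh : measurable_fun D h).
Hypothesis hB : {ae mu, forall t, D t -> `|h t| <= B * \1_(`[c, d]%classic) t}.
Hypothesis B0 : 0 <= B.

Lemma integral_bounded_support : (\int[mu]_(t in D) `|(h t)%:E| <= (B * (`|d - c|))%:E)%E.
Proof.
have -> : (\int[mu]_(t in D) `|(h t)%:E| = \int[mu]_(t in D) `|h t|%:E)%E by [].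
apply: (@le_trans _ _ (\int[mu]_(t in D) (B * \1_(`[c, d]%classic) t)%:E)%E).
  apply: ae_ge0_le_integral => //.
  - by apply/measurable_EFinP; exact: measurableT_comp.
  - by move=> t _; rewrite lee_fin mulr_ge0.
  - by apply/measurable_EFinP; apply: measurable_funM => //; exact: measurable_indic.
apply: (@le_trans _ _ (\int[mu]_t (B * \1_(`[c, d]%classic) t)%:E)%E).
  apply: ge0_subset_integral => //.
    exact: measurable_int (integrable_indic_itv B c d).
  by move=> t _; rewrite lee_fin mulr_ge0.
have -> : (\int[mu]_t (B * \1_(`[c, d]%classic) t)%:E =
    (\int[mu]_t (B * \1_(`[c, d]%classic) t))%:E)%E.
  rewrite /Rintegral fineK//; apply: integrable_fin_num => //.
  exact: integrable_indic_itv.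
have [cd|dc] := leP c d.
  by rewrite integral_indic_itv// ger0_norm// subr_ge0.
rewrite lee_fin (_ : (fun t => _) = cst 0).
  by rewrite Rintegral_cst// mul0r mulr_ge0.
apply/funext => t; rewrite indicE memNset ?mulr0//= in_itv/=.
by move=> /andP[] ct td; have := le_trans ct td; rewrite leNgt dc.
Qed.

Lemma integrable_bounded_support : mu.-integrable D (EFin \o h).
Proof.
apply/integrableP; split; first exact/measurable_EFinP.
by apply: le_lt_trans integral_bounded_support _; rewrite ltry.
Qed.

Lemma Rintegral_bounded_support : `|\int[mu]_(t in D) h t| <= B * `|d - c|.
Proof.
apply: le_trans (@le_normr_Rintegral _ _ R mu D h mD integrable_bounded_support) _.
rewrite -lee_fin /Rintegral fineK.
  exact: integral_bounded_support.
apply: integrable_fin_num => //.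
by have := integrable_abse integrable_bounded_support.
Qed.

End BoundedSupport.

Definition bump_at c e t := bump ((t - c) / e).

Lemma bump_atE c e : bump_at c e = (fun t => bump (e^-1 * t + - c / e)).
Proof. by apply/funext => t; rewrite /bump_at; congr bump; ring. Qed.

Lemma smooth_bump_at c e : smooth (bump_at c e).
Proof. by rewrite bump_atE; exact: smooth_affine (@smooth_bump R). Qed.

Lemma smooth_measurable f (D : set R) : smooth f -> measurable_fun D f.
Proof.
move=> sf; apply: measurable_funTS; apply: continuous_measurable_fun.
exact: smooth_continuous sf.
Qed.

Lemma bump_at_out c e t : 0 < e -> ~~ (c <= t <= c + e) -> bump_at c e t = 0.
Proof.
move=> e0 h; apply: bump_out; move: h; apply: contra.
rewrite pmulr_lge0 ?invr_gt0// subr_ge0 ler_pdivrMr// mul1r => /andP[-> ].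
by rewrite lerBlDl.
Qed.

Lemma bump_at_bound : exists2 C : R, 0 < C & forall c e t, 0 < e ->
  `|bump_at c e t| <= C * \1_(`[c, c + e]%classic) t.
Proof.
have [C C0 CP] := bump_bounded R; exists C => // c e t e0.
rewrite indicE; have [h|h] := boolP (c <= t <= c + e).
  by rewrite mem_set /= ?in_itv// mulr1; exact: CP.
by rewrite bump_at_out// normr0 mulr_ge0// ltW.
Qed.

Lemma deriv_step_at c e : deriv_fun (fun t => step ((t - c) / e)) (fun t => e^-1 * bump_at c e t).
Proof.
have := deriv_fun_affine e^-1 (- c / e) (@deriv_step R).
rewrite (_ : (fun t => step _) = (fun t => step ((t - c) / e))) ?bump_atE//.
by apply/funext => t; congr step; ring.
Qed.

Lemma integral_bump_at c e : 0 < e -> \int[mu]_t bump_at c e t = e.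
Proof.
move=> e0; pose F t := e * step ((t - c) / e).
have dF : deriv_fun F (bump_at c e).
  move=> t; have := deriv_funM (deriv_fun_cst e) (deriv_step_at c e) t.
  by rewrite mulr0 addr0 mulrA mulfV ?gt_eqF// mul1r.
have cF : continuous F.
  move=> t; apply: differentiable_continuous; apply/derivable1_diffP.
  exact: (@ex_derive _ _ _ _ _ _ _ (dF t)).
have ce : c < c + e by rewrite ltrDl.
have := @continuous_FTC2 R (bump_at c e) F c (c + e) ce.
have -> : F (c + e) = e by rewrite /F addrAC subrr add0r divff ?gt_eqF// step1// mulr1.
have -> : F c = 0 by rewrite /F subrr mul0r step0// mulr0.
move=> h; transitivity (\int[mu]_(t in `[c, c + e]) bump_at c e t).
  rewrite [RHS]Rintegral_mkcond; apply: eq_Rintegral => t _; rewrite patchE.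
  case: ifPn => // /negP ht; apply: bump_at_out => //; apply/negP => hct.
  by apply: ht; rewrite inE /= in_itv.
rewrite /Rintegral h ?sube0//.
- by apply: continuous_subspaceT => t; exact: smooth_continuous (smooth_bump_at c e) t.
- split=> [t _| |].
  + exact: (@ex_derive _ _ _ _ _ _ _ (dF t)).
  + by apply: cvg_at_right_filter; exact: cF.
  + by apply: cvg_at_left_filter; exact: cF.
- by move=> t _; rewrite (deriv_funE dF).
Qed.

Section SquareIntegrableScalar.
Variable g : R -> R.
Hypothesis mg : measurable_fun setT g.
Hypothesis g2 : mu.-integrable setT (fun t => (g t ^+ 2)%:E).

(** [2 |bump g| <= bump^2 + g^2]. *)
Lemma integrable_mul_bump c e : 0 < e ->
  mu.-integrable setT (EFin \o (fun t => bump_at c e t * g t)).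
Proof.
move=> e0; have [C C0 CP] := bump_at_bound.
have mb : measurable_fun setT (bump_at c e) by apply: smooth_measurable; exact: smooth_bump_at.
have iC := integrable_indic_itv (C ^+ 2) c (c + e).
have : mu.-integrable setT (fun t => ((C ^+ 2 * \1_(`[c, c + e]%classic) t)%:E + (g t ^+ 2)%:E)%E).
  exact: integrableD.
apply: le_integrable => //; first by apply/measurable_EFinP; exact: measurable_funM.
move=> t _; rewrite -EFinD !abse_EFin lee_fin.
rewrite [leRHS]ger0_norm; last first.
  by apply: addr_ge0; [apply: mulr_ge0 => //|]; exact: sqr_ge0.
apply: (@le_trans _ _ (bump_at c e t ^+ 2 + g t ^+ 2)).
  have h1 := sqr_ge0 (bump_at c e t + g t); have h2 := sqr_ge0 (bump_at c e t - g t).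
  have h3 := sqr_ge0 (bump_at c e t); have h4 := sqr_ge0 (g t).
  by rewrite ler_norml; apply/andP; split; move: h1 h2 h3 h4; rewrite !expr2; lra.
rewrite lerD2r -real_normK ?num_real//.
have := CP c e t e0; rewrite indicE; case: (_ \in _) => /=; rewrite ?mulr1 ?mulr0.
  by move=> h; rewrite ler_sqr ?nnegrE// ltW.
by rewrite normr_le0 => /eqP ->; rewrite normr0 expr0n.
Qed.

Lemma square_integrable_locally : locally_integrable setT g.
Proof.
split=> //; first exact: openT.
move=> K _ cK; have mK := compact_measurable cK.
have i1 : mu.-integrable K (fun=> 1%:E).
  apply/integrableP; split=> //; rewrite integral_cst//= normr1 mul1e.
  exact: compact_finite_measure.
have iK : mu.-integrable K (fun t => (1%:E + (g t ^+ 2)%:E)%E).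
  by apply: integrableD => //; exact: integrableS g2.
have : mu.-integrable K (EFin \o g).
  apply: le_integrable iK => //; first by apply/measurable_EFinP; exact: measurable_funTS.
  move=> t _; rewrite -EFinD !abse_EFin lee_fin [leRHS]ger0_norm ?addr_ge0 ?sqr_ge0//.
  rewrite -[g t ^+ 2]real_normK ?num_real//; have := sqr_ge0 (`|g t| - 1).
  by have := normr_ge0 (g t); rewrite !expr2; nra.
by move=> /integrableP[].
Qed.

(** Testing against the mollifiers concentrated at a Lebesgue point of [g]
    recovers the value of [g] there. *)
Lemma ae_eq0_bump (U : set R) : open U ->
  (forall c e, 0 < e -> `[c, c + e]%classic `<=` U ->
     \int[mu]_t (bump_at c e t * g t) = 0) ->
  {ae mu, forall t, U t -> g t = 0}.
Proof.
move=> oU gU; have [C C0 CP] := bump_at_bound.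
have lg := square_integrable_locally.
apply: ae_imp (lebesgue_differentiation lg) => c gc Uc.
apply/eqP; rewrite -normr_le0; apply/ler_addgt0Pr => eta eta0; rewrite add0r.
have eta1 : 0 < eta / (4 * C) by rewrite divr_gt0 ?mulr_gt0.
move/fine_cvgP : gc => [fgc /cvgrPdist_lt/(_ _ eta1) gc].
have [r0 r0p r0U] : exists2 r0 : R, 0 < r0 & ball c r0 `<=` U.
  by have /nbhs_ballP[r /= rp rU] := open_nbhs_nbhs (conj oU Uc); exists r.
near (0 : R)^'+ => e.
have e0 : 0 < e by near: e; exact: nbhs_right_gt.
have er : e < r0 by near: e; exact: nbhs_right_lt.
have dfin : davg g c e \is a fin_num by near: e.
have dlt : fine (davg g c e) < eta / (4 * C).
  have : `|0 - (fine \o davg g c) e| < eta / (4 * C) by near: e.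
  rewrite sub0r normrN /= ger0_norm//; apply: fine_ge0; exact: iavg_ge0.
have mball := measurable_ball c e.
have e'0 : 0 < e / 2 by rewrite divr_gt0.
have sub : `[c, c + e / 2]%classic `<=` ball c e.
  move=> t /=; rewrite in_itv /= => /andP[ct tc].
  by rewrite /ball /= ltr_distlC; apply/andP; split; move: ct tc e0; lra.
(* The half ensures that the support of the mollifier lies in the ball over which
   the mean oscillation of [g] is taken. *)
have g0 : \int[mu]_t (bump_at c (e / 2) t * g t) = 0.
  by apply: gU => // t /sub /(@le_ball _ _ c _ _ (ltW er)) /r0U.
have ib : mu.-integrable setT (EFin \o (fun t => bump_at c (e / 2) t)).
  apply: (@integrable_bounded_support _ _ C c (c + e / 2)) => //.
  - by apply: smooth_measurable; exact: smooth_bump_at.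
  - by apply: aeW => t _; exact: CP.
  - exact: ltW.
have ig := integrable_mul_bump c e'0.
have igc : mu.-integrable (ball c e) (EFin \o (fun t => g t - g c)).
  have i1 : mu.-integrable (ball c e) (EFin \o cst (g c)).
    apply/integrableP; split; first exact/measurable_EFinP.
    rewrite (@eq_integral _ _ _ _ _ (cst `|g c|%:E))// integral_cst//=.
    by rewrite lebesgue_measure_ball ?(ltW e0)// -EFinM ltry.
  have i2 : mu.-integrable (ball c e) (EFin \o g).
    apply/integrableP; split; first by apply/measurable_EFinP; exact: measurable_funTS.
    have [_ _ h] := lg.
    apply: le_lt_trans (h _ _ (@segment_compact R (c - e) (c + e))); last by [].
    apply: ge0_subset_integral => //.
      by apply/measurable_EFinP; apply: measurableT_comp => //; exact: measurable_funTS.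
    move=> t; rewrite /ball /= ltr_distlC in_itv /= => /andP[h1 h2].
    by rewrite !ltW.
  exact: integrableB_real.
have key : (e / 2) * g c = \int[mu]_(t in ball c e) (bump_at c (e / 2) t * (g c - g t)).
  transitivity (\int[mu]_t (g c * bump_at c (e / 2) t - bump_at c (e / 2) t * g t)).
    rewrite RintegralB//; last first.
      exact: integrableZ_real ib.
    by rewrite RintegralZl// integral_bump_at// g0 subr0 mulrC.
  rewrite [RHS]Rintegral_mkcond; apply: eq_Rintegral => t _; rewrite patchE.
  case: ifPn => [_|ht]; first by ring.
  rewrite bump_at_out//; first by rewrite mulr0 mul0r subr0.
  apply: contra ht => hct; rewrite inE; apply: sub; by rewrite /= in_itv.
have bound : `|(e / 2) * g c| <= C * (fine (davg g c e) * (e *+ 2)).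
  rewrite key.
  have mgc : measurable_fun (ball c e) (fun t => bump_at c (e / 2) t * (g c - g t)).
    apply: measurable_funM; first by apply: smooth_measurable; exact: smooth_bump_at.
    by apply: measurable_funB => //; exact: measurable_funTS.
  have le t : `|bump_at c (e / 2) t * (g c - g t)| <= C * `|g t - g c|.
    rewrite normrM [`|g c - _|]distrC ler_wpM2r//; apply: le_trans (CP c _ t e'0) _.
    by rewrite ler_piMr ?(ltW C0)// indicE; case: (_ \in _).
  have iC : mu.-integrable (ball c e) (EFin \o (fun t => C * `|g t - g c|)).
    by apply: integrableZ_real => //; exact: integrable_norm_real.
  have ikey : mu.-integrable (ball c e) (EFin \o (fun t => bump_at c (e / 2) t * (g c - g t))).
    apply: le_integrable iC => //; first exact/measurable_EFinP.
    by move=> t _ /=; rewrite lee_fin [leRHS]ger0_norm ?mulr_ge0 ?(ltW C0).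
  apply: le_trans (@le_normr_Rintegral _ _ R mu _ _ mball ikey) _.
  apply: (@le_trans _ _ (\int[mu]_(t in ball c e) (C * `|g t - g c|))).
    apply: le_Rintegral => //.
    exact: integrable_norm_real ikey.
  rewrite RintegralZl//; last exact: integrable_norm_real igc.
  rewrite ler_wpM2l ?(ltW C0)// /davg /iavg lebesgue_measure_ball ?(ltW e0)//.
  have e2 : 0 < e *+ 2 by rewrite mulrn_wgt0.
  rewrite inver gt_eqF// fineM//=; last by apply: integrable_fin_num => //; exact: integrable_norm_real igc.
  by rewrite mulrAC mulVf ?gt_eqF// mul1r.
move: bound; rewrite normrM [`|e / 2|]gtr0_norm// => bound.
have e2 : 0 < e / 2 by [].
rewrite -(ler_pM2l e2); apply: le_trans bound _.
apply: (@le_trans _ _ (C * (eta / (4 * C) * (e *+ 2)))).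
  by rewrite ler_wpM2l ?(ltW C0)// ler_wpM2r ?mulrn_wge0 ?(ltW e0)// ltW.
by rewrite le_eqVlt; apply/orP; left; apply/eqP; field; rewrite gt_eqF.
Unshelve. all: by end_near.
Qed.

End SquareIntegrableScalar.
End Mollification.

(** * Translation-invariant mollifications on a half-line *)

Section HalfLineScalar.
Variables (R : realType) (s a : R).
Local Notation mu := (@lebesgue_measure R).

(** Both half-lines at once: [s = 1] gives [t > a] and [s = -1] gives [t < a]. *)
Definition half_line : set R := [set t | 0 < s * (t - a)].

Hypothesis s1 : s ^+ 2 = 1.

Lemma open_half_line : open half_line.
Proof.
have -> : half_line = (fun t => s * (t - a)) @^-1` [set x | 0 < x] by [].
apply: open_comp; last exact: open_gt.
move=> t _; apply: cvgM; first exact: cvg_cst.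
by apply: cvgB; [exact: cvg_id|exact: cvg_cst].
Qed.

Variable g : R -> R.
Hypothesis mg : measurable_fun setT g.
Hypothesis g2 : mu.-integrable setT (EFin \o (fun t => g t ^+ 2)).

Let tail (c e : R) (n : nat) : R :=
  \int[mu]_t (\1_(`[c + s * n%:R, c + s * n%:R + e]%classic) t * g t ^+ 2).

Let mtail (c d : R) : measurable_fun setT (fun t => \1_(`[c, d]%classic) t * g t ^+ 2).
Proof.
by apply: measurable_funM; [exact: measurable_indic|exact: measurable_funX].
Qed.

Let itail (c d : R) : mu.-integrable setT (EFin \o (fun t => \1_(`[c, d]%classic) t * g t ^+ 2)).
Proof.
apply: le_integrable_real g2 => // t _.
rewrite ger0_norm; last by apply: mulr_ge0; rewrite ?sqr_ge0.
by apply: ler_piMl; [exact: sqr_ge0|rewrite indicE; case: (_ \in _)].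
Qed.

Let tail_cvg (c e : R) : tail c e @ \oo --> (0 : R).
Proof.
pose f_ (n : nat) t := (\1_(`[c + s * n%:R, c + s * n%:R + e]%classic) t * g t ^+ 2)%:E : \bar R.
have h : (\int[mu]_t f_ n t)%E @[n --> \oo] --> (\int[mu]_t (cst 0%E t))%E.
  apply: (@dominated_cvg _ _ R mu setT measurableT f_ (cst 0%E) (fun t => (g t ^+ 2)%:E)) => //.
  - by move=> n; apply/measurable_EFinP; exact: mtail.
  - move=> t _; apply: cvg_near_cst.
    exists (Num.truncn (`|t - c| + `|e|)).+1 => // n /= nN.
    have nbig : `|t - c| + `|e| < n%:R.
      apply: lt_le_trans (truncnS_gt _) _; by rewrite ler_nat.
    rewrite /f_ indicE memNset ?mul0r//= in_itv /= => /andP[h1 h2].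
    have : `|s * n%:R| <= `|t - c| + `|e|.
      move: (ler_norm (t - c)) (ler_norm e) (ler_norm (- (t - c))) (ler_norm (- e)).
      by rewrite !normrN ler_norml => *; apply/andP; split; move: h1 h2; lra.
    have -> : `|s * n%:R| = n%:R.
      rewrite normrM normr_nat (_ : `|s| = 1) ?mul1r//.
      by apply/eqP; rewrite -(@eqrXn2 _ 2)// expr1n real_normK ?num_real// s1.
    by rewrite leNgt nbig.
  - move=> n t _; rewrite /f_ abse_EFin lee_fin ger0_norm; last by apply: mulr_ge0; rewrite ?sqr_ge0.
    by apply: ler_piMl; [exact: sqr_ge0|rewrite indicE; case: (_ \in _)].
rewrite integral0 in h.
have {}h : (\int[mu]_t f_ n t)%E @[n --> \oo] --> (0 : R)%:E by exact: h.
exact: fine_cvg h.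
Qed.

(** If the mollified values of [g] do not change under translation, they vanish:
    translated to infinity they are bounded by the tails of [g ^ 2]. *)
Lemma ae_eq0_bump_translation :
  (forall c d e, 0 < e -> `[c, c + e]%classic `<=` half_line ->
     `[d, d + e]%classic `<=` half_line ->
     \int[mu]_t (bump_at c e t * g t) = \int[mu]_t (bump_at d e t * g t)) ->
  {ae mu, forall t, half_line t -> g t = 0}.
Proof.
move=> gT; apply: (ae_eq0_bump mg g2 open_half_line) => c e e0 ceI.
have [C C0 CP] := bump_at_bound R.
set M := \int[mu]_t _.
have ss : s * s = 1 by rewrite -expr2.
have MC (n : nat) (eta : R) : 0 < eta -> `|M| <= C * (eta * e) + C / eta * tail c e n.
  move=> eta0; pose cn := c + s * n%:R.
  have -> : M = \int[mu]_t (bump_at cn e t * g t).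
    apply: gT => // t /=; rewrite in_itv /= => /andP[h1 h2].
    have : half_line (t - s * n%:R).
      by apply: ceI; rewrite /= in_itv /=; apply/andP; split; move: h1 h2; rewrite /cn; lra.
    rewrite /half_line /= => h; apply: (lt_le_trans h).
    have -> : s * (t - s * n%:R - a) = s * (t - a) - (s * s) * n%:R by ring.
    by rewrite ss mul1r gerBl.
  have ig := integrable_mul_bump mg g2 cn e0.
  apply: le_trans (@le_normr_Rintegral _ _ R mu _ _ measurableT ig) _.
  have i1 := @integrable_indic_itv R (C * eta) cn (cn + e).
  have i2 := integrableZ_real measurableT (C / eta) (itail cn (cn + e)).
  rewrite /tail -/cn.
  have -> : C * (eta * e) + C / eta * \int[mu]_t (\1_(`[cn, cn + e]%classic) t * g t ^+ 2) =
    \int[mu]_t (C * eta * \1_(`[cn, cn + e]%classic) t +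
       C / eta * (\1_(`[cn, cn + e]%classic) t * g t ^+ 2)).
    rewrite (RintegralD measurableT i1 i2) integral_indic_itv ?lerDl ?ltW//.
    rewrite (RintegralZl _ measurableT (itail cn (cn + e))).
    by congr (_ + _); ring.
  apply: le_Rintegral => //.
  - exact: integrable_norm_real ig.
  - exact: integrableD_real.
  move=> t _; rewrite normrM; apply: (le_trans (ler_wpM2r _ (CP cn e t e0))) => //.
  rewrite indicE; case: (_ \in _) => /=; last by rewrite !(mulr0, mul0r) addr0.
  rewrite !mulr1 mul1r -[g t ^+ 2]real_normK ?num_real//.
  have -> : C * eta + C / eta * `|g t| ^+ 2 = C * (eta + `|g t| ^+ 2 / eta) by ring.
  rewrite ler_pM2l// -(ler_pM2r eta0) mulrDl divfK ?gt_eqF//.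
  have := sqr_ge0 (eta - `|g t|); have := normr_ge0 (g t); have := sqr_ge0 eta.
  by have := sqr_ge0 `|g t|; rewrite !expr2; nra.
apply/eqP/negP => /negP M0; have Mp : 0 < `|M| by rewrite normr_gt0.
(* With this [eta] the first term of the bound is half of [|M|]. *)
pose eta := `|M| / (2 * C * e).
have eta0 : 0 < eta by rewrite divr_gt0 ?mulr_gt0.
have half n : `|M| / 2 <= C / eta * tail c e n.
  have := MC n eta eta0; rewrite (_ : C * (eta * e) = `|M| / 2); first by lra.
  by rewrite /eta; field; rewrite !gt_eqF.
have : (fun n => C / eta * tail c e n) @ \oo --> C / eta * 0.
  by apply: cvgM; [exact: cvg_cst|exact: tail_cvg].
rewrite mulr0 => /cvgrPdist_lt/(_ (`|M| / 2)); rewrite divr_gt0// => /(_ isT)[N _ NP].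
have := NP N (leqnn _); rewrite /= sub0r normrN => h.
have := half N; rewrite leNgt; apply/negP; rewrite negbK.
by apply: le_lt_trans h; exact: ler_norm.
Qed.

End HalfLineScalar.

(** * Elementary tensors in [L2 H I] *)

Section Coefficients.
Variables (R : realType) (I : interval R).
Local Notation mu := (@lebesgue_measure R).
Implicit Types phi psi : R -> R.

Definition bounded_support_by phi (B c d : R) :=
  forall t, [set` I] t -> `|phi t| <= B * \1_(`[c, d]%classic) t.

(** Only values on [I] matter: the cutoffs at an end point of a half-line do not
    vanish on the other side of that point. *)
Definition bounded_support phi := measurable_fun [set` I] phi /\
  exists B c d, 0 <= B /\ bounded_support_by phi B c d.

Lemma bounded_supportZ (r : R) phi :
  bounded_support phi -> bounded_support (fun t => r * phi t).
Proof.
move=> [mphi [B [c [d [B0 h]]]]]; split; first exact: measurable_funM.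
exists (`|r| * B), c, d; split=> [|t It]; first exact: mulr_ge0.
by rewrite normrM -mulrA ler_wpM2l// h.
Qed.

Lemma bounded_supportD phi psi : bounded_support phi -> bounded_support psi ->
  bounded_support (fun t => phi t + psi t).
Proof.
move=> [mphi [B [c [d [B0 h]]]]] [mpsi [B' [c' [d' [B'0 h']]]]].
split; first exact: measurable_funD.
exists (B + B'), (Num.min c c'), (Num.max d d'); split=> [|t It]; first exact: addr_ge0.
have sub (e e' x y : R) : Num.min c c' <= e -> e' <= Num.max d d' ->
    \1_(`[e, e']%classic) t <= \1_(`[Num.min c c', Num.max d d']%classic) t :> R.
  move=> h1 h2; rewrite !indicE; case: (boolP (t \in `[e, e']%classic)) => // tI.
  rewrite mem_set//= in_itv /=; move: tI; rewrite inE /= in_itv /= => /andP[h3 h4].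
  by rewrite (le_trans h1 h3) (le_trans h4 h2).
apply: le_trans (ler_normD _ _) _; rewrite mulrDl lerD//.
  apply: le_trans (h t It) _; rewrite ler_wpM2l// sub//.
    by rewrite ge_min lexx.
  by rewrite le_max lexx.
apply: le_trans (h' t It) _; rewrite ler_wpM2l// sub//.
  by rewrite ge_min lexx orbT.
by rewrite le_max lexx orbT.
Qed.

Lemma bounded_support_eq phi psi : (forall t, [set` I] t -> phi t = psi t) ->
  bounded_support phi -> bounded_support psi.
Proof.
move=> e [mphi [B [c [d [B0 h]]]]]; split.
  by apply: eq_measurable_fun mphi => t; rewrite inE; exact: e.
by exists B, c, d; split=> // t It; rewrite -e// h.
Qed.

(** A segment containing the support, unlike the support itself, is explicit for all
    functions met below, and it is inherited by products and derivatives. *)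
Definition smooth_in phi := smooth phi /\ exists c d,
  [/\ c <= d, `[c, d]%classic `<=` [set` I] & forall t, ~~ (c <= t <= d) -> phi t = 0].

Lemma continuous_bounded_support phi (c d : R) : continuous phi -> c <= d ->
  (forall t, [set` I] t -> ~~ (c <= t <= d) -> phi t = 0) -> bounded_support phi.
Proof.
move=> cphi cd phi0; split.
  by apply: measurable_funTS; exact: continuous_measurable_fun.
have cn : continuous (fun t => `|phi t|) by move=> t; apply: cvg_norm; exact: cphi.
have [b _ bmax] := @EVT_max R (fun t => `|phi t|) c d cd (continuous_subspaceT cn).
exists `|phi b|, c, d; split=> // t It; rewrite indicE.
have [h|h] := boolP (c <= t <= d); last by rewrite phi0// normr0 mulr_ge0.
by rewrite mem_set /= ?in_itv// mulr1; apply: bmax; rewrite in_itv.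
Qed.

Lemma smooth_in_bounded phi : smooth_in phi -> bounded_support phi.
Proof.
move=> [sphi [c [d [cd _ phi0]]]].
apply: (@continuous_bounded_support _ c d) => //; first exact: smooth_continuous.
by move=> t _; exact: phi0.
Qed.

Lemma smooth_in_deriv phi : smooth_in phi -> smooth_in phi^`()%classic.
Proof.
move=> [sphi [c [d [cd cdI phi0]]]]; split; first exact: smooth_derive1.
exists c, d; split=> // t tcd.
suff near0 : \near t, cst 0 t = phi t.
  have h := near_is_derive near0 (is_derive_cst 0 t 1).
  by rewrite derive1E (@derive_val _ _ _ _ _ _ _ h).
move: tcd; rewrite negb_and -!ltNge => /orP[tc|dt].
  near=> x; rewrite phi0// negb_and -!ltNge; apply/orP; left.
  by near: x; exact: lt_nbhsl.
near=> x; rewrite phi0// negb_and -!ltNge; apply/orP; right.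
by near: x; exact: lt_nbhsr.
Unshelve. all: by end_near.
Qed.

Lemma smooth_in_test phi : smooth_in phi -> test_function I phi.
Proof.
move=> [sphi [c [d [cd cdI phi0]]]].
have sub : closure [set t | phi t != 0] `<=` `[c, d]%classic.
  rewrite [X in _ `<=` X](closure_id _).1; last exact: interval_closed.
  apply: closureS => t /= pt; rewrite in_itv /=.
  by apply: contraNT pt => h; rewrite phi0.
split; first exact: smooth_derivable.
  by apply: subclosed_compact (@segment_compact R c d) sub; exact: closed_closure.
exact: subset_trans sub cdI.
Qed.

Lemma smooth_inM phi psi : smooth psi -> smooth_in phi ->
  smooth_in (fun t => psi t * phi t).
Proof.
move=> spsi [sphi [c [d [cd cdI phi0]]]]; split; first exact: smoothM.
by exists c, d; split=> // t h; rewrite phi0// mulr0.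
Qed.

Lemma smooth_in_bump (c e : R) : 0 < e -> `[c, c + e]%classic `<=` [set` I] ->
  smooth_in (bump_at c e).
Proof.
move=> e0 ceI; split; first exact: smooth_bump_at.
by exists c, (c + e); split=> //; [rewrite lerDl ltW|move=> t; exact: bump_at_out].
Qed.

Lemma smooth_step_at (c e : R) : smooth (fun t => step ((t - c) / e)).
Proof.
have := @smooth_affine R _ e^-1 (- c / e) (@smooth_step R).
rewrite (_ : (fun t => step _) = (fun t => step ((t - c) / e)))//.
by apply/funext => t; congr step; ring.
Qed.

(** Its derivative is the difference of two translates of the same mollifier. *)
Definition plateau (c d e t : R) := step ((t - c) / e) - step ((t - d) / e).

Lemma smooth_in_plateau (c d e : R) : 0 < e -> `[c, c + e]%classic `<=` [set` I] ->
  `[d, d + e]%classic `<=` [set` I] -> smooth_in (plateau c d e).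
Proof.
move=> e0 ceI deI; split; first by apply: smoothB; exact: smooth_step_at.
have lt_out x t : t < x -> step ((t - x) / e) = 0.
  by move=> tx; rewrite step0// pmulr_lle0 ?invr_gt0// subr_le0 ltW.
have gt_out x t : x + e < t -> step ((t - x) / e) = 1.
  by move=> tx; rewrite step1// ler_pdivlMr// mul1r lerBrDl ltW.
have II x y t : [set` I] x -> [set` I] y -> x <= t -> t <= y -> [set` I] t.
  by move=> Ix Iy xt ty; apply: (@interval_is_interval R I x y) => //; apply/andP.
exists (Num.min c d), (Num.max c d + e); split.
- by apply: (@le_trans _ _ (Num.max c d)); rewrite ?lerDl ?(ltW e0)// le_max ge_min lexx.
- have Im : [set` I] (Num.min c d).
    have [_|_] := leP c d; [apply: ceI|apply: deI];
      by rewrite /= in_itv /= lexx lerDl ltW.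
  have IM : [set` I] (Num.max c d + e).
    have [_|_] := leP c d; [apply: deI|apply: ceI];
      by rewrite /= in_itv /= lexx lerDl ltW.
  by move=> t; rewrite /= in_itv /= => /andP[]; exact: II.
- move=> t; rewrite negb_and -!ltNge lt_min => /orP[/andP[tc td]|h].
    by rewrite /plateau !lt_out// subrr.
  rewrite /plateau !gt_out ?subrr//; apply: le_lt_trans h; rewrite lerD2r le_max lexx ?orbT//.
Qed.

Lemma plateau_deriv (c d e : R) :
  (plateau c d e)^`()%classic = (fun t => e^-1 * (bump_at c e t - bump_at d e t)).
Proof.
apply: deriv_funE => t; rewrite mulrBr.
exact: deriv_funB (deriv_step_at c e) (deriv_step_at d e) t.
Qed.

End Coefficients.

Section Tensors.
Variables (R : realType) (H : preHilbertType R) (I : interval R).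
Hypothesis H_separable : separable H.
Local Notation mu := (@lebesgue_measure R).
Implicit Types (phi psi : R -> R) (f g : H) (x : L2 H I).

(** The elementary tensors of [L2 H I], seen as [L2(I)] tensored with [H]. *)
Definition tensor phi f : L2 H I := L2_of I (fun t => (phi t)%:C *: f).

Lemma tensor_hnorm2_bound phi f (B c d : R) : measurable_fun [set` I] phi -> 0 <= B ->
  bounded_support_by I phi B c d ->
  (\int[mu]_(t in [set` I]) (hnorm ((phi t)%:C *: f) ^+ 2)%:E <=
   ((B * hnorm f) ^+ 2 * `|d - c|)%:E)%E.
Proof.
move=> mphi B0 phiB.
have e t : (hnorm ((phi t)%:C *: f) ^+ 2)%:E = (`|(phi t ^+ 2 * hnorm f ^+ 2)%:E|)%E :> \bar R.
  rewrite abse_EFin ger0_norm; last by apply: mulr_ge0; exact: sqr_ge0.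
  by rewrite hnormZr exprMn real_normK ?num_real.
under eq_integral do rewrite e.
apply: integral_bounded_support => //.
- by apply: measurable_funM => //; exact: measurable_funX.
- apply: aeW => t It; rewrite normrM exprMn [`|hnorm f ^+ 2|]ger0_norm ?sqr_ge0// mulrAC.
  rewrite ler_wpM2r ?sqr_ge0// normrX; have := phiB t It; rewrite indicE.
  case: (_ \in _) => /=; rewrite ?mulr1 ?mulr0; first by move=> h; rewrite ler_sqr ?nnegrE.
  by rewrite normr_le0 => /eqP ->; rewrite normr0 expr0n.
- exact: sqr_ge0.
Qed.

Lemma tensor_strongly_measurable phi f : measurable_fun [set` I] phi ->
  strongly_measurable I (fun t => (phi t)%:C *: f).
Proof.
by move=> mphi; apply: strongly_measurable_scale => //; exact: strongly_measurable_cst.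
Qed.

Lemma tensor_square_integrable phi f : bounded_support I phi ->
  square_integrable I (fun t => (phi t)%:C *: f).
Proof.
move=> [mphi [B [c [d [B0 phiB]]]]]; split; first exact: tensor_strongly_measurable.
by apply: le_lt_trans (tensor_hnorm2_bound _ _ _ phiB) _; rewrite ?ltry.
Qed.

Lemma tensorE phi f : bounded_support I phi ->
  (L2_repr (tensor phi f) : R -> H) = (fun t => (phi t)%:C *: f) %[ae mu in [set` I]].
Proof. by move=> bphi; apply: L2_ofE; exact: tensor_square_integrable. Qed.

Lemma tensor_hnorm phi f (B c d : R) : measurable_fun [set` I] phi -> 0 <= B ->
  bounded_support_by I phi B c d -> hnorm (tensor phi f) ^+ 2 <= (B * hnorm f) ^+ 2 * `|d - c|.
Proof.
move=> mphi B0 phiB; rewrite -lee_fin -(@L2_hnorm2 _ _ _ _ (fun t => (phi t)%:C *: f)).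
- exact: tensor_hnorm2_bound.
- exact: tensor_strongly_measurable.
- by apply: tensorE; split=> //; exists B, c, d.
Qed.

Lemma tensor_eq phi psi f : bounded_support I phi ->
  (forall t, [set` I] t -> phi t = psi t) -> tensor phi f = tensor psi f.
Proof.
move=> bphi e; have bpsi := bounded_support_eq e bphi.
apply: L2_eqP; apply: ae_imp2 (tensorE f bphi) (tensorE f bpsi) => t h1 h2 It.
by rewrite h1// h2// e.
Qed.

Lemma tensorD phi psi f : bounded_support I phi -> bounded_support I psi ->
  tensor (fun t => phi t + psi t) f = tensor phi f + tensor psi f.
Proof.
move=> bphi bpsi; apply: L2_eqP; have hS := tensorE f (bounded_supportD bphi bpsi).
have h1 := L2_reprP 1 (tensor phi f) (tensor psi f); rewrite scale1r in h1.
have h2 : (fun t => L2_repr (tensor phi f) t + L2_repr (tensor psi f) t) =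
    (fun t => (phi t + psi t)%:C *: f) %[ae mu in [set` I]].
  apply: ae_imp2 (tensorE f bphi) (tensorE f bpsi) => t e1 e2 It.
  by rewrite e1// e2// -scalerDl -rmorphD.
have h3 := ae_imp2 (fun t e1 e2 => fun It : [set` I] t => etrans (e1 It) (esym (e2 It))) hS h2.
by apply: ae_imp2 h1 h3 => t e1 e2 It; rewrite e2// e1// scale1r.
Qed.

Lemma tensor_scale (z : R[i]) (r : R) phi f g : bounded_support I phi -> z *: f = r%:C *: g ->
  z *: tensor phi f = tensor (fun t => r * phi t) g.
Proof.
move=> bphi e; apply: L2_eqP; have h1 := L2_reprP z (tensor phi f) 0.
rewrite addr0 in h1.
have h2 := ae_imp2 (fun t e1 e2 => fun It : [set` I] t => conj (e1 It) (e2 It))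
  (tensorE f bphi) (L2_repr0 H I).
have h3 := ae_imp2 (fun t e1 e2 => fun It : [set` I] t => conj (e1 It) (e2 It)) h1 h2.
apply: ae_imp2 h3 (tensorE g (bounded_supportZ r bphi)) => t e1 e2 It.
have [-> [-> ->]] := e1 It; rewrite e2// addr0 scalerA mulrC -scalerA e.
by rewrite scalerA -rmorphM /= mulrC.
Qed.

Lemma tensorZ (r : R) phi f : bounded_support I phi ->
  tensor (fun t => r * phi t) f = r%:C *: tensor phi f.
Proof. by move=> bphi; rewrite (@tensor_scale _ r _ _ f). Qed.

Lemma tensor_i phi f : bounded_support I phi -> 'i *: tensor phi f = tensor phi ('i *: f).
Proof.
move=> bphi; rewrite (@tensor_scale _ 1 _ _ ('i *: f))//; last by rewrite scale1r.
by apply: tensor_eq => [|t _]; [exact: bounded_supportZ|exact: mul1r].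
Qed.

Lemma tensor0 phi : bounded_support I phi -> tensor phi 0 = 0.
Proof.
move=> bphi; apply: L2_eqP; apply: ae_imp2 (tensorE 0 bphi) (L2_repr0 H I) => t e1 e2 It.
by rewrite e1// e2// scaler0.
Qed.

Lemma rdot_tensor x phi f : bounded_support I phi ->
  rdot x (tensor phi f) = \int[mu]_(t in [set` I]) (phi t * rdot (L2_repr x t) f).
Proof.
move=> bphi; apply: L2_rdot_ae.
  apply: measurable_funM; first exact: bphi.1.
  exact: strongly_measurable_rdot (L2_reprI x).1 (strongly_measurable_cst I f).
by apply: ae_imp (tensorE f bphi) => t e It; rewrite e// rdotZr.
Qed.

(** Extension by [0] turns coordinates of [x] into functions on the whole line, to
    which mollification applies. *)
Lemma coordinate_sqr_integrable x (h : R -> R) (C : R) : measurable_fun [set` I] h ->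
  (forall t, [set` I] t -> `|h t| <= C * hnorm (L2_repr x t)) ->
  measurable_fun setT (h \_ [set` I]) /\
  mu.-integrable setT (EFin \o (fun t => (h \_ [set` I]) t ^+ 2)).
Proof.
move=> mh hC; split; first exact: (measurable_restrictT h (measurable_itv I)).1 mh.
have -> : EFin \o (fun t => (h \_ [set` I]) t ^+ 2) = (EFin \o (fun t => h t ^+ 2)) \_ [set` I].
  by apply/funext => t; rewrite /= !patchE; case: ifP => // _; rewrite expr0n.
suff h2 : mu.-integrable [set` I] (EFin \o (fun t => h t ^+ 2)).
  exact: (@integrable_mkcond _ _ _ mu _ _ (measurable_itv I)).1 h2.
have ix : mu.-integrable [set` I] (EFin \o (fun t => C ^+ 2 * hnorm (L2_repr x t) ^+ 2)).
  by apply: integrableZ_real => //; exact: hnorm2_integrable (L2_reprI x).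
apply: le_integrable_real ix => //; first exact: measurable_funX.
move=> t It; rewrite ger0_norm ?sqr_ge0// -exprMn -[h t ^+ 2]real_normK ?num_real//.
have := hC t It => h1; rewrite ler_sqr ?nnegrE//; exact: le_trans h1.
Qed.

(** Separability of [H] leaves countably many null sets to discard. *)
Lemma L2_eq0_coordinate x :
  (forall f, {ae mu, forall t, [set` I] t -> rdot (L2_repr x t) f = 0}) -> x = 0.
Proof.
move=> x0; have [s sd] := H_separable; apply: L2_eqP.
have := @ae_foralln _ _ _ mu (fun n t => [set` I] t -> rdot (L2_repr x t) (s n) = 0) (fun n => x0 (s n)).
move=> h; apply: ae_imp2 h (L2_repr0 H I) => t {}h e It; rewrite e//.
set y := L2_repr x t in h *; apply: hnorm_eq0; apply/eqP/negP => /negP y0.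
have yp : 0 < hnorm y by rewrite lt_neqAle eq_sym y0 hnorm_ge0.
have [_ [n _ <-] yn] := sd y _ yp.
have : hnorm y ^+ 2 <= hnorm y * hnorm (y - s n).
  rewrite hnorm_sq -[X in rdot y X](subrK (s n)) rdotDr h// addr0.
  exact: le_trans (ler_norm _) (rdot_CS _ _).
by rewrite expr2 ler_pM2l// leNgt yn.
Qed.

Lemma integral_patch phi (h : R -> R) :
  \int[mu]_(t in [set` I]) (phi t * h t) = \int[mu]_t (phi t * (h \_ [set` I]) t).
Proof.
rewrite Rintegral_mkcond; apply: eq_Rintegral => t _; rewrite !patchE.
by case: ifP => // _; rewrite mulr0.
Qed.

Lemma measurable_coordinate x f :
  measurable_fun [set` I] (fun t => rdot (L2_repr x t) f).
Proof. exact: strongly_measurable_rdot (L2_reprI x).1 (strongly_measurable_cst I f). Qed.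

(** Totality of the elementary tensors of test functions, obtained by mollifying
    each coordinate of [x]. *)
Lemma L2_eq0_test x : open [set` I] ->
  (forall phi f, smooth_in I phi -> rdot x (tensor phi f) = 0) -> x = 0.
Proof.
move=> oI x0; apply: L2_eq0_coordinate => f.
have [|mg g2] := @coordinate_sqr_integrable x _ (hnorm f) (measurable_coordinate x f).
  by move=> t _; rewrite mulrC; exact: rdot_CS.
have := ae_eq0_bump mg g2 oI; move=> h; apply: ae_imp (h _) => [t + It|c e e0 ceI].
  by move=> /(_ It); rewrite patchE mem_set.
have sb := smooth_in_bump e0 ceI.
by rewrite -integral_patch -rdot_tensor ?x0//; exact: smooth_in_bounded.
Qed.

End Tensors.

(** * Wave packets and oscillating solutions *)

Lemma mul_ii (R : realType) : 'i * 'i = -1 :> R[i].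
Proof. by apply/eqP; rewrite eq_complex /= !mul0r mulr0 mulr1 sub0r addr0 oppr0 !eqxx. Qed.

Lemma rdot_iN (R : realType) (V : preHilbertType R) (u v : V) :
  rdot ('i *: u) v = - rdot u ('i *: v).
Proof.
rewrite -Im_dotp /rdot dotpZl; case: (dotp u v) => x y /=.
by rewrite mul0r mul1r sub0r.
Qed.

Lemma hnorm_i (R : realType) (V : preHilbertType R) (u : V) : hnorm ('i *: u) = hnorm u.
Proof.
by rewrite /hnorm -/(rdot _ _) -/(rdot _ _) rdot_iN scalerA mul_ii scaleN1r rdotNr opprK.
Qed.

Lemma rdot_i_self (R : realType) (V : preHilbertType R) (u : V) : rdot u ('i *: u) = 0.
Proof. by rewrite -Im_dotp dotpp. Qed.

Lemma imag_scale (R : realType) (V : lmodType R[i]) (omega : R) (u : V) :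
  (0 +i* omega) *: u = omega%:C *: ('i *: u).
Proof.
rewrite scalerA; congr (_ *: _).
by apply/eqP; rewrite eq_complex /= !mulr0 !mul0r mulr1 subr0 addr0 !eqxx.
Qed.

Section WavePackets.
Variables (R : realType) (H : preHilbertType R) (I : interval R).
Hypothesis H_separable : separable H.
Variables (omega : R) (f : H).
Local Notation mu := (@lebesgue_measure R).
Implicit Types (phi psi : R -> R).

Let C t := cos (omega * t).
Let S t := sin (omega * t).

Let sC : smooth C. Proof. exact: (smooth_trigo omega).1. Qed.
Let sS : smooth S. Proof. exact: (smooth_trigo omega).2. Qed.

(** The class of [t |-> phi(t) exp(i omega t) f]. *)
Definition wave phi : L2 H I :=
  tensor I (fun t => C t * phi t) f + tensor I (fun t => S t * phi t) ('i *: f).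

Lemma wave_deriv phi : smooth_in I phi ->
  tensor I (fun t => C t * phi t)^`()%classic f +
    tensor I (fun t => S t * phi t)^`()%classic ('i *: f) =
  wave phi^`()%classic + (0 +i* omega) *: wave phi.
Proof.
move=> sphi.
have b1 := smooth_in_bounded (smooth_inM sC sphi).
have b2 := smooth_in_bounded (smooth_inM sS sphi).
have sphi' := smooth_in_deriv sphi.
have b1' := smooth_in_bounded (smooth_inM sC sphi').
have b2' := smooth_in_bounded (smooth_inM sS sphi').
have dphi := smooth_deriv_fun sphi.1.
have -> : (fun t => C t * phi t)^`()%classic =
    (fun t => C t * phi^`()%classic t + - omega * (S t * phi t)).
  by rewrite (deriv_funE (deriv_funM (@deriv_cos _ omega) dphi)); apply/funext => t; rewrite /C /S; ring.
have -> : (fun t => S t * phi t)^`()%classic =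
    (fun t => S t * phi^`()%classic t + omega * (C t * phi t)).
  by rewrite (deriv_funE (deriv_funM (@deriv_sin _ omega) dphi)); apply/funext => t; rewrite /C /S; ring.
rewrite (tensorD H_separable f b1' (bounded_supportZ _ b2)).
rewrite (tensorD H_separable ('i *: f) b2' (bounded_supportZ _ b1)) addrACA.
congr (_ + _); rewrite /wave scalerDr addrC; congr (_ + _).
  by rewrite (@tensor_scale _ _ _ H_separable _ omega _ _ ('i *: f) b1)// imag_scale.
rewrite (@tensor_scale _ _ _ H_separable _ (- omega) _ _ f b2)//.
by rewrite imag_scale (scalerA 'i 'i) mul_ii scaleN1r scalerN rmorphN scaleNr.
Qed.

Lemma integrable_tensor (x : L2 H I) phi g : bounded_support I phi ->
  mu.-integrable [set` I] (EFin \o (fun t => phi t * rdot (L2_repr x t) g)).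
Proof.
move=> bphi; have h := rdot_integrable (L2_reprI x) (tensor_square_integrable H_separable g bphi).
by move: h; congr integrable; apply/funext => t; rewrite /= rdotZr.
Qed.

Lemma rdot_wave (x : L2 H I) phi : smooth_in I phi ->
  rdot x (wave phi) = \int[mu]_(t in [set` I]) (phi t *
    (C t * rdot (L2_repr x t) f + S t * rdot (L2_repr x t) ('i *: f))).
Proof.
move=> sphi; have b1 := smooth_in_bounded (smooth_inM sC sphi).
have b2 := smooth_in_bounded (smooth_inM sS sphi).
rewrite /wave rdotDr (rdot_tensor H_separable x f b1) (rdot_tensor H_separable x ('i *: f) b2).
rewrite -(RintegralD _ (integrable_tensor x f b1) (integrable_tensor x ('i *: f) b2))//.
by apply: eq_Rintegral => t _; ring.
Qed.

(* [exp(i omega t)] has modulus [1]. *)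
Let wave_norm (z t : R) :
  hnorm ((C t * z)%:C *: f + (S t * z)%:C *: ('i *: f)) ^+ 2 = z ^+ 2 * hnorm f ^+ 2.
Proof.
have CS : C t ^+ 2 + S t ^+ 2 = 1 by exact: cos2Dsin2.
rewrite hnorm_sq rdotDl !rdotDr !rdotZl !rdotZr (rdotC _ f) rdot_i_self -!hnorm_sq hnorm_i.
rewrite -[RHS]mul1r -CS; ring.
Qed.

(** On a plateau of length [L] the wave packet has constant norm [|f|]. *)
Lemma wave_hnorm_ge phi (c L : R) : smooth_in I phi -> 0 <= L ->
  `[c, c + L]%classic `<=` [set` I] -> (forall t, c <= t <= c + L -> phi t = 1) ->
  L * hnorm f ^+ 2 <= hnorm (wave phi) ^+ 2.
Proof.
move=> sphi L0 cI phi1.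
have b1 := smooth_in_bounded (smooth_inM sC sphi).
have b2 := smooth_in_bounded (smooth_inM sS sphi).
pose w t := (C t * phi t)%:C *: f + (S t * phi t)%:C *: ('i *: f).
have wE : (L2_repr (wave phi) : R -> H) = w %[ae mu in [set` I]].
  have h := L2_reprP 1 (tensor I (fun t => C t * phi t) f) (tensor I (fun t => S t * phi t) ('i *: f)).
  rewrite scale1r in h.
  have h2 := ae_imp2 (fun t e1 e2 => fun It : [set` I] t => conj (e1 It) (e2 It))
    (tensorE H_separable f b1) (tensorE H_separable ('i *: f) b2).
  apply: ae_imp2 h h2 => t e1 e2 It; have [e3 e4] := e2 It.
  by rewrite /wave e1// e3 e4 scale1r.
have mw : strongly_measurable I w.
  have := strongly_measurableP 1 (tensor_strongly_measurable H_separable f b1.1)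
    (tensor_strongly_measurable H_separable ('i *: f) b2.1).
  by under eq_fun do rewrite scale1r.
rewrite -lee_fin -(L2_hnorm2 mw wE).
have -> : ((L * hnorm f ^+ 2)%:E = \int[mu]_(t in `[c, (c + L)%R]) (cst (hnorm f ^+ 2)%:E t))%E.
  rewrite integral_cst//= lebesgue_measure_itv /= lte_fin.
  have [cL|] := ltP c (c + L); first by rewrite -EFinB -EFinM addrAC subrr add0r mulrC.
  by move=> h; rewrite mule0 (_ : L = 0) ?mul0r//; lra.
apply: (@le_trans _ _ (\int[mu]_(t in `[c, (c + L)%R]) (hnorm (w t) ^+ 2)%:E)%E).
  apply: ge0_le_integral => //.
  - by move=> t _; rewrite lee_fin sqr_ge0.
  - by apply: (measurable_funS (measurable_itv I) cI); exact: measurable_hnorm2.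
  - by move=> t; rewrite /= in_itv /= => tc; rewrite lee_fin wave_norm phi1// expr1n mul1r.
apply: ge0_subset_integral => //; first exact: measurable_hnorm2.
by move=> t _; rewrite lee_fin sqr_ge0.
Qed.

(** Only the two transitions of the plateau contribute, whatever its length. *)
Lemma wave_plateau_deriv_le : exists2 K : R, 0 <= K & forall c d : R,
  `[c, c + 1]%classic `<=` [set` I] -> `[d, d + 1]%classic `<=` [set` I] ->
  hnorm (wave (plateau c d 1)^`()%classic) <= K * hnorm f.
Proof.
have [B B0 BP] := bump_at_bound R.
exists (4 * B) => [|c d cI dI]; first by rewrite mulr_ge0// ltW.
have one (T : R -> R) (e : R) (h : H) : smooth T -> (forall t, `|T t| <= 1) ->
    `[e, e + 1]%classic `<=` [set` I] -> hnorm h = hnorm f ->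
    bounded_support I (fun t => T t * bump_at e 1 t) /\
    hnorm (tensor I (fun t => T t * bump_at e 1 t) h) <= B * hnorm f.
  move=> sT T1 eI hf.
  have bs := smooth_in_bounded (smooth_inM sT (smooth_in_bump ltr01 eI)).
  split=> //.
  have by_ : bounded_support_by I (fun t => T t * bump_at e 1 t) B e (e + 1).
    move=> t It; rewrite normrM; apply: le_trans (BP e 1 t ltr01).
    by rewrite ler_piMl.
  rewrite -(@ler_pXn2r _ 2) ?nnegrE ?mulr_ge0 ?hnorm_ge0 ?(ltW B0)//.
  have := @tensor_hnorm R H I H_separable _ h _ _ _ bs.1 (ltW B0) by_.
  by rewrite addrAC subrr add0r normr1 mulr1 hf.
have C1 t : `|C t| <= 1 by rewrite ler_norml cos_geN1 cos_le1.
have S1 t : `|S t| <= 1 by rewrite ler_norml sin_geN1 sin_le1.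
have [b1 n1] := one C c f sC C1 cI erefl; have [b2 n2] := one C d f sC C1 dI erefl.
have [b3 n3] := one S c ('i *: f) sS S1 cI (hnorm_i f); have [b4 n4] := one S d ('i *: f) sS S1 dI (hnorm_i f).
have split_ (T : R -> R) (h : H) : bounded_support I (fun t => T t * bump_at c 1 t) ->
   bounded_support I (fun t => T t * bump_at d 1 t) ->
   tensor I (fun t => T t * (plateau c d 1)^`()%classic t) h =
   tensor I (fun t => T t * bump_at c 1 t) h + (-1)%:C *: tensor I (fun t => T t * bump_at d 1 t) h.
  move=> h1 h2; rewrite -(tensorZ H_separable (-1) h h2).
  rewrite -(tensorD H_separable h h1 (bounded_supportZ _ h2)) plateau_deriv.
  by congr L2_of; apply/funext => t; congr (_%:C *: _); rewrite invr1; ring.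
rewrite /wave (split_ C f b1 b2) (split_ S ('i *: f) b3 b4).
apply: le_trans (hnormD _ _) _.
have m1 (x y : L2 H I) : hnorm (x + (-1)%:C *: y) <= hnorm x + hnorm y.
  by apply: le_trans (hnormD _ _) _; rewrite hnormZr normrN normr1 mul1r.
apply: le_trans (lerD (m1 _ _) (m1 _ _)) _.
apply: le_trans (lerD (lerD n1 n2) (lerD n3 n4)) _.
by rewrite le_eqVlt; apply/orP; left; apply/eqP; ring.
Qed.

End WavePackets.

Section Oscillating.
Variables (R : realType) (H : preHilbertType R) (I : interval R) (s a : R).
Hypothesis H_separable : separable H.
Hypothesis s1 : s ^+ 2 = 1.
Hypothesis I_half : [set` I] = half_line s a.
Local Notation mu := (@lebesgue_measure R).
Implicit Types (phi psi : R -> R) (f : H) (x : L2 H I).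

(** The term [i omega w] that appears when a wave packet is differentiated cancels
    against the right-hand side of the weak equation. *)
Lemma rdot_transport (V : preHilbertType R) (omega : R) (x t1 t2 w w' z1 z2 : V) :
  t1 + t2 = w' + (0 +i* omega) *: w -> 'i *: w = z1 + z2 ->
  rdot x t1 = omega * rdot x z1 -> rdot x t2 = omega * rdot x z2 -> rdot x w' = 0.
Proof.
move=> e ew h1 h2; have := congr1 (rdot x) e.
by rewrite imag_scale ew rdotDr h1 h2 rdotDr rdotZr rdotDr; lra.
Qed.

(** A square-integrable weak solution of [x' = i omega x] on a half-line vanishes:
    [exp(-i omega t) x(t)] would be constant. *)
Lemma L2_eq0_oscillating x (omega : R) :
  (forall phi f, smooth_in I phi ->
     rdot x (tensor I phi^`()%classic f) = omega * rdot x (tensor I phi ('i *: f))) ->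
  x = 0.
Proof.
move=> xd; pose C t := cos (omega * t); pose S t := sin (omega * t).
have [sC sS] : smooth C /\ smooth S by exact: smooth_trigo.
pose r f t := rdot (L2_repr x t) f.
pose g f t := C t * r f t + S t * r ('i *: f) t.
have mr f : measurable_fun [set` I] (r f) by exact: measurable_coordinate.
have mgI f : measurable_fun [set` I] (g f).
  by apply: measurable_funD; apply: measurable_funM => //; exact: smooth_measurable.
have Cle t : `|C t| <= 1 by rewrite ler_norml cos_geN1 cos_le1.
have Sle t : `|S t| <= 1 by rewrite ler_norml sin_geN1 sin_le1.
have gx f t : [set` I] t -> `|g f t| <= (hnorm f + hnorm ('i *: f)) * hnorm (L2_repr x t).
  move=> _; rewrite /g mulrDl; apply: le_trans (ler_normD _ _) _; rewrite !normrM.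
  by apply: lerD; rewrite mulrC; apply: (le_trans (ler_piMr _ _)) => //;
    rewrite mulrC; exact: rdot_CS.
have waveE phi f : smooth_in I phi ->
    rdot x (wave I omega f phi) = \int[mu]_t (phi t * (g f \_ [set` I]) t).
  by move=> sphi; rewrite (rdot_wave H_separable omega f x sphi) -integral_patch.
have wave0 psi f : smooth_in I psi -> rdot x (wave I omega f psi^`()%classic) = 0.
  move=> spsi; have s1' := smooth_inM sC spsi; have s2' := smooth_inM sS spsi.
  apply: (rdot_transport (wave_deriv H_separable omega f spsi) _
    (xd _ f s1') (xd _ ('i *: f) s2')).
  rewrite /wave scalerDr (tensor_i H_separable f (smooth_in_bounded s1')).
  by rewrite (tensor_i H_separable ('i *: f) (smooth_in_bounded s2')).
have g0 f : {ae mu, forall t, [set` I] t -> g f t = 0}.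
  have [mg g2] := coordinate_sqr_integrable (mgI f) (gx f).
  have h := @ae_eq0_bump_translation R s a s1 (g f \_ [set` I]) mg g2.
  rewrite -I_half in h.
  apply: ae_imp (h _) => [t + It|c d e e0 ceI deI].
    by move=> /(_ It); rewrite patchE mem_set.
  have sp := smooth_in_plateau e0 ceI deI.
  have := wave0 _ f sp; rewrite (waveE _ _ (smooth_in_deriv sp)) plateau_deriv.
  have ic := integrable_mul_bump mg g2 c e0; have id := integrable_mul_bump mg g2 d e0.
  have -> : \int[mu]_t (e^-1 * (bump_at c e t - bump_at d e t) * (g f \_ [set` I]) t) =
     \int[mu]_t (e^-1 * (bump_at c e t * (g f \_ [set` I]) t - bump_at d e t * (g f \_ [set` I]) t)).
    by apply: eq_Rintegral => t _; ring.
  rewrite (RintegralZl _ measurableT (integrableB_real measurableT ic id)).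
  rewrite (RintegralB measurableT ic id) => h0.
  have en0 : e^-1 != 0 by rewrite invr_eq0 gt_eqF.
  by apply: subr0_eq; apply: (mulfI en0); rewrite h0 mulr0.
apply: (L2_eq0_coordinate H_separable) => f.
apply: ae_imp2 (g0 f) (g0 ('i *: f)) => t g1 g2 It.
have {g1}g1 := g1 It; have {g2}g2 := g2 It.
have ii : r ('i *: ('i *: f)) t = - r f t by rewrite /r scalerA mul_ii scaleN1r rdotNr.
move: g1 g2; rewrite /g ii -/(r f t) => g1 g2.
have CS : C t ^+ 2 + S t ^+ 2 = 1 by exact: cos2Dsin2.
rewrite -[r f t]mul1r -CS.
have -> : (C t ^+ 2 + S t ^+ 2) * r f t = C t * (C t * r f t + S t * r ('i *: f) t)
  - S t * (C t * r ('i *: f) t + S t * - r f t) by ring.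
by rewrite g1 g2 !mulr0 subr0.
Qed.

End Oscillating.

(** * Test elements and cutoffs at an end point *)

Section TestElements.
Variables (R : realType) (H : preHilbertType R) (I : interval R).
Hypothesis H_separable : separable H.
Local Notation mu := (@lebesgue_measure R).
Implicit Types (phi psi : R -> R) (f g : H) (A : operator H).

Lemma preminimal_tensor (c : R) A phi f g : smooth_in I phi -> A (f, g) ->
  preminimal c A I (tensor I phi f,
    tensor I (fun t => c * phi^`()%classic t) f + tensor I phi g).
Proof.
move=> sphi Afg; have bphi := smooth_in_bounded sphi.
have bphi' := bounded_supportZ c (smooth_in_bounded (smooth_in_deriv sphi)).
exists 1%N, (fun=> phi), (fun=> f), (fun=> g); split.
- by move=> _; exact: smooth_in_test.
- by [].
- by apply: ae_imp (tensorE H_separable f bphi) => t e It; rewrite e// big_ord1.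
rewrite /=; set u := tensor I _ f; set v := tensor I phi g.
have := L2_reprP 1 u v; rewrite scale1r => h.
have h2 := ae_imp2 (fun t e1 e2 => fun It : [set` I] t => conj (e1 It) (e2 It))
  (tensorE H_separable f bphi') (tensorE H_separable g bphi).
apply: ae_imp2 h h2 => t e1 e2 It; have [e3 e4] := e2 It.
by rewrite big_ord1 e1// scale1r /u /v e3 e4.
Qed.

Lemma minimal_tensor A phi f g : smooth_in I phi -> A (f, g) ->
  minimal_operator A I (tensor I phi f, tensor I phi^`()%classic f + tensor I phi g).
Proof.
move=> sphi Afg e e0; have := preminimal_tensor 1 sphi Afg.
under eq_fun do rewrite mul1r.
by move=> h; eexists; [exact: h|rewrite subrr hnorm0].
Qed.

Lemma maximal_tensor A phi f g u v : maximal_operator A I (u, v) ->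
  smooth_in I phi -> A (f, g) ->
  - rdot u (tensor I phi^`()%classic f) + rdot u (tensor I phi g) = rdot v (tensor I phi f).
Proof.
move=> muv sphi Afg; have h := preminimal_tensor (-1) sphi Afg.
have inc : op_closure (preminimal (-1) A I) (tensor I phi f,
    tensor I (fun t => -1 * phi^`()%classic t) f + tensor I phi g).
  by move=> e e0; eexists; [exact: h|rewrite subrr hnorm0].
have e : rdot (tensor I (fun t => -1 * phi^`()%classic t) f + tensor I phi g) u =
    rdot (tensor I phi f) v.
  exact: (congr1 (@complex.Re R) (muv _ inc)).
rewrite [RHS]rdotC -e [RHS]rdotC rdotDr.
rewrite (tensorZ H_separable (-1) f (smooth_in_bounded (smooth_in_deriv sphi))) rdotZr.
by rewrite mulN1r.
Qed.

(** The negative norm is dual to the graph norm of [A]; [1 + |f| + |g|] dominates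
    the graph norm of [(f, g)] and does not vanish at [f = 0]. *)
Lemma negative_norm_rdot A h f g : linear_operator A -> A (f, g) ->
  `|rdot h f| <= negative_norm A h * (1 + hnorm f + hnorm g).
Proof.
move=> [A0 AP _] Afg; pose K := 1 + hnorm f + hnorm g.
have K0 : 0 < K by rewrite /K -addrA ltr_pwDl// addr_ge0 ?hnorm_ge0.
pose S := [set complex.Re `|dotp h p.1| | p in
        [set p | A p /\ hnorm p.2 ^+ 2 + hnorm p.1 ^+ 2 <= 1]].
have rdot_le (z : H) : `|rdot h z| <= complex.Re `|dotp h z|.
  rewrite /rdot; case: (dotp h z) => x y /=.
  by rewrite -sqrtr_sqr ler_sqrt ?addr_ge0 ?sqr_ge0// lerDl sqr_ge0.
have le_rdot (z : H) : complex.Re `|dotp h z| <= `|rdot h z| + `|rdot h ('i *: z)|.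
  rewrite -Im_dotp /rdot; case: (dotp h z) => x y /=.
  rewrite -(@ler_pXn2r _ 2) ?nnegrE ?sqrtr_ge0 ?addr_ge0// sqr_sqrtr ?addr_ge0 ?sqr_ge0//.
  rewrite sqrrD !real_normK ?num_real//; have := mulr_ge0 (normr_ge0 x) (normr_ge0 y); lra.
have Sub : has_ubound S.
  exists (2 * hnorm h) => _ [[p q] /= [_ pq] <-].
  have p1 : hnorm p <= 1.
    rewrite -(@ler_pXn2r _ 2) ?nnegrE ?hnorm_ge0// expr1n.
    by apply: le_trans pq; rewrite lerDr sqr_ge0.
  have hp : hnorm h * hnorm p <= hnorm h by rewrite ler_piMr ?hnorm_ge0.
  apply: le_trans (le_rdot _) _.
  have h1 := rdot_CS h p; have h2 := rdot_CS h ('i *: p); rewrite hnorm_i in h2; lra.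
have inS : S (complex.Re `|dotp h ((K^-1)%:C *: f)|).
  exists ((K^-1)%:C *: f, (K^-1)%:C *: g) => //=; split.
    have := AP (K^-1)%:C _ _ Afg A0.
    by rewrite addr0.
  rewrite !hnormZr ger0_norm ?invr_ge0 ?(ltW K0)// !exprMn -mulrDr exprVn.
  rewrite ler_pdivrMl ?exprn_gt0// mulr1.
  have := hnorm_ge0 f; have := hnorm_ge0 g; rewrite /K; nra.
have := ub_le_sup Sub inS => h1.
have h2 := le_trans (rdot_le _) h1; rewrite rdotZr normrM gtr0_norm ?invr_gt0// in h2.
by rewrite ler_pdivrMl// mulrC in h2.
Qed.

End TestElements.

Section Boundary.
Variables (R : realType) (H : preHilbertType R) (I : interval R) (s a : R).
Hypothesis H_separable : separable H.
Hypothesis s1 : s = 1 \/ s = -1.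
Hypothesis I_half : [set` I] = half_line s a.
Local Notation mu := (@lebesgue_measure R).
Implicit Types (phi psi : R -> R) (f g : H) (A : operator H).

Let ss : s * s = 1.
Proof. by case: s1 => ->; ring. Qed.

Lemma segment_half_line (p q : R) : p <= q -> exists c d,
  [/\ c <= d, d - c = q - p & forall t, (c <= t <= d) = (p <= s * (t - a) <= q)].
Proof.
move=> pq; case: s1 => ->.
  exists (a + p), (a + q); split; [by rewrite lerD2l|by ring|].
  by move=> t; rewrite mul1r lerBrDl lerBlDl.
exists (a - q), (a - p); split; [by rewrite lerD2l lerN2|by ring|].
by move=> t; rewrite mulN1r opprB andbC lerBrDr lerBlDr lerBrDr lerBlDr ![_ + t]addrC;
  congr andb; apply/idP/idP => ?; lra.
Qed.

(** [1] within distance [1 / n] of the end point [a] and [0] beyond [2 / n]. *)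
Definition cutoff (n : nat) t := 1 - step (n%:R * (s * (t - a)) - 1).

Lemma cutoffE n : cutoff n = (fun t => 1 - step (n%:R * s * t + (- (n%:R * s * a) - 1))).
Proof. by apply/funext => t; congr (1 - step _); ring. Qed.

Lemma smooth_cutoff n : smooth (cutoff n).
Proof.
rewrite cutoffE; apply: smoothB; first exact: smooth_cst.
exact: smooth_affine (@smooth_step R).
Qed.

Lemma cutoff_deriv n :
  (cutoff n)^`()%classic = (fun t => - (n%:R * s * bump (n%:R * (s * (t - a)) - 1))).
Proof.
rewrite cutoffE; apply: deriv_funE => t.
have := deriv_funB (deriv_fun_cst 1)
  (deriv_fun_affine (n%:R * s) (- (n%:R * s * a) - 1) (@deriv_step R)) t.
rewrite sub0r; congr is_derive; congr (- (_ * bump _)); ring.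
Qed.

Lemma cutoff_bounded n : (0 < n)%N -> exists c d, [/\ c <= d, d - c = 2 / n%:R,
  bounded_support_by I (cutoff n) 1 c d,
  forall t, (c <= t <= d) = (0 <= s * (t - a) <= 2 / n%:R) &
  forall C, 0 <= C -> (forall t, `|bump t| <= C) ->
    bounded_support_by I (cutoff n)^`()%classic (n%:R * C) c d].
Proof.
move=> n0; have n0' : 0 < n%:R :> R by rewrite ltr0n.
have [|c [d [cd dc e]]] := @segment_half_line 0 (2 / n%:R); first by rewrite divr_ge0.
exists c, d; rewrite subr0 in dc; split=> // [t It|C C0 CP t It]; rewrite indicE.
  have t0 : 0 < s * (t - a) by move: It; rewrite I_half.
  have [h|h] := boolP (c <= t <= d).
    rewrite mem_set /= ?in_itv// mulr1 /cutoff ger0_norm ?subr_ge0 ?step_le1//.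
    by rewrite gerBl step_ge0.
  rewrite memNset /= ?in_itv ?(negbTE h)// mulr0 /cutoff step1 ?subrr ?normr0//.
  move: h; rewrite e (ltW t0) /= -ltNge ltr_pdivrMr// mulrC => /ltW; lra.
have t0 : 0 < s * (t - a) by move: It; rewrite I_half.
rewrite cutoff_deriv normrN !normrM normr_nat.
have -> : `|s| = 1 by case: s1 => ->; rewrite ?normrN normr1.
have [h|h] := boolP (c <= t <= d).
  by rewrite mem_set /= ?in_itv// !mulr1 ler_wpM2l.
rewrite memNset /= ?in_itv ?(negbTE h)// !mulr0 bump_out ?normr0 ?mulr0//.
move: h; rewrite e (ltW t0) /= -ltNge ltr_pdivrMr// mulrC => h.
by rewrite negb_and -!ltNge; apply/orP; right; lra.
Qed.

Lemma bounded_support_cutoff n : (0 < n)%N -> bounded_support I (cutoff n).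
Proof.
move=> n0; have [c [d [cd _ h _ _]]] := cutoff_bounded n0.
by split; [apply: smooth_measurable; exact: smooth_cutoff|exists 1, c, d].
Qed.

Lemma bounded_support_cutoff' n : (0 < n)%N -> bounded_support I (cutoff n)^`()%classic.
Proof.
move=> n0; have [c [d [cd _ _ _ h]]] := cutoff_bounded n0.
have [C C0 CP] := bump_bounded R.
split; first by apply: smooth_measurable; apply: smooth_derive1; exact: smooth_cutoff.
by exists (n%:R * C), c, d; split; [rewrite mulr_ge0 ?(ltW C0)|apply: h => //; exact: ltW].
Qed.

(** Both cutoffs are [1] near [a], so their difference is a test function. *)
Lemma smooth_in_cutoffB n : (0 < n)%N -> smooth_in I (fun t => cutoff 1 t - cutoff n t).
Proof.
move=> n0; have n0' : 0 < n%:R :> R by rewrite ltr0n.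
split; first by apply: smoothB; exact: smooth_cutoff.
have ninv : n%:R^-1 <= 1 :> R by rewrite invf_le1// ler1n.
have [|c [d [cd _ e]]] := @segment_half_line n%:R^-1 2; first lra.
exists c, d; split=> // t.
  rewrite I_half /half_line /= in_itv /= e => /andP[h _].
  by apply: lt_le_trans h; rewrite invr_gt0.
rewrite e negb_and -!ltNge /cutoff mul1r => /orP[h|h].
  rewrite !step0 ?subrr//; first by move: h; rewrite -[_^-1]mul1r ltr_pdivlMr// mulrC; lra.
  by lra.
rewrite !step1 ?subrr//; last lra.
have : 1 * 2 <= n%:R * (s * (t - a)) by apply: ler_pM => //; rewrite ?ler1n// ltW.
lra.
Qed.

End Boundary.

(** * Boundary values of the maximal operator *)

Lemma dotp_closure0 (R : realType) (V : preHilbertType R) (S : set V) (z p : V) :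
  subspace S -> (forall e : R, 0 < e -> exists2 u, S u & hnorm (p - u) < e) ->
  (forall u, S u -> dotp z u = 0) -> dotp z p = 0.
Proof.
move=> SS pS zS; suff h (w : V) : (forall u, S u -> rdot w u = 0) -> rdot w p = 0.
  apply: dotp_eq0; first by apply: h => u /zS; rewrite /rdot => ->.
  rewrite -[LHS]opprK -rdot_iN h ?oppr0// => u Su.
  by rewrite rdot_iN [rdot z _]/rdot zS ?oppr0//; exact: subspaceZ.
move=> wS; apply/eqP/negP => /negP; rewrite -normr_gt0 => p0.
have W0 : 0 < hnorm w + 1 by rewrite ltr_wpDl ?hnorm_ge0.
have [u Su pu] := pS _ (divr_gt0 p0 W0).
have : `|rdot w p| <= hnorm w * hnorm (p - u).
  by rewrite -[X in rdot w X](subrK u) rdotDr (wS u)// addr0; exact: rdot_CS.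
move: pu; rewrite ltr_pdivlMr// => pu.
have := hnorm_ge0 (p - u); have := hnorm_ge0 w; nra.
Qed.

(** Bilinearity: the defect of a weak identity does not change when the tests [y]
    are replaced by tests [z] such that the identity holds for [y - z]. *)
Lemma subtract_tests (R : realType) (V : preHilbertType R) (u v : V)
  (x1 x2 x3 y1 y2 y3 z1 z2 z3 : V) :
  x1 = y1 + (-1)%:C *: z1 -> x2 = y2 + (-1)%:C *: z2 -> x3 = y3 + (-1)%:C *: z3 ->
  - rdot u x1 + rdot u x2 = rdot v x3 ->
  - rdot u y1 + rdot u y2 - rdot v y3 = - rdot u z1 + rdot u z2 - rdot v z3.
Proof. by move=> -> -> ->; rewrite !rdotDr !rdotZr; lra. Qed.

Section BoundaryPairing.
Variables (R : realType) (H : preHilbertType R) (I : interval R) (s a : R).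
Hypothesis H_separable : separable H.
Hypothesis s1 : s = 1 \/ s = -1.
Hypothesis I_half : [set` I] = half_line s a.
Local Notation mu := (@lebesgue_measure R).
Implicit Types (phi psi : R -> R) (f g : H) (A : operator H).

Lemma exists_inv_lt (e : R) : 0 < e -> exists2 n : nat, (0 < n)%N & n%:R^-1 < e.
Proof.
move=> e0; exists (Num.truncn e^-1).+1 => //.
by rewrite invf_plt ?posrE ?ltr0n// truncnS_gt.
Qed.

Lemma normr_dist_half_line t : 0 < s * (t - a) -> `|t - a| = s * (t - a).
Proof.
case: s1 => ->; first by rewrite mul1r => h; rewrite gtr0_norm.
by rewrite mulN1r => h; rewrite -normrN gtr0_norm.
Qed.

(** Integration by parts up to the end point, against [cutoff 1 f].  The boundary
    term pairs the boundary value with [f]; it vanishes by orthogonality.  The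
    identity holds for [(cutoff 1 - cutoff n) f], which vanishes near [a], and the
    contribution of [cutoff n f] tends to [0]. *)
Lemma boundary_pairing A f g u v x : linear_operator A -> A (f, g) ->
  maximal_operator A I (u, v) -> boundary_value A u a x -> rdot x f = 0 ->
  - rdot u (tensor I (cutoff s a 1)^`()%classic f) + rdot u (tensor I (cutoff s a 1) g) =
  rdot v (tensor I (cutoff s a 1) f).
Proof.
move=> Alin Afg muv ux xf; have bc n := @bounded_support_cutoff R I s a s1 I_half n.
have bc' n := @bounded_support_cutoff' R I s a s1 I_half n.
pose E n := - rdot u (tensor I (cutoff s a n)^`()%classic f)
  + rdot u (tensor I (cutoff s a n) g) - rdot v (tensor I (cutoff s a n) f).
have sm n : smooth (cutoff s a n) by exact: smooth_cutoff.
have E1 n : (0 < n)%N -> E 1%N = E n.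
  move=> n0; have bN := bounded_supportZ (-1) (bc n n0).
  have bN' := bounded_supportZ (-1) (bc' n n0).
  have b1 := bc 1%N isT; have b1' := bc' 1%N isT.
  have tB (h : H) : tensor I (fun t => cutoff s a 1 t - cutoff s a n t) h =
      tensor I (cutoff s a 1) h + (-1)%:C *: tensor I (cutoff s a n) h.
    rewrite -(tensorZ H_separable (-1) h (bc n n0)) -(tensorD H_separable h b1 bN).
    by congr L2_of; apply/funext => t; rewrite mulN1r.
  have tB' (h : H) : tensor I (fun t => cutoff s a 1 t - cutoff s a n t)^`()%classic h =
      tensor I (cutoff s a 1)^`()%classic h + (-1)%:C *: tensor I (cutoff s a n)^`()%classic h.
    rewrite -(tensorZ H_separable (-1) h (bc' n n0)) -(tensorD H_separable h b1' bN').
    rewrite (deriv_funE (deriv_funB (smooth_deriv_fun (sm 1%N)) (smooth_deriv_fun (sm n)))).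
    by congr L2_of; apply/funext => t; rewrite mulN1r.
  have m := maximal_tensor H_separable muv (smooth_in_cutoffB s1 I_half n0) Afg.
  exact: subtract_tests (tB' f) (tB g) (tB f) m.
suff : E 1%N = 0 by rewrite /E => /eqP; rewrite subr_eq0 => /eqP.
have [C C0 CP] := bump_bounded R.
pose K := 1 + hnorm f + hnorm g.
have K0 : 0 < K by rewrite /K -addrA ltr_pwDl// addr_ge0 ?hnorm_ge0.
have small (eta : R) : 0 < eta -> `|E 1%N| <= (2 * C * K + hnorm u + hnorm v) * eta.
  move=> eta0; have [d d0 dux] := ux eta eta0.
  (* The first bound puts the support of [cutoff n] where [u] is [eta]-close to [x],
     the second makes [cutoff n f] and [cutoff n g] of norm at most [eta]. *)
  pose q := Num.min (d / 4) (eta ^+ 2 / (2 * K ^+ 2)).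
  have q0 : 0 < q by rewrite lt_min !divr_gt0 ?mulr_gt0 ?exprn_gt0.
  have [n n0 nq] := exists_inv_lt q0.
  have n0' : 0 < n%:R :> R by rewrite ltr0n.
  rewrite (E1 _ n0).
  have nd : 2 / n%:R < d.
    have : n%:R^-1 < d / 4 by apply: lt_le_trans nq _; rewrite ge_min lexx.
    lra.
  have neta : K ^+ 2 * (2 / n%:R) <= eta ^+ 2.
    have : n%:R^-1 <= eta ^+ 2 / (2 * K ^+ 2).
      by apply/ltW/(lt_le_trans nq); rewrite ge_min lexx orbT.
    by rewrite ler_pdivlMr ?mulr_gt0 ?exprn_gt0//; lra.
  have [b [e [be eb hc he hc']]] := cutoff_bounded s1 I_half n0.
  have be0 : 0 <= 2 / n%:R :> R by rewrite divr_ge0.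
  have tens (h : H) : hnorm h <= K -> hnorm (tensor I (cutoff s a n) h) <= eta.
    move=> hK; rewrite -(@ler_pXn2r _ 2) ?nnegrE ?hnorm_ge0 ?(ltW eta0)//.
    have := @tensor_hnorm R H I H_separable _ h _ _ _ (bc n n0).1 ler01 hc.
    rewrite mul1r eb (ger0_norm be0) => h1; apply: le_trans h1 _; apply: le_trans neta.
    by rewrite ler_wpM2r// ler_sqr ?nnegrE ?hnorm_ge0 ?(ltW K0).
  have fK : hnorm f <= K by have := hnorm_ge0 g; rewrite /K; lra.
  have gK : hnorm g <= K by have := hnorm_ge0 f; rewrite /K; lra.
  have h1 : `|rdot u (tensor I (cutoff s a n) g)| <= hnorm u * eta.
    by apply: le_trans (rdot_CS _ _) _; rewrite ler_wpM2l ?hnorm_ge0// tens.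
  have h2 : `|rdot v (tensor I (cutoff s a n) f)| <= hnorm v * eta.
    by apply: le_trans (rdot_CS _ _) _; rewrite ler_wpM2l ?hnorm_ge0// tens.
  have h3 : `|rdot u (tensor I (cutoff s a n)^`()%classic f)| <= 2 * C * K * eta.
    rewrite (rdot_tensor H_separable _ _ (bc' n n0)).
    have B0 : 0 <= n%:R * C * (eta * K).
      by rewrite !mulr_ge0 ?(ltW C0) ?(ltW eta0) ?(ltW K0).
    have mh : measurable_fun [set` I] (fun t => (cutoff s a n)^`()%classic t * rdot (L2_repr u t) f).
      by apply: measurable_funM; [exact: (bc' n n0).1|exact: measurable_coordinate].
    have := @Rintegral_bounded_support R _ _ _ b e (measurable_itv I) mh _ B0.
    rewrite eb (ger0_norm be0) => h; apply: le_trans (h _) _; last first.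
      rewrite le_eqVlt; apply/orP; left; apply/eqP; field; rewrite gt_eqF//.
    apply: ae_imp dux => t ht It; rewrite normrM.
    have := hc' C (ltW C0) CP t It; rewrite indicE.
    have t0 : 0 < s * (t - a) by move: It; rewrite I_half.
    have [tbe|tbe] := boolP (b <= t <= e); last first.
      rewrite memNset /= ?in_itv ?(negbTE tbe)// !mulr0 normr_le0 => /eqP ->.
      by rewrite normr0 mul0r.
    rewrite mem_set /= ?in_itv// !mulr1 => h'.
    apply: ler_pM => //; move: tbe; rewrite he => /andP[_ tn].
    have td : `|t - a| < d by rewrite normr_dist_half_line//; exact: le_lt_trans tn nd.
    have := negative_norm_rdot (L2_repr u t - x) Alin Afg.
    rewrite rdotBl xf subr0 => h4; apply: le_trans h4 _.
    by rewrite -/K ler_wpM2r ?(ltW K0)// ltW// ht.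
  move: h1 h2 h3; rewrite /E !mulrDl.
  move: (rdot u _) (rdot u _) (rdot v _) => x1 x2 x3 h1 h2 h3.
  have := ler_normB (- x1 + x2) x3; have := ler_normD (- x1) x2; rewrite normrN.
  lra.
apply/eqP/negP => /negP; rewrite -normr_gt0 => Ep.
pose L := 2 * C * K + hnorm u + hnorm v.
have L0 : 0 < L.
  have h1 := hnorm_ge0 u; have h2 := hnorm_ge0 v.
  have h3 : 0 < 2 * C * K by rewrite !mulr_gt0.
  by rewrite /L; lra.
have := small (`|E 1%N| / (2 * L)); rewrite divr_gt0 ?mulr_gt0// => /(_ isT).
rewrite -/L; have -> : L * (`|E 1%N| / (2 * L)) = `|E 1%N| / 2 by field; rewrite gt_eqF.
lra.
Qed.

Lemma ae_exists (P : R -> Prop) (c d : R) : c < d -> {ae mu, forall t, P t} ->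
  exists2 t, c < t < d & P t.
Proof.
move=> cd [N [mN N0 PN]]; apply: contrapT => h.
have sub : `]c, d[%classic `<=` N.
  move=> t; rewrite /= in_itv /= => tcd.
  by apply: PN => /= Pt; apply: h; exists t.
have : (mu `]c, d[%classic <= mu N)%E by apply: le_measure => //; rewrite inE.
rewrite N0 lebesgue_measure_itv /= lte_fin cd -EFinB lee_fin.
by rewrite subr_le0 leNgt cd.
Qed.

(** [cutoff 1 f] is equal to [f] near [a], so [f - x] has negative norm [0] and is
    orthogonal to the dense set [D(A)]. *)
Lemma boundary_value_cutoff A f x : linear_operator A -> hdense (dom A) ->
  boundary_value A (tensor I (cutoff s a 1) f) a x -> x = f.
Proof.
move=> Alin Ad fx.
have orth (h : H) : dom A h -> rdot (f - x) h = 0.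
  move=> [g Ahg]; pose K := 1 + hnorm h + hnorm g.
  have K0 : 0 < K by rewrite /K -addrA ltr_pwDl// addr_ge0 ?hnorm_ge0.
  apply/eqP/negP => /negP; rewrite -normr_gt0 => p0.
  have e0 : 0 < `|rdot (f - x) h| / K by rewrite divr_gt0.
  have [d d0 hd] := fx _ e0.
  have bc := @bounded_support_cutoff R I s a s1 I_half 1%N isT.
  have ae2 := ae_imp2 (fun t e1 e2 => conj e1 e2) hd (tensorE H_separable f bc).
  pose m := Num.min d 1.
  have m0 : 0 < m by rewrite lt_min d0 ltr01.
  have [t tm [h1 h2]] : exists2 t, 0 < s * (t - a) < m & 
     ([set` I] t -> `|t - a| < d ->
        negative_norm A (L2_repr (tensor I (cutoff s a 1) f) t - x) < `|rdot (f - x) h| / K) /\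
     ([set` I] t -> L2_repr (tensor I (cutoff s a 1) f) t = (cutoff s a 1 t)%:C *: f).
    case: s1 => e.
      have am : a < a + m by rewrite ltrDl.
      have [t /andP[t1 t2] ht] := ae_exists am ae2; exists t => //.
      by rewrite e mul1r; apply/andP; split; lra.
    have am : a - m < a by rewrite gtrBl.
    have [t /andP[t1 t2] ht] := ae_exists am ae2; exists t => //.
    by rewrite e mulN1r; apply/andP; split; lra.
  have /andP[t0 tm'] := tm.
  have It : [set` I] t by rewrite I_half.
  have td : `|t - a| < d.
    by rewrite normr_dist_half_line//; apply: lt_le_trans tm' _; rewrite ge_min lexx.
  have c1 : cutoff s a 1 t = 1.
    rewrite /cutoff mul1r step0 ?subr0//; rewrite subr_le0; apply/ltW.
    by apply: lt_le_trans tm' _; rewrite ge_min lexx orbT.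
  have := h1 It td; rewrite h2// c1 scale1r ltr_pdivlMr// ltNge.
  by rewrite negative_norm_rdot.
apply/esym/eqP; rewrite -subr_eq0; apply/eqP.
apply: (hdense_orthogonal0 Ad) => h dh; apply: dotp_eq0; first exact: orth.
apply: orth; have [g Ahg] := dh; exists ('i *: g).
have [A0 AP _] := Alin; have := AP 'i _ _ Ahg A0; by rewrite addr0.
Qed.

(** On a half-line the boundary condition [u(a) \in ker B] cannot define a normal
    operator unless [A = 0].  The last hypothesis says that the elements of the
    domain of the adjoint satisfy the boundary condition.  For [f \in D(A)]
    orthogonal to [ker B], the function [cutoff 1 f] is in that domain since
    its boundary term vanishes, so [f] is in [ker B] and [f = 0].  Hence [D(A)] is
    contained in [ker B], where [A] vanishes. *)
Lemma half_line_normal_eq0 A B : complete_space H ->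
  selfadjoint A -> selfadjoint B -> (forall f, ker B f -> A (f, 0)) ->
  (forall u w,
     (forall v v' x, maximal_operator A I (v, v') -> boundary_value A v a x -> ker B x ->
        rdot v' u = rdot v w) ->
     exists2 x, boundary_value A u a x & ker B x) ->
  forall f, A (f, 0).
Proof.
move=> H_complete [Alin Ad Aadj] [Blin Bd Badj] BA dom_adj.
have [A0 AP Afun] := Alin; have [B0 BP Bfun] := Blin.
have kerB : subspace (ker B).
  split=> // z u v Bu Bv; have := BP z _ _ Bu Bv.
  by rewrite /ker /= (_ : z *: (u, 0) + (v, 0) = (z *: u + v, z *: 0 + 0))// scaler0 addr0.
have Aeq0 f g : A (f, g) -> g = 0.
  move=> Afg; have [p pB pf] := orthogonal_decomposition f H_complete kerB.
  have Bp : ker B p.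
    rewrite /ker /= -Badj => -[q q'] Bq /=; rewrite linear0r.
    apply: (dotp_closure0 kerB pB) => w Bw.
    by have /seteqP[_ /(_ _ Bw)/(_ _ Bq)] := Badj; rewrite /= linear0r.
  have Afp : A (f - p, g).
    have := AP (-1) _ _ (BA _ Bp) Afg.
    rewrite (_ : -1 *: (p, 0) + (f, g) = (-1 *: p + f, -1 *: 0 + g))//.
    by rewrite scaler0 add0r scaleN1r addrC.
  set c := cutoff s a 1.
  have [|x ux Bx] := dom_adj (tensor I c (f - p))
    (- tensor I c^`()%classic (f - p) + tensor I c g).
    move=> v v' x mv vx Bx; rewrite rdotDr rdotNr; apply/esym.
    by apply: (boundary_pairing Alin Afp mv vx); rewrite rdotC /rdot pf.
  have xf : f - p = 0.
    have e := boundary_value_cutoff Alin Ad ux; rewrite e in Bx.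
    by apply: rdot_eq0; rewrite /rdot pf.
  by apply: (Afun (f - p)) => //; rewrite xf; exact: A0.
by move=> f; rewrite -Aadj => -[q q'] Aq /=; rewrite (Aeq0 _ _ Aq) linear0l linear0r.
Qed.

End BoundaryPairing.

(** * Normal and closed operators *)

Section NormalOperators.
Variables (R : realType) (V : preHilbertType R).
Implicit Types (T : operator V) (l : R[i]).

Lemma adjoint_rdot T p : linear_operator T ->
  (forall q, T q -> rdot q.2 p.1 = rdot q.1 p.2) -> adjoint T p.
Proof.
move=> [T0 TP _] h q Tq; apply/eqP; rewrite eq_complex; apply/andP; split.
  exact/eqP/h.
rewrite !Im_dotp; apply/eqP; rewrite -[LHS]opprK -[RHS]opprK -!rdot_iN; congr (- _).
by apply: (h ('i *: q)); have := TP 'i _ _ Tq T0; rewrite addr0.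
Qed.

Lemma dotpZr l (u v : V) : dotp u (l *: v) = conjc l * dotp u v.
Proof. by rewrite dotpC dotpZl rmorphM /= -dotpC. Qed.

(** If [x] is orthogonal to the range of [T - l] then [T^* x = conj(l) x], and
    normality gives [T x = l x]. *)
Lemma normal_dense_range T l : complete_space V -> normal T ->
  ~ point_spectrum T l -> hdense (range_shift T l).
Proof.
move=> Vc [Tlin _ _ Tdom Tn] Tl; have [T0 TP Tfun] := Tlin.
apply: hdense_orthogonal => //.
  split; first by exists 0 => //; rewrite scaler0 subr0.
  move=> z _ _ [p Tp ->] [q Tq ->]; exists (z *: p + q); first exact: TP.
  rewrite /= scalerBr scalerDr opprD [LHS]addrACA; congr (_ + (_ + _)).
  by rewrite !scalerA mulrC.
move=> x xT; have adj : adjoint T (x, conjc l *: x).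
  move=> q Tq /=; have := xT _ (ex_intro2 _ _ q Tq erefl).
  move=> /(congr1 conjc); rewrite -dotpC linear0 dotpDl -scaleNr dotpZl mulNr.
  by move=> /eqP; rewrite subr_eq0 => /eqP ->; rewrite dotpZr conjcK.
have [F TF] : dom T x by rewrite Tdom; exists (conjc l *: x).
apply: contrapT => x0; apply: Tl; exists x; first exact/eqP.
suff <- : F = l *: x by [].
apply/eqP; rewrite -subr_eq0; apply/eqP; apply: rdot_eq0.
have := Tn _ _ _ TF adj => /(congr1 (fun r => r ^+ 2)); rewrite !hnorm_sq => nF.
have := adj _ TF => /= aF.
rewrite rdotBl !rdotBr nF.
have -> : rdot (l *: x) F = rdot F (l *: x) by exact: rdotC.
rewrite /rdot !(dotpZr, dotpZl) aF !(dotpZr, dotpZl) conjcK.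
by rewrite dotpp; case: (l) => p q /=; ring.
Qed.

(** Approximate solutions of [(T - l) x = g] form a Cauchy sequence by the estimate,
    and their limit is a solution because [T] is closed. *)
Lemma closed_surjective T l (M : R) : complete_space V -> linear_operator T ->
  closed_operator T -> (forall p, T p -> hnorm p.1 <= M * hnorm (p.2 - l *: p.1)) ->
  hdense (range_shift T l) -> range_shift T l = setT.
Proof.
move=> Vc Tlin Tcl TM Td; apply/seteqP; split=> // g _; have [T0 TP Tfun] := Tlin.
have /choice[p pP] : forall n : nat, exists p, T p /\
    hnorm (g - (p.2 - l *: p.1)) < n.+1%:R^-1.
  move=> n; have [|_ [p Tp ->] h] := Td g n.+1%:R^-1; first by rewrite invr_gt0.
  by exists p.
have Mp : 0 < `|M| + 1 by rewrite ltr_wpDl.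
have small (e : R) : 0 < e -> exists N, forall n, (N <= n)%N ->
    hnorm (g - ((p n).2 - l *: (p n).1)) < e.
  move=> e0; have /cvgrPdist_lt/(_ e e0)[N _ NP] := @cvg_harmonic R.
  exists N => n Nn; apply: lt_trans (pP n).2 _; have := NP n Nn.
  by rewrite /= sub0r normrN ger0_norm// invr_ge0.
have [x px] : exists x, hnorm ((p n).1 - x) @[n --> \oo] --> (0 : R).
  apply: Vc => e e0.
  have [|N NP] := small (e / (2 * (`|M| + 1))); first by rewrite divr_gt0 ?mulr_gt0.
  exists N => m n Nm Nn.
  have Tmn : T (p m - p n).
    by have := TP (-1) _ _ (pP n).1 (pP m).1; rewrite scaleN1r addrC.
  have := TM _ Tmn; rewrite /= => h.
  set z := (p m).2 - (p n).2 - l *: ((p m).1 - (p n).1) in h.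
  have zE : z = (g - ((p n).2 - l *: (p n).1)) - (g - ((p m).2 - l *: (p m).1)).
    rewrite /z scalerBr (opprB g) [RHS]addrC addrA subrK !opprB.
    by rewrite addrACA [RHS]addrACA; congr (_ + _); exact: addrC.
  have hz : hnorm z < e / (`|M| + 1).
    rewrite zE; apply: le_lt_trans (hnormD _ _) _; rewrite hnormN.
    have -> : e / (`|M| + 1) = e / (2 * (`|M| + 1)) + e / (2 * (`|M| + 1)).
      by field; rewrite gt_eqF.
    by rewrite ltrD// NP.
  apply: le_lt_trans h _; move: hz; rewrite ltr_pdivlMr// mulrC; apply: le_lt_trans.
  by rewrite ler_wpM2r ?hnorm_ge0//; have := ler_norm M; lra.
exists (x, g + l *: x); last by rewrite /= addrK.
apply: Tcl => e e0.
pose c := Num.sqrt (complex.Re (l * conjc l)).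
have c0 : 0 <= c by exact: sqrtr_ge0.
have q0 : 0 < e / (4 * (c + 1)) by rewrite divr_gt0 ?mulr_gt0// ltr_wpDl.
have [N1 _ N1P] := (@cvgrPdist_lt _ _ _ _ _ _ _).1 px _ q0.
have [N2 N2P] := small _ q0.
pose n := maxn N1 N2.
have d1 : hnorm ((p n).1 - x) < e / (4 * (c + 1)).
  by have := N1P n (leq_maxl _ _); rewrite /= sub0r normrN ger0_norm ?hnorm_ge0.
have d2 := N2P n (leq_maxr _ _).
exists (p n); first exact: (pP n).1.
pose y := g + l *: x - (p n).2.
have hy : hnorm y <= e / (4 * (c + 1)) + c * (e / (4 * (c + 1))).
  have -> : y = (g - ((p n).2 - l *: (p n).1)) + l *: (x - (p n).1).
    by rewrite /y scalerBr opprB [RHS]addrACA [l *: _ - _ - _]addrAC subrr add0r.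
  apply: le_trans (hnormD _ _) _; apply: lerD; first exact: ltW.
  by rewrite hnormZ ler_wpM2l// hnormB ltW.
have : hnorm ((x, g + l *: x) - p n) ^+ 2 = hnorm (x - (p n).1) ^+ 2 + hnorm y ^+ 2.
  by rewrite !hnorm_sq /rdot /dotp /= /pair_dot /=; case: (dotp (x - _) _) => ? ?; case: (dotp y _).
have hx : hnorm (x - (p n).1) <= e / (4 * (c + 1)) by rewrite hnormB ltW.
have e4 : e / (4 * (c + 1)) * (1 + c) = e / 4 by field; rewrite gt_eqF// ltr_wpDl.
have {}hy : hnorm y <= e / 4 by rewrite -e4 mulrC mulrDl mul1r.
have {}hx : hnorm (x - (p n).1) <= e / 4.
  by apply: le_trans hx _; rewrite -e4 ler_peMr ?(ltW q0)// lerDl.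
move=> sq; rewrite -(@ltr_pXn2r _ 2) ?nnegrE ?hnorm_ge0 ?(ltW e0)// sq.
have := hnorm_ge0 y; have := hnorm_ge0 (x - (p n).1); nra.
Qed.

End NormalOperators.

(** * The components of [L] on a half-line *)

Section Components.
Variables (R : realType) (H : preHilbertType R) (I : interval R).
Hypothesis H_separable : separable H.
Local Notation mu := (@lebesgue_measure R).
Implicit Types (phi psi : R -> R) (f g : H) (A : operator H).

Lemma minimal0 A : minimal_operator A I (0, 0).
Proof.
move=> e e0; exists (0, 0); last by rewrite subrr hnorm0.
exists 0%N, (fun=> cst 0), (fun=> 0), (fun=> 0); split=> [[]//|[]//||] /=.
  by apply: ae_imp (L2_repr0 H I) => t h It; rewrite h// big_ord0.
by apply: ae_imp (L2_repr0 H I) => t h It; rewrite h// big_ord0.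
Qed.

Lemma maximal_tensor0 A phi f u v : (forall f, A (f, 0)) ->
  maximal_operator A I (u, v) -> smooth_in I phi ->
  rdot v (tensor I phi f) = - rdot u (tensor I phi^`()%classic f).
Proof.
move=> A0 muv sphi; have <- := maximal_tensor H_separable muv sphi (A0 f).
rewrite (tensor0 H_separable (smooth_in_bounded sphi)).
by rewrite [X in _ + X](_ : rdot u 0 = 0) ?addr0// /rdot linear0r.
Qed.

(** With [A = 0] the maximal operator is [d/dt], and testing against the minimal
    operator says that [w] is the derivative of [- u]. *)
Lemma adjoint_component A u v w : open [set` I] -> (forall f, A (f, 0)) ->
  maximal_operator A I (u, v) ->
  (forall phi f, smooth_in I phi ->
     rdot (tensor I phi^`()%classic f) u = rdot (tensor I phi f) w) ->
  w = - v.
Proof.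
move=> oI A0 muv adj; apply/eqP; rewrite -addr_eq0; apply/eqP.
apply: (L2_eq0_test H_separable oI) => phi f sphi.
rewrite rdotDl (maximal_tensor0 _ A0 muv sphi) [rdot w _]rdotC -(adj _ _ sphi).
by rewrite [rdot (tensor _ _ _) u]rdotC subrr.
Qed.

(** With [A = 0] the eigenvalue equation is the weak equation [u' = i omega u]. *)
Lemma eigen_component (s a : R) A u (l : R[i]) : s ^+ 2 = 1 ->
  [set` I] = half_line s a -> (forall f, A (f, 0)) -> complex.Re l = 0 ->
  maximal_operator A I (u, l *: u) -> u = 0.
Proof.
move=> s1 I_half A0; case: l => x omega /= x0; rewrite x0 => mu_.
apply: (L2_eq0_oscillating H_separable s1 I_half (omega := omega)) => phi f sphi.
have := maximal_tensor0 f A0 mu_ sphi; rewrite imag_scale rdotZl rdot_iN.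
rewrite (tensor_i H_separable f (smooth_in_bounded sphi)) mulrN.
by move=> /eqP; rewrite eqr_opp => /eqP ->.
Qed.

Lemma wave_minimal A (T : operator (L2 H I)) omega f phi :
  linear_operator T -> (forall f, A (f, 0)) -> minimal_operator A I `<=` T ->
  smooth_in I phi ->
  T (wave I omega f phi,
     wave I omega f phi^`()%classic + (0 +i* omega) *: wave I omega f phi).
Proof.
move=> [T0 TP _] A0 AT sphi; rewrite -(wave_deriv H_separable omega f sphi).
have [sC sS] := @smooth_trigo R omega.
have s1 := smooth_inM sC sphi; have s2 := smooth_inM sS sphi.
have := TP 1 _ _ (AT _ (minimal_tensor H_separable s1 (A0 f)))
  (AT _ (minimal_tensor H_separable s2 (A0 ('i *: f)))).
rewrite scale1r (tensor0 H_separable (smooth_in_bounded s1)).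
by rewrite (tensor0 H_separable (smooth_in_bounded s2)) !addr0.
Qed.

End Components.

(** * Spectrum of the normal extension *)

Lemma left_half_line (R : realType) (a : R) : [set` `]-oo, a[] = half_line (-1) a.
Proof.
by apply/seteqP; split=> t; rewrite /half_line /= in_itv /= mulN1r oppr_gt0 subr_lt0.
Qed.

Lemma right_half_line (R : realType) (a : R) : [set` `]a, +oo[] = half_line 1 a.
Proof.
by apply/seteqP; split=> t; rewrite /half_line /= in_itv /= andbT mul1r subr_gt0.
Qed.

Lemma rdot_pair (R : realType) (V W : preHilbertType R) (p q : V * W) :
  rdot p q = rdot p.1 q.1 + rdot p.2 q.2.
Proof. by rewrite /rdot /dotp /= /pair_dot; case: (dotp p.1 _); case: (dotp p.2 _). Qed.

Lemma rdot0r (R : realType) (V : preHilbertType R) (u : V) : rdot u 0 = 0.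
Proof. by rewrite /rdot linear0r. Qed.

Lemma rdot_scale_self (R : realType) (V : preHilbertType R) (l : R[i]) (u : V) :
  rdot (l *: u) u = complex.Re l * hnorm u ^+ 2.
Proof. by rewrite hnorm_sq /rdot dotpZl dotpp; case: l => x y /=; rewrite mulr0 subr0. Qed.

Section Triples.
Variables (R : realType) (V1 V2 V3 : preHilbertType R).
Implicit Type u : (V1 * V2 * V3)%type.

Lemma rdot_triple u (v : V1 * V2 * V3) :
  rdot u v = rdot u.1.1 v.1.1 + rdot u.1.2 v.1.2 + rdot u.2 v.2.
Proof. by rewrite !rdot_pair. Qed.

Lemma rdot_triple1 u v1 : rdot u (v1, 0, 0) = rdot u.1.1 v1.
Proof. by rewrite rdot_triple /= !rdot0r !addr0. Qed.

Lemma rdot_triple3 u v3 : rdot u (0, 0, v3) = rdot u.2 v3.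
Proof. by rewrite rdot_triple /= !rdot0r !add0r. Qed.

Lemma rdot_triple13 u v1 v3 : rdot u (v1, 0, v3) = rdot u.1.1 v1 + rdot u.2 v3.
Proof. by rewrite rdot_triple /= rdot0r addr0. Qed.

Lemma hnorm_triple u :
  hnorm u ^+ 2 = hnorm u.1.1 ^+ 2 + hnorm u.1.2 ^+ 2 + hnorm u.2 ^+ 2.
Proof. by rewrite !hnorm_sq rdot_triple. Qed.

Lemma hnorm_triple2_le u : hnorm u.1.2 <= hnorm u.
Proof.
rewrite -(@ler_pXn2r _ 2) ?nnegrE ?hnorm_ge0// hnorm_triple.
have := sqr_ge0 (hnorm u.1.1); have := sqr_ge0 (hnorm u.2); lra.
Qed.

Lemma hnorm_triple2 (u2 : V2) : hnorm ((0, u2, 0) : V1 * V2 * V3) = hnorm u2.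
Proof.
apply/eqP; rewrite -(@eqrXn2 _ 2) ?hnorm_ge0// hnorm_triple /= !hnorm0 expr0n /=.
by rewrite add0r addr0.
Qed.

Lemma hnorm_triple3 (u3 : V3) : hnorm ((0, 0, u3) : V1 * V2 * V3) = hnorm u3.
Proof.
apply/eqP; rewrite -(@eqrXn2 _ 2) ?hnorm_ge0// hnorm_triple /= !hnorm0 expr0n /=.
by rewrite !add0r.
Qed.

Lemma scale_triple2 (l : R[i]) (u2 : V2) :
  l *: ((0, u2, 0) : V1 * V2 * V3) = (0, l *: u2, 0).
Proof. by rewrite [LHS](_ : _ = (l *: 0, l *: u2, l *: 0))// !scaler0. Qed.

Lemma scale_triple3 (l : R[i]) (u3 : V3) :
  l *: ((0, 0, u3) : V1 * V2 * V3) = (0, 0, l *: u3).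
Proof. by rewrite [LHS](_ : _ = (l *: 0, l *: 0, l *: u3))// !scaler0. Qed.

Lemma add_triple3 (u3 v3 : V3) :
  (0, 0, u3) + (0, 0, v3) = (0, 0, u3 + v3) :> V1 * V2 * V3.
Proof. by rewrite [LHS](_ : _ = (0 + 0, 0 + 0, u3 + v3))// !addr0. Qed.

Lemma skew_scale_eq0 (l : R[i]) (u1 : V1) (u3 : V3) : complex.Re l != 0 ->
  rdot (l *: u1) u1 + rdot (l *: u3) u3 = 0 -> u1 = 0 /\ u3 = 0.
Proof.
move=> l0; rewrite !rdot_scale_self -mulrDr => /eqP; rewrite mulf_eq0 (negbTE l0) /=.
rewrite paddr_eq0 ?sqr_ge0// !sqrf_eq0 => /andP[/eqP h1 /eqP h3].
by split; exact: hnorm_eq0.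
Qed.

Lemma estimate_triple2 (M : R) (l : R[i]) (u2 f2 : V2) :
  hnorm ((0, u2, 0) : V1 * V2 * V3) <=
    M * hnorm ((0, f2, 0) - l *: ((0, u2, 0) : V1 * V2 * V3)) ->
  hnorm u2 <= M * hnorm (f2 - l *: u2).
Proof.
rewrite scale_triple2 [_ - _](_ : _ = (0 - 0, f2 - l *: u2, 0 - 0))//.
by rewrite !subr0 !hnorm_triple2.
Qed.

Lemma estimate_triple3 (M : R) (l : R[i]) (u3 f3 : V3) :
  hnorm ((0, 0, u3) : V1 * V2 * V3) <=
    M * hnorm ((0, 0, f3 + l *: u3) - l *: ((0, 0, u3) : V1 * V2 * V3)) ->
  hnorm u3 <= M * hnorm f3.
Proof.
rewrite scale_triple3 [_ - _](_ : _ = (0 - 0, 0 - 0, f3 + l *: u3 - l *: u3))//.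
by rewrite !subr0 addrK !hnorm_triple3.
Qed.

Lemma skew_sum (u1 v1 w1 : V1) (u3 v3 w3 : V3) : w1 = - v1 -> w3 = - v3 ->
  rdot v1 u1 + rdot v3 u3 = rdot w1 u1 + rdot w3 u3 -> rdot v1 u1 + rdot v3 u3 = 0.
Proof. by move=> -> ->; rewrite !rdotNl; lra. Qed.

(** Skew-symmetry gives [Re <v - l u, u> = - Re l |u|^2]; the Cauchy-Schwarz
    inequality turns this into a lower bound for [|v - l u|]. *)
Lemma skew_estimate (l : R[i]) (u1 v1 : V1) (u3 v3 : V3) :
  rdot v1 u1 + rdot v3 u3 = 0 ->
  complex.Re l ^+ 2 * (hnorm u1 ^+ 2 + hnorm u3 ^+ 2) <=
  hnorm (v1 - l *: u1) ^+ 2 + hnorm (v3 - l *: u3) ^+ 2.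
Proof.
move=> sk; set c := complex.Re l.
have e : rdot (v1 - l *: u1) u1 + rdot (v3 - l *: u3) u3 =
   - c * (hnorm u1 ^+ 2 + hnorm u3 ^+ 2).
  rewrite !rdotBl !rdot_scale_self -/c.
  by move: sk; move: (rdot v1 u1) (rdot v3 u3) => *; lra.
have h1 := rdot_CS (v1 - l *: u1) u1; have h3 := rdot_CS (v3 - l *: u3) u3.
have n1 := hnorm_ge0 u1; have n3 := hnorm_ge0 u3.
have n2 := hnorm_ge0 (v1 - l *: u1); have n4 := hnorm_ge0 (v3 - l *: u3).
move: e h1 h3 n1 n3 n2 n4.
move: (rdot (v1 - _) _) (rdot (v3 - _) _) => r1 r3.
move: (hnorm u1) (hnorm u3) (hnorm (v1 - _)) (hnorm (v3 - _)) => x1 x3 y1 y3.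
move=> e h1 h3 x10 x30 y10 y30.
have main : `|c| * (x1 ^+ 2 + x3 ^+ 2) <= y1 * x1 + y3 * x3.
  have -> : `|c| * (x1 ^+ 2 + x3 ^+ 2) = `|r1 + r3|.
    by rewrite e normrM normrN [`|_ + _|]ger0_norm// addr_ge0 ?sqr_ge0.
  exact: le_trans (ler_normD _ _) (lerD h1 h3).
have q1 := sqr_ge0 (y1 - `|c| * x1); have q3 := sqr_ge0 (y3 - `|c| * x3).
have c0 := normr_ge0 c; rewrite -[c ^+ 2]real_normK ?num_real//.
have := ler_wpM2l c0 main; rewrite !expr2 in q1 q3 *; nra.
Qed.

Lemma triple_estimate (M : R) (l : R[i]) (u1 v1 : V1) (u2 v2 : V2) (u3 v3 : V3) :
  complex.Re l != 0 -> rdot v1 u1 + rdot v3 u3 = 0 ->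
  hnorm u2 <= M * hnorm (v2 - l *: u2) ->
  hnorm ((u1, u2, u3) : V1 * V2 * V3) <=
    (`|complex.Re l|^-1 + `|M|) * hnorm ((v1, v2, v3) - l *: ((u1, u2, u3) : V1 * V2 * V3)).
Proof.
move=> l0 sk h2.
have h1 := skew_estimate l sk.
rewrite -(@ler_pXn2r _ 2) ?nnegrE ?mulr_ge0 ?addr_ge0 ?invr_ge0 ?hnorm_ge0//.
rewrite exprMn !hnorm_triple /=.
set c := `|complex.Re l|; have c0 : 0 < c by rewrite normr_gt0.
rewrite -[complex.Re l ^+ 2]real_normK ?num_real// -/c in h1.
have n2 := hnorm_ge0 u2; have m2 := hnorm_ge0 (v2 - l *: u2).
move: h1 h2 n2 m2.
move: (hnorm u1) (hnorm u2) (hnorm u3) (hnorm (v1 - _)) (hnorm (v2 - _)) (hnorm (v3 - _)).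
move=> x1 x2 x3 y1 y2 y3 h1 h2 x20 y20.
have k1 : x1 ^+ 2 + x3 ^+ 2 <= c^-1 ^+ 2 * (y1 ^+ 2 + y3 ^+ 2).
  by rewrite exprVn ler_pdivlMl ?exprn_gt0.
have k2 : x2 ^+ 2 <= `|M| ^+ 2 * y2 ^+ 2.
  rewrite -exprMn ler_sqr ?nnegrE ?mulr_ge0//; apply: le_trans h2 _.
  by rewrite ler_wpM2r// ler_norm.
have ci : 0 <= c^-1 by rewrite invr_ge0 ltW.
have M0 := normr_ge0 M; move: (`|M|) (c^-1) ci M0 k1 k2 => m d d0 m0 k1 k2.
have dm : 0 <= d * m by exact: mulr_ge0.
have s1 := sqr_ge0 y1; have s2 := sqr_ge0 y2; have s3 := sqr_ge0 y3.
have dd := sqr_ge0 d; have mm := sqr_ge0 m.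
have t1 : d ^+ 2 * (y1 ^+ 2 + y3 ^+ 2) <= (d + m) ^+ 2 * (y1 ^+ 2 + y3 ^+ 2).
  by apply: ler_wpM2r; [exact: addr_ge0|rewrite sqrrD mulr2n; lra].
have t2 : m ^+ 2 * y2 ^+ 2 <= (d + m) ^+ 2 * y2 ^+ 2.
  by apply: ler_wpM2r => //; rewrite sqrrD mulr2n; lra.
move: k1 k2 t1 t2; rewrite !mulrDr; lra.
Qed.

End Triples.

Section Spectrum.
Variables (R : realType) (H : preHilbertType R) (a1 a2 b2 a3 : R).
Hypotheses (H_complete : complete_space H) (H_separable : separable H).
Variables (A1 A2 A3 B1 B3 : operator H) (W1 W2 : {linear H -> H}).
Hypotheses (A1_sa : selfadjoint A1) (A3_sa : selfadjoint A3).
Hypotheses (B1_sqrt : is_sqrt B1 (op_opp A1)) (B3_sqrt : is_sqrt B3 A3).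
Local Notation L := (L_W1W2 a1 a2 b2 a3 A1 A2 A3 B1 B3 W1 W2).
Local Notation LW1 := (L_W1 a1 a3 A1 A3 B1 B3 W1).
Local Notation LW2 := (L_W2 a2 b2 A2 W2).
Local Notation H1 := (L2 H `]-oo, a1[).
Local Notation H2 := (L2 H `]a2, b2[).
Local Notation H3 := (L2 H `]a3, +oo[).
Hypothesis L_extends : L0_111 a1 a2 b2 a3 A1 A2 A3 `<=` L.
Hypothesis L_normal : normal L.

Let Llin : linear_operator L. Proof. by case: L_normal. Qed.
Let Lclosed : closed_operator L. Proof. by case: L_normal. Qed.
Let Ldom : dom L = dom (adjoint L). Proof. by case: L_normal. Qed.
Let L00 : L 0. Proof. by case: Llin. Qed.

Let L2_111_complete : complete_space (L2_111 H a1 a2 b2 a3).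
Proof.
have c I : complete_space (L2 H I) by exact: L2_complete.
exact: (complete_pair (complete_pair (c _) (c _)) (c _)).
Qed.

Let oI1 : open [set` `]-oo, a1[]. Proof. by rewrite left_half_line; exact: open_half_line. Qed.
Let oI3 : open [set` `]a3, +oo[]. Proof. by rewrite right_half_line; exact: open_half_line. Qed.

(** Elements with a single nonzero component transfer to that component the equality
    of the domains of [L] and of its adjoint. *)
Lemma A1_eq0 f : A1 (f, 0).
Proof.
have [B1sa _ B1A] := B1_sqrt; have [[B10 _ _] _ _] := B1sa.
apply: (half_line_normal_eq0 H_separable (or_intror erefl) (left_half_line a1) H_complete A1_sa B1sa).
  move=> {}f Bf; have : op_opp A1 (f, 0) by rewrite -B1A; exists 0.
  by rewrite /op_opp /= oppr0.
move=> u w h.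
have : adjoint L ((u, 0, 0), (w, 0, 0)).
  apply: (adjoint_rdot Llin) => -[[[q1 q2] q3] [[f1 f2] f3]] [[m1 _ [x1 [x3 [bv1 _ _ k1 _]]]] _].
  by rewrite (rdot_triple1 (f1, f2, f3)) (rdot_triple1 (q1, q2, q3)); exact: h m1 bv1 k1.
move=> adj; have [[[F1 F2] F3]] : dom L (u, 0, 0) by rewrite Ldom; exists (w, 0, 0).
by move=> [[_ _ [x1 [x3 [bv1 _ _ k1 _]]]] _]; exists x1.
Qed.

Lemma A3_eq0 f : A3 (f, 0).
Proof.
have [B3sa _ B3A] := B3_sqrt; have [[B30 _ _] _ _] := B3sa.
apply: (half_line_normal_eq0 H_separable (or_introl erefl) (right_half_line a3) H_complete A3_sa B3sa).
  by move=> {}f Bf; rewrite -B3A; exists 0.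
move=> u w h.
have : adjoint L ((0, 0, u), (0, 0, w)).
  apply: (adjoint_rdot Llin) => -[[[q1 q2] q3] [[f1 f2] f3]] [[_ m3 [x1 [x3 [_ bv3 _ _ k3]]]] _].
  by rewrite (rdot_triple3 (f1, f2, f3)) (rdot_triple3 (q1, q2, q3)); exact: h m3 bv3 k3.
move=> adj; have [[[F1 F2] F3]] : dom L (0, 0, u) by rewrite Ldom; exists (0, 0, w).
by move=> [[_ _ [x1 [x3 [_ bv3 _ _ k3]]]] _]; exists x3.
Qed.

Lemma L_outer u1 u2 u3 v1 v2 v3 : L ((u1, u2, u3), (v1, v2, v3)) ->
  L ((u1, 0, u3), (v1, 0, v3)).
Proof. by move=> [h _]; split=> //; exact: L00.2. Qed.

Lemma L_inner u2 v2 : LW2 (u2, v2) -> L ((0, u2, 0), (0, v2, 0)).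
Proof. by move=> h; split=> //; exact: L00.1. Qed.

(** Since [A1 = A3 = 0], the outer part of [L] is a restriction of [d/dt], and its
    adjoint a restriction of [- d/dt]. *)
Lemma L_skew u1 u2 u3 v1 v2 v3 : L ((u1, u2, u3), (v1, v2, v3)) ->
  rdot v1 u1 + rdot v3 u3 = 0.
Proof.
move=> /L_outer Luv; have [[m1 m3 _] _] := Luv.
have [[[w1 w2] w3] adj] : dom (adjoint L) (u1, 0, u3) by rewrite -Ldom; exists (v1, 0, v3).
have e1 : w1 = - v1.
  apply: (adjoint_component H_separable oI1 A1_eq0 m1) => phi f sphi.
  have Lt : L ((tensor _ phi f, 0, 0), (tensor _ phi^`()%classic f + tensor _ phi 0, 0, 0)).
    by apply: L_extends; split; [exact: minimal_tensor (A1_eq0 f)|exact: minimal0|exact: minimal0].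
  have e : rdot (tensor _ phi^`()%classic f + tensor _ phi 0, 0, 0) (u1, 0 : H2, u3) =
      rdot (tensor _ phi f, 0, 0) (w1, w2, w3) by have := adj _ Lt => /(congr1 (@complex.Re R)).
  rewrite rdotC [RHS]rdotC (rdot_triple1 (u1, 0, u3)) (rdot_triple1 (w1, w2, w3)) in e.
  by rewrite (tensor0 H_separable (smooth_in_bounded sphi)) addr0 in e; rewrite rdotC e rdotC.
have e3 : w3 = - v3.
  apply: (adjoint_component H_separable oI3 A3_eq0 m3) => phi f sphi.
  have Lt : L ((0, 0, tensor _ phi f), (0, 0, tensor _ phi^`()%classic f + tensor _ phi 0)).
    by apply: L_extends; split; [exact: minimal0|exact: minimal0|exact: minimal_tensor (A3_eq0 f)].
  have e : rdot (0, 0, tensor _ phi^`()%classic f + tensor _ phi 0) (u1, 0 : H2, u3) =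
      rdot (0, 0, tensor _ phi f) (w1, w2, w3) by have := adj _ Lt => /(congr1 (@complex.Re R)).
  rewrite rdotC [RHS]rdotC (rdot_triple3 (u1, 0, u3)) (rdot_triple3 (w1, w2, w3)) in e.
  by rewrite (tensor0 H_separable (smooth_in_bounded sphi)) addr0 in e; rewrite rdotC e rdotC.
have e : rdot (v1, 0, v3) (u1, 0 : H2, u3) = rdot (u1, 0, u3) (w1, w2, w3).
  by have := adj _ Luv => /(congr1 (@complex.Re R)).
rewrite [RHS]rdotC (rdot_triple13 (v1, 0, v3)) (rdot_triple13 (w1, w2, w3)) in e.
have {}e : rdot v1 u1 + rdot v3 u3 = rdot w1 u1 + rdot w3 u3 by exact: e.
exact: skew_sum e1 e3 e.
Qed.

(** An eigenvector of [L] vanishes on the half-lines: by skew-symmetry if its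
    eigenvalue is off the imaginary axis, by square integrability otherwise. *)
Lemma point_spectrum_L : point_spectrum L = point_spectrum LW2.
Proof.
apply/seteqP; split=> l; last first.
  move=> [u2 u20 Lu2]; exists (0, u2, 0); last first.
    rewrite (_ : l *: _ = (0, l *: u2, 0)); first exact: L_inner.
    exact: scale_triple2.
  by apply: contra u20 => /eqP[->].
move=> [[[u1 u2] u3] u0 Lu].
have [[m1 m3 _] Lu2] : LW1 ((u1, u3), (l *: u1, l *: u3)) /\ LW2 (u2, l *: u2) by exact: Lu.
have [e1 e3] : u1 = 0 /\ u3 = 0.
  have [l0|l0] := eqVneq (complex.Re l) 0.
    split.
      apply: (eigen_component H_separable _ (left_half_line a1) A1_eq0 l0 m1).
      by rewrite expr2 mulrNN mulr1.
    apply: (eigen_component H_separable _ (right_half_line a3) A3_eq0 l0 m3).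
    by rewrite expr1n.
  exact: skew_scale_eq0 l0 (L_skew Lu).
exists u2 => //; apply: contra u0 => /eqP e2; by rewrite e1 e2 e3.
Qed.

Lemma dense_range_LW2 l : hdense (range_shift L l) -> hdense (range_shift LW2 l).
Proof.
move=> Ld v e e0; have [_ [[[[u1 u2] u3] [[f1 f2] f3]] [_ Lp] ->] h] := Ld (0, v, 0) e e0.
exists (f2 - l *: u2); first by exists (u2, f2).
exact: le_lt_trans (hnorm_triple2_le _) h.
Qed.

Lemma resolvent_LW2 l : resolvent_set L l -> resolvent_set LW2 l.
Proof.
move=> [Lp Lr [M LM]]; split; first by rewrite -point_spectrum_L.
  rewrite -subTset => g _.
  have [[[[u1 u2] u3] [[f1 f2] f3]] [_ Lq] e] : range_shift L l (0, g, 0) by rewrite Lr.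
  by exists (u2, f2); [exact: Lq|exact: (congr1 (fun p => p.1.2) e)].
exists M => -[u2 f2] Lq; have := LM _ (L_inner Lq).
exact: estimate_triple2.
Qed.

(** Density of the range is assumed because it is part of the definition of the
    continuous spectrum, where the lemma is applied. *)
Lemma resolvent_L l : complex.Re l != 0 -> hdense (range_shift L l) ->
  resolvent_set LW2 l -> resolvent_set L l.
Proof.
move=> l0 Ld [Lp Lr [M LM]].
have est p : L p -> hnorm p.1 <= (`|complex.Re l|^-1 + `|M|) * hnorm (p.2 - l *: p.1).
  case: p => [[[u1 u2] u3] [[v1 v2] v3]] Lq.
  exact: (triple_estimate l0 (L_skew Lq) (LM _ Lq.2)).
split; [by rewrite point_spectrum_L| |by eexists; exact: est].
exact: closed_surjective L2_111_complete Llin Lclosed est Ld.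
Qed.

(** On the imaginary axis the wave packets of constant profile on long intervals of
    [(a3, +oo)] are approximate eigenvectors. *)
Lemma imaginary_not_resolvent l (f : H) : f != 0 -> complex.Re l = 0 -> ~ resolvent_set L l.
Proof.
move=> f0; case: l => x omega /= ->; move=> [_ _ [M LM]].
pose I3 := `]a3, +oo[ : interval R.
have [K K0 KP] := @wave_plateau_deriv_le R H I3 H_separable omega f.
have segI (c : R) e : a3 < c -> `[c, c + e]%classic `<=` [set` I3].
  by move=> ac t; rewrite /= !in_itv /= andbT => /andP[h _]; exact: lt_le_trans h.
pose T : operator H3 := [set p | L ((0, 0, p.1), (0, 0, p.2))].
have Tlin : linear_operator T.
  have [_ LP Lfun] := Llin; split; first exact: L00.
    move=> z p q Tp Tq; have h := LP z _ _ Tp Tq.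
    have e (u v : H3) : z *: ((0, 0, u) : H1 * H2 * H3) + (0, 0, v) = (0, 0, z *: u + v).
      by rewrite scale_triple3 add_triple3.
    exact: (eq_ind _ L h _ (congr2 pair (e p.1 q.1) (e p.2 q.2))).
  by move=> u g h Lg Lh; have [] := Lfun _ _ _ Lg Lh.
have minT : minimal_operator A3 I3 `<=` T.
  by move=> [u v] muv; apply: L_extends; split; [exact: minimal0|exact: minimal0|exact: muv].
have ac : a3 < a3 + 1 by rewrite ltrDl.
have bound (n : nat) : n%:R * hnorm f ^+ 2 <= (`|M| * (K * hnorm f)) ^+ 2.
  (* The plateau equals [1] between [c + 1] and [d], over a length [n]. *)
  pose c := a3 + 1; pose d := c + n%:R + 1.
  have cd : a3 < d by rewrite /d /c -!addrA ltrDl addr_gt0// ltr_wpDl.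
  have sp := smooth_in_plateau ltr01 (segI c 1 ac) (segI d 1 cd).
  have Lw := wave_minimal H_separable omega f Tlin A3_eq0 minT sp.
  have low := @wave_hnorm_ge R H I3 H_separable omega f _ (c + 1) n%:R sp (ler0n _ _) _ _.
  apply: le_trans (low _ _) _.
  - by apply: segI; rewrite /c -addrA ltrDl.
  - move=> t /andP[h1 h2]; rewrite /plateau !divr1 step1 ?step0 ?subr0//.
      by rewrite /d; lra.
    by lra.
  rewrite ler_sqr ?nnegrE ?mulr_ge0 ?hnorm_ge0//.
  apply: le_trans (estimate_triple3 (LM _ Lw)) _.
  apply: (le_trans (ler_wpM2r (hnorm_ge0 _) (ler_norm M))).
  by apply: ler_wpM2l => //; exact: KP (segI c 1 ac) (segI d 1 cd).
have fp : 0 < hnorm f ^+ 2.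
  rewrite exprn_gt0// lt_neqAle hnorm_ge0 andbT eq_sym.
  by apply: contra f0 => /eqP/hnorm_eq0->.
pose n := (Num.truncn ((`|M| * K) ^+ 2)).+1.
have : n%:R <= (`|M| * K) ^+ 2.
  by rewrite -(ler_pM2r fp) -exprMn -mulrA; exact: bound.
by rewrite leNgt truncnS_gt.
Qed.

Lemma imaginary_continuous l (f : H) : f != 0 -> complex.Re l = 0 ->
  ~ point_spectrum LW2 l -> continuous_spectrum L l.
Proof.
move=> f0 l0 Ll; have Lp : ~ point_spectrum L l by rewrite point_spectrum_L.
split=> //; first exact: imaginary_not_resolvent f0 l0.
exact: normal_dense_range L2_111_complete L_normal Lp.
Qed.

Lemma continuous_spectrum_LW2 l : continuous_spectrum LW2 l -> continuous_spectrum L l.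
Proof.
move=> [nr np _]; have Lp : ~ point_spectrum L l by rewrite point_spectrum_L.
split=> //; first by move=> /resolvent_LW2.
exact: normal_dense_range L2_111_complete L_normal Lp.
Qed.

Lemma continuous_spectrum_L l : complex.Re l != 0 -> continuous_spectrum L l ->
  continuous_spectrum LW2 l.
Proof.
move=> l0 [nr np Ld]; split.
- by move=> /(resolvent_L l0 Ld).
- by rewrite -point_spectrum_L.
- exact: dense_range_LW2.
Qed.

End Spectrum.

Theorem theorem3p4 (R : realType) (H : preHilbertType R)
    (H_complete : complete_space H) (H_separable : separable H)
    (a1 a2 b2 a3 : R) (a1_lt_a2 : a1 < a2) (a2_lt_b2 : a2 < b2)
    (b2_lt_a3 : b2 < a3)
    (A1 A2 A3 : operator H)
    (A1_sa : selfadjoint A1) (A1_le0 : nonneg_operator (op_opp A1))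
    (A2_sa : selfadjoint A2) (A2_ge0 : nonneg_operator A2)
    (A3_sa : selfadjoint A3) (A3_ge0 : nonneg_operator A3)
    (B1 B3 : operator H)
    (B1_sqrt : is_sqrt B1 (op_opp A1)) (B3_sqrt : is_sqrt B3 A3)
    (sqrt_spectrum : (point_spectrum B1 `&` point_spectrum B3) 0)
    (W1 W2 : {linear H -> H}) (W1_unitary : unitary W1)
    (W2_unitary : unitary W2)
    (L_extends : L0_111 a1 a2 b2 a3 A1 A2 A3 `<=`
                 L_W1W2 a1 a2 b2 a3 A1 A2 A3 B1 B3 W1 W2)
    (L_normal : normal (L_W1W2 a1 a2 b2 a3 A1 A2 A3 B1 B3 W1 W2)) :
  point_spectrum (L_W1W2 a1 a2 b2 a3 A1 A2 A3 B1 B3 W1 W2) =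
    point_spectrum (L_W2 a2 b2 A2 W2) /\
  continuous_spectrum (L_W1W2 a1 a2 b2 a3 A1 A2 A3 B1 B3 W1 W2) =
    (~` point_spectrum (L_W2 a2 b2 A2 W2) `&` imaginary_axis R) `|`
    continuous_spectrum (L_W2 a2 b2 A2 W2).
Proof.
have sp := point_spectrum_L H_complete H_separable A1_sa A3_sa B1_sqrt B3_sqrt L_extends L_normal.
split; first exact: sp.
have [[f f0 _] _] := sqrt_spectrum.
apply/seteqP; split=> l.
  move=> Ll; have [l0|l0] := eqVneq (complex.Re l) 0.
    by left; split; [have [_ + _] := Ll; rewrite sp|exact: l0].
  right; exact: (continuous_spectrum_L H_complete H_separable A1_sa A3_sa B1_sqrt B3_sqrt L_extends L_normal l0 Ll).
move=> [[Ll l0]|Ll].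
  exact: (imaginary_continuous H_complete H_separable A1_sa A3_sa B1_sqrt B3_sqrt L_extends L_normal f0 l0 Ll).
exact: (continuous_spectrum_LW2 H_complete H_separable A1_sa A3_sa B1_sqrt B3_sqrt L_extends L_normal Ll).
Qed.
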